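(* Fix a positive integer $s$ and a real number $\alpha$ with $\alpha/(2\pi)\notin\mathbb{Q}$. Let $$\Sigma=\{a=(a_{i,j})_{i,j\ge 0,\ i+j>2s}:\ a_{j,i}=\overline{a_{i,j}},\ |a_{i,j}|<1\},$$ and for $a\in\Sigma$ put $\tilde a(z,\bar z)=\sum_{i+j>2s}a_{i,j}z^i\bar z^j$, $\phi_a(z)=z\,e^{i\tilde a(z,\bar z)}$, $T(z)=z\,e^{i(\alpha+(z\bar z)^s)}$, $\tau(z)=\bar z$, and $$\varphi_a=\phi_a\circ T\circ\tau\circ\phi_a^{-1}\circ\tau,$$ a real analytic map of a neighborhood of $0$ in $\mathbb{R}^2=\mathbb{C}$ fixing $0$ (here $\phi_a^{-1}$ is the local inverse near $0$). Then there exists a sequence $(H_k)_{k\ge1}$ of functionally independent power series in the infinitely many variables $a_{i,j}$, each $H_k$ converging for $a\in\Sigma$, with the following property: if $a\in\Sigma$ is fixed and $H_k(a)\neq 0$ for infinitely many $k$, then there is no convergent (real analytic, locally invertible near $0$) transformation $\Phi$ of $\mathbb{R}^2$ fixing $0$ with $\Phi\circ\varphi_a\circ\Phi^{-1}=T$.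
   Context: A power series in infinitely many variables $a_{i,j}$ is said to converge at a point if it converges absolutely there. The map $\varphi_a$ is reversible with respect to $\tau$ ($\varphi_a^{-1}=\tau\varphi_a\tau$), and $z\bar z$ is invariant under $\varphi_a$. *)

(* Defs.v *)
From HB Require Import structures.
From mathcomp Require Import all_boot all_order all_algebra.
From mathcomp Require Import all_classical all_reals all_analysis.
From mathcomp Require Import fingroup perm complex finmap.
From Stdlib Require Import ClassicalEpsilon.

Set Implicit Arguments.
Unset Strict Implicit.
Unset Printing Implicit Defensive.
Import Order.TTheory GRing.Theory Num.Theory.
Local Open Scope classical_set_scope.
Local Open Scope ring_scope.

Section Defs.
Variable R : realType.
Local Notation C := R[i].

Definition cnorm (z : C) : R := ComplexField.Normc.normc z.
Definition iC : C := Complex 0 1.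
Definition cexp (w : C) : C :=
  ((expR (complex.Re w))%:C)%C * Complex (cos (complex.Im w)) (sin (complex.Im w)).

Definition cvgC (u : nat -> C) (l : C) : Prop :=
  forall e : R, 0 < e -> exists N : nat, forall n, (N <= n)%N -> cnorm (u n - l) < e.
Definition seriesC (u : nat -> C) (l : C) : Prop :=
  cvgC (fun N => \sum_(n < N) u n) l.
Definition sumC (u : nat -> C) : C := epsilon (inhabits 0) (seriesC u).

Definition idx := (nat * nat)%type.
Definition in_idx (s : nat) (v : idx) : bool := (2 * s < v.1 + v.2)%N.

(* Sigma: a_{j,i} = conj a_{i,j}, |a_{i,j}| < 1 for i+j > 2s;
   the entries with i+j <= 2s do not exist and are normalized to 0. *)
Definition inSigma (s : nat) (a : idx -> C) : Prop :=
  (forall i j, in_idx s (i, j) ->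
      a (j, i) = conjc (a (i, j)) /\ cnorm (a (i, j)) < 1) /\
  (forall i j, ~~ in_idx s (i, j) -> a (i, j) = 0).

Definition atilde (s : nat) (a : idx -> C) (z : C) : C :=
  sumC (fun n => if (2 * s < n)%N then
                   \sum_(i < n.+1) a (val i, (n - val i)%N) * z ^+ i * (conjc z) ^+ (n - i)
                 else 0).

Definition phi_a (s : nat) (a : idx -> C) (z : C) : C := z * cexp (iC * atilde s a z).
Definition Tmap (s : nat) (alpha : R) (z : C) : C :=
  z * cexp (iC * ((alpha%:C)%C + (z * conjc z) ^+ s)).
Definition tau (z : C) : C := conjc z.

(* g is the local inverse of f near 0 (a germ; unique as a germ) *)
Definition local_inverse (f g : C -> C) : Prop :=
  g 0 = 0 /\
  (forall e : R, 0 < e -> exists d : R, 0 < d /\ forall z, cnorm z < d -> cnorm (g z) < e) /\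
  exists r : R, 0 < r /\ forall z, cnorm z < r -> f (g z) = z /\ g (f z) = z.

(* varphi_a = phi_a o T o tau o phi_a^{-1} o tau, with phi_a^{-1} := psi *)
Definition varphi_a (s : nat) (alpha : R) (a : idx -> C) (psi : C -> C) (z : C) : C :=
  phi_a s a (Tmap s alpha (tau (psi (tau z)))).

Definition ranalytic0 (F : C -> C) : Prop :=
  exists r : R, 0 < r /\ exists b : nat -> nat -> C,
    (exists M : R, forall N : nat,
        \sum_(n < N) \sum_(k < n.+1) cnorm (b k (n - k)%N) * r ^+ n <= M) /\
    forall z, cnorm z < r ->
      seriesC (fun n => \sum_(k < n.+1) b k (n - k)%N * z ^+ k * (conjc z) ^+ (n - k)) (F z).

Definition analytically_conjugate (F G : C -> C) : Prop :=
  exists Phi Psi : C -> C,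
    Phi 0 = 0 /\ Psi 0 = 0 /\ ranalytic0 Phi /\ ranalytic0 Psi /\
    exists r : R, 0 < r /\ forall w, cnorm w < r ->
      Psi (Phi w) = w /\ Phi (Psi w) = w /\ Phi (F (Psi w)) = G w.

(* a monomial  prod a_{i,j}^{m(i,j)} : an exponent function with finite support *)
Definition mono := idx -> nat.
Definition mono_ok (s : nat) (m : mono) : Prop :=
  finite_set [set v | m v != 0%N] /\ forall v, m v != 0%N -> in_idx s v.
Definition fpseries := mono -> C.
Definition pseries_ok (s : nat) (H : fpseries) : Prop :=
  forall m, H m != 0 -> mono_ok s m.

Definition mono_eval (a : idx -> C) (m : mono) : C :=
  \big[*%R/1]_(v \in [set v | m v != 0%N]) a v ^+ m v.

Definition ps_converges (H : fpseries) (a : idx -> C) : Prop :=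
  exists M : R, forall F : {fset mono}, \sum_(m <- F) cnorm (H m * mono_eval a m) <= M.
Definition ps_sum (H : fpseries) (a : idx -> C) (v : C) : Prop :=
  forall e : R, 0 < e -> exists F0 : {fset mono}, forall F : {fset mono},
    (F0 `<=` F)%fset -> cnorm (\sum_(m <- F) H m * mono_eval a m - v) < e.
Definition ps_nonzero_at (H : fpseries) (a : idx -> C) : Prop :=
  exists v, ps_sum H a v /\ v != 0.

Definition ps_deriv (v : idx) (H : fpseries) : fpseries :=
  fun m => (m v).+1%:R * H (fun w => (m w + (w == v))%N).
Definition ps_prodn (n : nat) (F : 'I_n -> fpseries) : fpseries :=
  fun m => \sum_(t \in [set t : ('I_n -> mono) | forall w, (\sum_(p < n) t p w)%N = m w])
             \prod_(p < n) F p (t p).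
Definition ps_jacdet (n : nat) (H : 'I_n -> fpseries) (x : 'I_n -> idx) : fpseries :=
  fun m => \sum_(sg : 'S_n) (-1) ^+ sg * ps_prodn (fun p => ps_deriv (x (sg p)) (H p)) m.

(* H_1..H_n functionally independent: dH_1 /\ ... /\ dH_n <> 0, i.e. some
   n x n minor of the formal Jacobian matrix is a nonzero power series *)
Definition fun_independent (s : nat) (n : nat) (H : 'I_n -> fpseries) : Prop :=
  exists x : 'I_n -> idx, injective x /\ (forall q, in_idx s (x q)) /\
    exists m, ps_jacdet H x m != 0.

Definition seq_fun_independent (s : nat) (H : nat -> fpseries) : Prop :=
  forall (n : nat) (k : 'I_n -> nat), injective k ->
    fun_independent s (fun p => H (k p)).

End Defs.

(* Main.v *)
(** The map [varphi_a] preserves every circle [|z| = r].  For an odd prime [q] let [2 pi p / q] be the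
    smallest frequency with denominator [q] above [alpha], and consider the orbits of [varphi_a] that
    close up after [q] steps and [p] turns.  Starting from a fixed angle, such an orbit exists on
    exactly one circle near [r0^(2s) = 2 pi p / q - alpha]: its logarithmic radius and its angles are
    the fixed point of a contraction.  Solving this contraction in the Banach algebra of absolutely
    convergent power series in the [a_(i,j)] exhibits the radius as such a series.  Take for [H] the
    difference of the logarithmic radii for the starting angles [0] and [pi].  Its linear part
    contains [a_(q,0)] but no [a_(q',0)] with [q'] another prime, so the Jacobian determinants have
    nonzero constant term.

    If an analytic [Psi] conjugates [varphi_a] to [T], the twist of [T] makes [|Psi|] constant on
    circles, and comparing rotations over long times shows that the image of the circle of [T] of
    frequency [2 pi p / q] is a circle of radius close to [r0].  It consists entirely of
    [q]-periodic points with [p] turns, so both starting angles give the same radius and [H]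
    vanishes, for every large [q]. *)
Require Import Defs.
From HB Require Import structures.
From mathcomp Require Import all_boot all_order all_algebra.
From mathcomp Require Import all_classical all_reals all_analysis.
From mathcomp Require Import fingroup perm complex finmap.
From mathcomp Require Import ring lra zify.
From Stdlib Require Import ClassicalEpsilon.
Set Implicit Arguments.
Unset Strict Implicit.
Unset Printing Implicit Defensive.
Import Order.TTheory GRing.Theory Num.Theory.
Local Open Scope classical_set_scope.
Local Open Scope ring_scope.

(** * Unconditional sums of complex families *)

(** Two features of the problem shape the construction. The local inverse of [phi_a] is a mere germ,
    awkward to expand, so an orbit is recorded through [v = phi_a^{-1}(conj z)]. In this variable a
    step involves only [atilde], at [u = T (conj v)] and at the next [v], and the angle fixed at the
    start is that of [v]. Moreover, coefficients of the series are read off on axes where a single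
    [a_(k,0)] is nonzero, and such points violate the reality condition of Sigma. The equation is
    therefore complexified: [z] and its conjugate become independent arguments, and the estimates
    hold on the polydisc [|a_v| <= 1].

    The contraction survives [q] steps because [atilde] has order at least [2s+1] while the resonant
    radius satisfies [q r0^(2s) <= 8]: the angles accumulated along an orbit are
    [O(q r0^(2s+1)) = O(r0)], and dividing by the derivative of the frequency, of size [r0^(2s)],
    also leaves [O(r0)]. A bound [kappa] on the coefficients is carried along: [kappa = 1] gives the
    series, small [kappa] its linear part. *)

Section ComplexNorm.
Variable R : realType.
Local Notation C := R[i].
Implicit Types (x y z w : C) (I J K : choiceType).

Lemma cnormM x y : cnorm (x * y) = cnorm x * cnorm y.
Proof. exact: ComplexField.Normc.normcM. Qed.

Lemma cnormD x y : cnorm (x + y) <= cnorm x + cnorm y.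
Proof. exact: le_normcD. Qed.

Lemma cnormN x : cnorm (- x) = cnorm x.
Proof. exact: normcN. Qed.

Lemma cnorm0 : cnorm (0 : C) = 0.
Proof. exact: ComplexField.Normc.normc0. Qed.

Lemma cnorm1 : cnorm (1 : C) = 1.
Proof. exact: ComplexField.Normc.normc1. Qed.

Lemma cnorm_ge0 x : 0 <= cnorm x.
Proof. by case: x => a b; rewrite /cnorm /= sqrtr_ge0. Qed.

Lemma cnorm_eq0 x : cnorm x = 0 -> x = 0.
Proof. exact: ComplexField.Normc.eq0_normc. Qed.

Lemma cnorm_gt0 x : x != 0 -> 0 < cnorm x.
Proof.
move=> x0; rewrite lt_neqAle cnorm_ge0 andbT eq_sym.
by apply: contraNneq x0 => /cnorm_eq0 ->.
Qed.

Lemma cnormB x y : cnorm (x - y) <= cnorm x + cnorm y.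
Proof. by rewrite (le_trans (cnormD _ _)) // cnormN. Qed.

Lemma cnormBC x y : cnorm (x - y) = cnorm (y - x).
Proof. by rewrite -cnormN opprB. Qed.

Lemma cnorm_dist x y z : cnorm (x - z) <= cnorm (x - y) + cnorm (y - z).
Proof. by rewrite (_ : x - z = (x - y) + (y - z)) ?cnormD //; ring. Qed.

Lemma cnorm_sub_le x y : cnorm x - cnorm y <= cnorm (x - y).
Proof. by rewrite lerBlDr -{1}(subrK y x) cnormD. Qed.

Lemma cnormV x : cnorm (x^-1) = (cnorm x)^-1.
Proof. exact: ComplexField.Normc.normcV. Qed.

Lemma cnormX x n : cnorm (x ^+ n) = cnorm x ^+ n.
Proof. by elim: n => [|n IH]; rewrite ?expr0 ?cnorm1 // !exprS cnormM IH. Qed.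

Lemma cnorm_sum I (r : seq I) (P : pred I) (F : I -> C) :
  cnorm (\sum_(i <- r | P i) F i) <= \sum_(i <- r | P i) cnorm (F i).
Proof.
elim/big_rec2: _ => [|i a b _ ab]; first by rewrite cnorm0.
by rewrite (le_trans (cnormD _ _)) // lerD2l.
Qed.

Lemma cnormR (t : R) : cnorm (t%:C)%C = `|t|.
Proof. by rewrite /cnorm /= expr0n /= addr0 sqrtr_sqr. Qed.

Lemma cnorm_conj x : cnorm (conjc x) = cnorm x.
Proof. by case: x => a b; rewrite /cnorm /= sqrrN. Qed.

Lemma cnorm_nat n : cnorm (n%:R : C) = n%:R.
Proof.
rewrite (_ : n%:R = ((n%:R : R)%:C)%C); first by rewrite cnormR ger0_norm.
by rewrite rmorph_nat.
Qed.

Lemma cnorm_sqr x : cnorm x ^+ 2 = complex.Re x ^+ 2 + complex.Im x ^+ 2.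
Proof. by case: x => a b; rewrite /cnorm /= sqr_sqrtr // addr_ge0 ?sqr_ge0. Qed.

Lemma mul_conjc x : x * conjc x = ((cnorm x ^+ 2)%:C)%C.
Proof.
rewrite cnorm_sqr; case: x => a b /=; apply/eqP; rewrite eq_complex /=.
by apply/andP; split; apply/eqP; ring.
Qed.

Lemma Re_le_cnorm x : `|complex.Re x| <= cnorm x.
Proof.
rewrite -(@ler_pXn2r _ 2) ?nnegrE ?cnorm_ge0 // cnorm_sqr real_normK ?num_real //.
by rewrite lerDl sqr_ge0.
Qed.

Lemma Im_le_cnorm x : `|complex.Im x| <= cnorm x.
Proof.
rewrite -(@ler_pXn2r _ 2) ?nnegrE ?cnorm_ge0 // cnorm_sqr real_normK ?num_real //.
by rewrite lerDr sqr_ge0.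
Qed.

Lemma cnorm_small x (B : R) : (forall e, 0 < e -> cnorm x <= B + e) -> cnorm x <= B.
Proof. by move=> h; apply/ler_addgt0Pr. Qed.

Lemma cnorm_lt_eq0 x : (forall e, 0 < e -> cnorm x < e) -> x = 0.
Proof.
move=> h; apply: cnorm_eq0; apply/eqP; rewrite eq_le cnorm_ge0 andbT.
by apply: cnorm_small => e /h /ltW; rewrite add0r.
Qed.

End ComplexNorm.

Section UnconditionalSums.
Variable R : realType.
Local Notation C := R[i].
Implicit Types (I J K : choiceType).

Definition bounded_sum I (c : I -> R) (B : R) : Prop :=
  forall F : {fset I}, \sum_(i <- F) c i <= B.

(** Convergence along finite subsets needs no enumeration, so pairs, dependent sums and monomials
    can all serve as indices; [ps_sum] is the instance for a family of monomial terms. *)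
Definition has_sum I (c : I -> C) (l : C) : Prop :=
  forall e : R, 0 < e -> exists F0 : {fset I}, forall F : {fset I},
    (F0 `<=` F)%fset -> cnorm (\sum_(i <- F) c i - l) < e.

Lemma bounded_sum_ge0 I (c : I -> R) B : bounded_sum c B -> 0 <= B.
Proof. by move=> /(_ fset0); rewrite big_seq_fset0. Qed.

Lemma bounded_sum_le I (c : I -> R) B B' :
  bounded_sum c B -> B <= B' -> bounded_sum c B'.
Proof. by move=> h BB F; rewrite (le_trans (h F)). Qed.

Lemma bounded_sum_mono I (c d : I -> R) B :
  (forall i, c i <= d i) -> bounded_sum d B -> bounded_sum c B.
Proof. by move=> cd h F; rewrite (le_trans _ (h F)) // ler_sum. Qed.

Lemma bounded_sumZ I (c : I -> R) B k :
  0 <= k -> bounded_sum c B -> bounded_sum (fun i => k * c i) (k * B).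
Proof. by move=> k0 h F; rewrite -mulr_sumr ler_wpM2l. Qed.

Lemma fset_sum_le I (c : I -> R) (F : {fset I}) (r : seq I) :
  (forall i, 0 <= c i) -> uniq r -> {subset F <= r} ->
  \sum_(i <- F) c i <= \sum_(i <- r) c i.
Proof.
move=> c0 ur Fr.
rewrite [leRHS](bigID (mem F)) /= -[leLHS]addr0 lerD ?sumr_ge0 //.
rewrite -[leRHS]big_filter (perm_big [seq i <- r | i \in F]) //=.
apply: uniq_perm; rewrite ?fset_uniq ?filter_uniq // => i.
by rewrite mem_filter; case: (boolP (i \in F)) => //= /Fr ->.
Qed.

Lemma has_sum_uniq I (c : I -> C) l l' : has_sum c l -> has_sum c l' -> l = l'.
Proof.
move=> h h'; apply/eqP; rewrite -subr_eq0; apply/eqP; apply: cnorm_lt_eq0 => e e0.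
have e20 : 0 < e / 2 by lra.
have [F0 hF] := h _ e20; have [F1 hF'] := h' _ e20.
have := hF (F0 `|` F1)%fset (fsubsetUl _ _).
have := hF' (F0 `|` F1)%fset (fsubsetUr _ _).
set S := \sum_(i <- _) _ => h1 h2.
have := cnorm_dist l S l'; rewrite (cnormBC l S); lra.
Qed.

Lemma eq_has_sum I (c d : I -> C) l : c =1 d -> has_sum c l -> has_sum d l.
Proof. by move=> /funext ->. Qed.

Lemma has_sumD I (c d : I -> C) l m :
  has_sum c l -> has_sum d m -> has_sum (fun i => c i + d i) (l + m).
Proof.
move=> h h' e e0; have e20 : 0 < e / 2 by lra.
have [F0 hF] := h _ e20; have [F1 hF'] := h' _ e20.
exists (F0 `|` F1)%fset => F; rewrite fsubUset => /andP[/hF h1 /hF' h2].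
rewrite big_split /= opprD addrACA (le_lt_trans (cnormD _ _)) //.
by lra.
Qed.

Lemma has_sumZ I (c : I -> C) l k : has_sum c l -> has_sum (fun i => k * c i) (k * l).
Proof.
move=> h e e0; have k0 : 0 < cnorm k + 1 by rewrite ltr_wpDl ?cnorm_ge0.
have [F0 hF] := h _ (divr_gt0 e0 k0).
exists F0 => F /hF h1; rewrite -mulr_sumr -mulrBr cnormM.
move: h1; rewrite ltr_pdivlMr // => h1; apply: le_lt_trans h1.
by rewrite mulrC ler_wpM2l ?cnorm_ge0 // lerDl.
Qed.

Lemma has_sumN I (c : I -> C) l : has_sum c l -> has_sum (fun i => - c i) (- l).
Proof.
by move=> /(has_sumZ (-1)); rewrite mulN1r; apply: eq_has_sum => i; rewrite mulN1r.
Qed.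

Lemma has_sum_finsupp I (c : I -> C) (F0 : {fset I}) :
  (forall i, i \notin F0 -> c i = 0) -> has_sum c (\sum_(i <- F0) c i).
Proof.
move=> c0 e e0; exists F0 => F sF.
rewrite [X in X - _](_ : _ = \sum_(i <- F0) c i) ?subrr ?cnorm0 //.
by apply: esym; apply: big_fset_incl => // i _ /c0.
Qed.

Lemma has_sum0 I : has_sum (fun _ : I => 0) 0.
Proof. by have := @has_sum_finsupp I (fun => 0) fset0 (fun _ _ => erefl); rewrite big_seq_fset0. Qed.

Lemma has_sum_le I (c : I -> C) l B :
  bounded_sum (fun i => cnorm (c i)) B -> has_sum c l -> cnorm l <= B.
Proof.
move=> hB h; apply: cnorm_small => e /h [F0 /(_ F0 (fsubset_refl _)) h1].
have := hB F0; have := cnorm_sum F0 xpredT c.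
have := cnorm_sub_le l (\sum_(i <- F0) c i); rewrite cnormBC; lra.
Qed.

Lemma has_sum_real_nonneg I (r : I -> R) B : (forall i, 0 <= r i) -> bounded_sum r B ->
  exists l : R, has_sum (fun i => (r i)%:C)%C l%:C%C.
Proof.
move=> r0 hB; pose A : set R := [set x | exists F : {fset I}, x = \sum_(i <- F) r i].
have hA : has_sup A.
  split; first by exists 0, fset0; rewrite big_seq_fset0.
  by exists B => _ [F ->]; exact: hB.
exists (sup A) => e e0; have [_ [F0 ->] hF0] := sup_adherent e0 hA.
exists F0 => F sF; rewrite -rmorph_sum -rmorphB cnormR.
have h1 : \sum_(i <- F0) r i <= \sum_(i <- F) r i.
  by apply: fset_sum_le => // i; apply/fsubsetP.
have h2 : \sum_(i <- F) r i <= sup A by apply: sup_upper_bound => //; exists F.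
by rewrite ler0_norm ?subr_le0 //; lra.
Qed.

Lemma has_sum_real I (r : I -> R) B : bounded_sum (fun i => `|r i|) B ->
  exists l : R, has_sum (fun i => (r i)%:C)%C l%:C%C.
Proof.
move=> hB.
have [|i|l1 h1] := @has_sum_real_nonneg I (fun i => Num.max (r i) 0) B.
- by move=> i; rewrite le_max lexx orbT.
- by apply: (bounded_sum_mono _ hB) => j; rewrite ge_max ler_norm normr_ge0.
have [|i|l2 h2] := @has_sum_real_nonneg I (fun i => Num.max (- r i) 0) B.
- by move=> i; rewrite le_max lexx orbT.
- by apply: (bounded_sum_mono _ hB) => j; rewrite ge_max -normrN ler_norm normr_ge0.
exists (l1 - l2); rewrite rmorphB.
apply: eq_has_sum (has_sumD h1 (has_sumN h2)) => i /=.
rewrite -rmorphN -rmorphD; congr (_%:C)%C.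
by case: (leP (r i) 0) => h; case: (leP (- r i) 0) => h'; lra.
Qed.

Lemma has_sum_ex I (c : I -> C) B :
  bounded_sum (fun i => cnorm (c i)) B -> exists l, has_sum c l.
Proof.
move=> hB.
have [l1 h1] : exists l : R, has_sum (fun i => (complex.Re (c i))%:C)%C l%:C%C.
  by apply: (@has_sum_real _ _ B); apply: (bounded_sum_mono _ hB) => i; exact: Re_le_cnorm.
have [l2 h2] : exists l : R, has_sum (fun i => (complex.Im (c i))%:C)%C l%:C%C.
  by apply: (@has_sum_real _ _ B); apply: (bounded_sum_mono _ hB) => i; exact: Im_le_cnorm.
exists (l1%:C%C + 'i%C * l2%:C%C).
by apply: eq_has_sum (has_sumD h1 (has_sumZ 'i%C h2)) => i; rewrite -complexE.
Qed.

(** One finite index set serves finitely many sums at once; it is used to approximate finitely many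
    fibres simultaneously. *)
Lemma has_sum_close I J (s : seq J) (c : J -> I -> C) L :
  (forall j, has_sum (c j) (L j)) -> forall e, 0 < e ->
  exists F0 : {fset I}, forall F, (F0 `<=` F)%fset ->
    \sum_(j <- s) cnorm (\sum_(i <- F) c j i - L j) < e.
Proof.
move=> h; elim: s => [|j s IH] e e0; first by exists fset0 => F _; rewrite big_nil.
have e20 : 0 < e / 2 by lra.
have [F0 hF0] := IH _ e20; have [F1 hF1] := h j _ e20.
exists (F0 `|` F1)%fset => F; rewrite fsubUset => /andP[/hF0 h1 /hF1 h2].
by rewrite big_cons; lra.
Qed.

Section Partition.
Variables (I J : choiceType) (p : I -> J) (c : I -> C) (L : J -> C).
Hypothesis hL : forall j, has_sum (fun i => if p i == j then c i else 0) (L j).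

Lemma sum_fibers (V : zmodType) (d : I -> V) (F : {fset I}) (G : {fset J}) :
  \sum_(j <- G) \sum_(i <- F) (if p i == j then d i else 0) =
  \sum_(i <- F | p i \in G) d i.
Proof.
rewrite exchange_big /= [RHS]big_mkcond /=; apply: eq_bigr => i _.
case: (boolP (p i \in G)) => pG; last first.
  by rewrite big_seq big1 // => j jG; case: eqP => // pj; rewrite -pj (negbTE pG) in jG.
rewrite (big_fsetD1 (p i)) //= eqxx big_seq big1 ?addr0 // => j.
by rewrite !inE => /andP[/negbTE]; rewrite eq_sym => ->.
Qed.

(** Finitely many fibres are approximated on one finite set, enlarged by the set [F0] that controls
    the total. Its part above the chosen fibres still contains [F0]. *)
Lemma has_sum_partition l : has_sum c l -> has_sum L l.
Proof.
move=> h e e0; have e20 : 0 < e / 2 by lra.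
have [F0 hF0] := h _ e20; exists [fset p i | i in F0]%fset => G sG.
have [F1 /(_ (F0 `|` F1)%fset (fsubsetUr _ _))] := has_sum_close G hL e20.
set F := (F0 `|` F1)%fset => h1.
have := cnorm_sum G xpredT (fun j => \sum_(i <- F) (if p i == j then c i else 0) - L j).
rewrite sumrB sum_fibers => h2.
have /hF0 : (F0 `<=` [fset i in F | p i \in G])%fset.
  apply/fsubsetP => i iF; rewrite !inE /= iF /=.
  by apply: (fsubsetP sG); apply/imfsetP; exists i.
rewrite big_fset /= => h3.
set U := \sum_(i <- F | p i \in G) c i in h2 h3.
have := cnorm_dist (\sum_(j <- G) L j) U l; rewrite (cnormBC _ U); lra.
Qed.

Lemma bounded_sum_partition B :
  bounded_sum (fun i => cnorm (c i)) B -> bounded_sum (fun j => cnorm (L j)) B.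
Proof.
move=> hB G; apply/ler_addgt0Pr => e e0.
have [F /(_ _ (fsubset_refl _)) h1] := has_sum_close G hL e0.
have h2 : \sum_(j <- G) cnorm (L j) <=
    \sum_(j <- G) (cnorm (\sum_(i <- F) (if p i == j then c i else 0) - L j) +
     \sum_(i <- F) (if p i == j then cnorm (c i) else 0)).
  apply: ler_sum => j _.
  have := cnorm_sum F xpredT (fun i => if p i == j then c i else 0).
  rewrite [X in _ <= X -> _](eq_bigr (fun i => if p i == j then cnorm (c i) else 0)); last first.
    by move=> i _; case: ifP; rewrite ?cnorm0.
  set S := \sum_(i <- F) _ => h3.
  by have := cnorm_sub_le (L j) S; rewrite cnormBC; lra.
rewrite (le_trans h2) // big_split /= sum_fibers addrC lerD //; last exact: ltW.
rewrite (le_trans _ (hB F)) // [leRHS](bigID (fun i => p i \in G)) /= lerDl sumr_ge0 // => i _.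
exact: cnorm_ge0.
Qed.

End Partition.

(** Reindexing along an injection with extension by zero; the explicit partial inverse [g] lets
    [pmap] compute preimages of finite sets. *)
Lemma has_sum_pinj I J (f : I -> J) (g : J -> option I) (c : I -> C) (d : J -> C) l :
  pcancel f g -> ocancel g f -> (forall j, d j = if g j is Some i then c i else 0) ->
  has_sum c l -> has_sum d l.
Proof.
move=> fg gf dE h e /h [F0 hF0]; exists [fset f i | i in F0]%fset => G sG.
have /hF0 : (F0 `<=` [fset i in pmap g G])%fset.
  apply/fsubsetP => i iF; rewrite !inE mem_pmap -fg map_f //.
  by apply: (fsubsetP sG); apply/imfsetP; exists i.
rewrite (perm_big (pmap g G)) /=; last first.
  apply: uniq_perm; rewrite ?fset_uniq ?(pmap_uniq gf) ?fset_uniq // => i.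
  by rewrite !inE.
suff -> : \sum_(j <- pmap g G) c j = \sum_(j <- G) d j by [].
by elim: (G : seq J) => [|j s IH]; rewrite ?big_nil // /= big_cons dE; case: (g j) => [i|] /=;
  rewrite ?big_cons ?IH ?add0r.
Qed.

Lemma bounded_sum_prod I J (c : I -> R) (d : J -> R) B B' :
  (forall i, 0 <= c i) -> (forall j, 0 <= d j) -> bounded_sum c B -> bounded_sum d B' ->
  bounded_sum (fun u : I * J => c u.1 * d u.2) (B * B').
Proof.
move=> c0 d0 hc hd F.
pose F1 := [fset u.1 | u in F]%fset; pose F2 := [fset u.2 | u in F]%fset.
have F12 : {subset F <= [seq (i, j) | i <- F1, j <- F2]}.
  move=> [i j] u; apply/allpairsP; exists (i, j); split => //=.
    by apply/imfsetP; exists (i, j).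
  by apply/imfsetP; exists (i, j).
rewrite (le_trans (fset_sum_le _ _ F12)) //.
- by move=> u; rewrite mulr_ge0.
- by apply: allpairs_uniq; rewrite ?fset_uniq // => -[? ?] [? ?].
rewrite big_allpairs /= -[leLHS](_ : (\sum_(i <- F1) c i) * (\sum_(j <- F2) d j) = _).
  by apply: ler_pM; rewrite ?sumr_ge0.
by rewrite mulr_suml; apply: eq_bigr => i _; rewrite mulr_sumr.
Qed.

Lemma has_sum_prod I J (c : I -> C) (d : J -> C) B B' l m :
  bounded_sum (fun i => cnorm (c i)) B -> bounded_sum (fun i => cnorm (d i)) B' ->
  has_sum c l -> has_sum d m -> has_sum (fun u : I * J => c u.1 * d u.2) (l * m).
Proof.
move=> hB hB' hc hd.
have bcd : bounded_sum (fun u : I * J => cnorm (c u.1 * d u.2)) (B * B').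
  apply: bounded_sum_mono (bounded_sum_prod _ _ hB hB') => *; rewrite ?cnormM //;
  exact: cnorm_ge0.
have [k hk] := has_sum_ex bcd.
suff hL : forall i, has_sum (fun u : I * J => if u.1 == i then c u.1 * d u.2 else 0) (c i * m).
  have h1 := has_sum_partition hL hk.
  suff -> : l * m = k by [].
  apply: has_sum_uniq _ h1; rewrite mulrC.
  by apply: eq_has_sum (has_sumZ m hc) => i; rewrite mulrC.
move=> i; apply: (@has_sum_pinj _ _ (pair i) (fun u : I * J => if u.1 == i then Some u.2 else None)
   (fun j => c i * d j)) (has_sumZ _ hd).
- by move=> j /=; rewrite eqxx.
- by move=> [i' j] /=; case: eqP => [->|].
- by move=> [i' j] /=; case: eqP => [->|].
Qed.

(** The index is a dependent sum because each member of a family of expansions comes with its own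
    index type. *)
Lemma bounded_sum_sigma J (T : J -> choiceType) (c : forall j, T j -> R) (B : J -> R) B' :
  (forall j i, 0 <= c j i) -> (forall j, bounded_sum (c j) (B j)) -> bounded_sum B B' ->
  bounded_sum (fun u : {j : J & T j} => c (tag u) (tagged u)) B'.
Proof.
move=> c0 hc hB F; pose G := [fset tag u | u in F]%fset.
rewrite (le_trans _ (hB G)) // [leLHS](_ : _ = \sum_(j <- G) \sum_(u <- F | tag u == j)
   c (tag u) (tagged u)); last first.
  transitivity (\sum_(u <- F | tag u \in G) c (tag u) (tagged u)).
    by rewrite big_seq [RHS]big_seq_cond; apply: eq_bigl => u; case: (boolP (u \in F)) => //= uF;
      rewrite (_ : _ \in _) //; apply/imfsetP; exists u.
  rewrite -sum_fibers; apply: eq_bigr => j _; by rewrite [RHS]big_mkcond.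
apply: ler_sum => j _.
pose g := fun u : {j : J & T j} => untag None (@Some (T j)) u.
have gK : ocancel g (Tagged T (i := j)).
  move=> u; rewrite /g /untag; case: eqP => [ju|//] /=; exact: etaggedK.
have gT i : g (Tagged T i) = Some i.
  rewrite /g /untag; case: eqP => //= e.
  by rewrite (eq_irrelevance e (erefl j)).
rewrite (le_trans _ (hc j [fset i in pmap g F]%fset)) //.
rewrite [leRHS](perm_big (pmap g F)) /=; last first.
  apply: uniq_perm; rewrite ?fset_uniq ?(pmap_uniq gK) ?fset_uniq // => i.
  by rewrite !inE.
rewrite le_eqVlt; apply/orP; left; apply/eqP.
elim: (F : seq _) => [|u s IH]; rewrite ?big_nil // big_cons IH /=.
case: eqP => [uj|uj].
  by case: u uj => j' i /= uj; case: j / uj g gK gT IH => g gK gT IH; rewrite gT /= big_cons.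
by rewrite /g (untag_dflt _ _) //; apply/eqP.
Qed.

Lemma has_sum_sigma_fiber J (T : J -> choiceType) (c : forall j, T j -> C) j l :
  has_sum (c j) l ->
  has_sum (fun u : {j : J & T j} => if tag u == j then c (tag u) (tagged u) else 0) l.
Proof.
apply: (@has_sum_pinj _ _ (Tagged T (i := j)) (fun u => untag None (@Some (T j)) u)).
- by move=> i; rewrite /untag; case: eqP => //= e; rewrite (eq_irrelevance e (erefl j)).
- by move=> u; rewrite /untag; case: eqP => [ju|//] /=; exact: etaggedK.
- move=> [j' i] /=; rewrite /untag; case: eqP => //= e; case: j / e => /=.
  by [].
Qed.

Lemma has_sum_nat (c : nat -> C) l : has_sum c l -> seriesC c l.
Proof.
move=> h e /h [F0 hF0]; exists (\max_(i <- F0) i)%N.+1 => n hn.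
have /hF0 : (F0 `<=` [fset i in iota 0 n])%fset.
  apply/fsubsetP => i iF; rewrite !inE mem_iota /= add0n.
  by apply: leq_trans _ hn; rewrite ltnS; exact: (@leq_bigmax_seq _ (enum_fset F0) xpredT id i iF isT).
rewrite (perm_big (iota 0 n)) /=; last first.
  by apply: uniq_perm; rewrite ?fset_uniq ?iota_uniq // => i; rewrite !inE.
by rewrite -{1}(subn0 n) -/(index_iota 0 n) big_mkord.
Qed.

Lemma cvgC_uniq (u : nat -> C) l l' : cvgC u l -> cvgC u l' -> l = l'.
Proof.
move=> h h'; apply/eqP; rewrite -subr_eq0; apply/eqP; apply: cnorm_lt_eq0 => e e0.
have e20 : 0 < e / 2 by lra.
have [n0 h1] := h _ e20; have [n1 h2] := h' _ e20.
have := h1 (maxn n0 n1) (leq_maxl _ _); have := h2 (maxn n0 n1) (leq_maxr _ _).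
set S := u _ => h3 h4.
have := cnorm_dist l S l'; rewrite (cnormBC l S); lra.
Qed.

Lemma seriesC_uniq (c : nat -> C) l l' : seriesC c l -> seriesC c l' -> l = l'.
Proof. exact: cvgC_uniq. Qed.

Lemma bounded_sum_nat (c : nat -> R) B : (forall n, 0 <= c n) ->
  (forall n, \sum_(i < n) c i <= B) -> bounded_sum c B.
Proof.
move=> c0 h F; rewrite (le_trans _ (h (\max_(i <- F) i)%N.+1)) //.
rewrite -[leRHS](big_mkord xpredT c); apply: fset_sum_le => // [|i iF]; first exact: iota_uniq.
by rewrite mem_index_iota /= ltnS; exact: (@leq_bigmax_seq _ (enum_fset F) xpredT id i iF isT).
Qed.

Definition sumI I (c : I -> C) : C := epsilon (inhabits 0) (has_sum c).

Lemma sumIP I (c : I -> C) B :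
  bounded_sum (fun i => cnorm (c i)) B -> has_sum c (sumI c).
Proof. by move=> /has_sum_ex h; exact: epsilon_spec h. Qed.

Lemma sumIE I (c : I -> C) l : has_sum c l -> sumI c = l.
Proof.
move=> h; have h' := epsilon_spec (inhabits 0) (has_sum c) (ex_intro _ l h).
exact: has_sum_uniq h' h.
Qed.

End UnconditionalSums.

(** * The complex exponential *)

Section ComplexExponential.
Import numFieldNormedType.Exports.
Variable R : realType.
Local Notation C := R[i].
Implicit Types (u v z : C) (x y t : R).

(** Supplies [has_sum_partition] with the fibres of [i + j]: a double family becomes a series by
    total degree, as in [atilde] and [ranalytic0], and products become Cauchy products. *)
Lemma has_sum_antidiag (d : nat * nat -> C) n :
  has_sum (fun w : nat * nat => if (w.1 + w.2 == n)%N then d w else 0)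
    (\sum_(i < n.+1) d (val i, n - val i)%N).
Proof.
pose s := [seq (i, n - i)%N | i <- iota 0 n.+1].
have us : uniq s by rewrite map_inj_uniq ?iota_uniq // => i j [].
have -> : \sum_(i < n.+1) d (val i, n - val i)%N =
   \sum_(v <- [fset v in s]%fset) (if (v.1 + v.2 == n)%N then d v else 0).
  rewrite [RHS](perm_big s) /=; last by apply: uniq_perm; rewrite ?fset_uniq // => i; rewrite !inE.
  rewrite big_map -[iota 0 n.+1]/(index_iota 0 n.+1) big_mkord.
  by apply: eq_bigr => i _ /=; rewrite subnKC ?eqxx // -ltnS.
apply: has_sum_finsupp => -[i j] hn; case: ifP => // /eqP /= ijn; exfalso.
move/negP: hn; apply; rewrite !inE.
have : (i, j) \in s by apply/mapP; exists i; [rewrite mem_iota; lia|congr pair; lia].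

by rewrite !inE.
Qed.

Lemma seriesC_real (f : nat -> R) (l : R) :
  (series f @ \oo --> l)%classic -> seriesC (fun n => (f n)%:C%C) l%:C%C.
Proof.
move=> /cvgrPdist_lt h e /h [N _ hN]; exists N => n /hN /=.
by rewrite -rmorph_sum -rmorphB cnormR distrC /series /= big_mkord.
Qed.

Lemma expR_partial_sum t n : 0 <= t -> \sum_(i < n) t ^+ i / i`!%:R <= expR t.
Proof.
move=> t0; rewrite -(big_mkord xpredT (fun i => t ^+ i / i`!%:R)).
apply: (nondecreasing_cvgn_le _ (is_cvg_series_exp_coeff t)).
by apply: nondecreasing_series => i _ _; rewrite divr_ge0 // exprn_ge0.
Qed.

Lemma bounded_sum_exp t : 0 <= t -> bounded_sum (fun n => t ^+ n / n`!%:R) (expR t).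
Proof.
move=> t0; apply: bounded_sum_nat => n; first by rewrite divr_ge0 // exprn_ge0.
exact: expR_partial_sum.
Qed.

Lemma bounded_cexp_series u : bounded_sum (fun n => cnorm (u ^+ n / n`!%:R)) (expR (cnorm u)).
Proof.
apply: bounded_sum_mono (bounded_sum_exp (cnorm_ge0 u)) => n.
by rewrite cnormM cnormX cnormV cnorm_nat.
Qed.

Lemma cexp_real x : cexp x%:C%C = (expR x)%:C%C.
Proof. by rewrite /cexp /= cos0 sin0 mulr1. Qed.

Lemma cexp_imag y : cexp (iC R * y%:C%C) = (cos y)%:C%C + iC R * (sin y)%:C%C.
Proof.
rewrite /cexp /iC /= !(mul0r, mul1r, mulr0, subr0, addr0, add0r) oppr0 expR0.
by rewrite mul1r; apply/eqP; rewrite eq_complex /= !(mul0r, mul1r, mulr0, subr0, addr0, add0r) !eqxx.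
Qed.

Lemma cexpD u v : cexp (u + v) = cexp u * cexp v.
Proof.
case: u => a b; case: v => c d; rewrite /cexp /= expRD cosD sinD.
by apply/eqP; rewrite eq_complex /=; apply/andP; split; apply/eqP; ring.
Qed.

Lemma iCC : iC R * iC R = -1.
Proof. by apply/eqP; rewrite eq_complex /= !(mul0r, mul1r, mulr0, subr0, addr0, add0r) !eqxx oppr0 eqxx. Qed.

Lemma iCX n : iC R ^+ n = (if odd n then iC R else 1) * (-1) ^+ n./2.
Proof.
rewrite -{1}(odd_double_half n) exprD -muln2 mulnC exprM expr2 iCC.
by case: (odd n).
Qed.

Lemma complex_decomp u : u = (complex.Re u)%:C%C + iC R * (complex.Im u)%:C%C.
Proof. exact: complexE. Qed.

Lemma has_sum_cexp_real x : has_sum (fun n => x%:C%C ^+ n / n`!%:R) (cexp x%:C%C).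
Proof.
have [l hl] := has_sum_ex (bounded_cexp_series x%:C%C).
suff -> : cexp x%:C%C = l by [].
rewrite cexp_real; apply: seriesC_uniq (has_sum_nat hl).
have := seriesC_real (is_cvg_series_exp_coeff x).
congr (seriesC _ _); apply/funext => n.
by rewrite /exp_coeff /= rmorphM rmorphXn fmorphV rmorph_nat.
Qed.

Lemma has_sum_cexp_imag y :
  has_sum (fun n => (iC R * y%:C%C) ^+ n / n`!%:R) (cexp (iC R * y%:C%C)).
Proof.
have [l hl] := has_sum_ex (bounded_cexp_series (iC R * y%:C%C)).
suff -> : cexp (iC R * y%:C%C) = l by [].
rewrite cexp_imag; apply: seriesC_uniq (has_sum_nat hl).
have hc : (series (cos_coeff y) @ \oo --> cos y)%classic.
  by rewrite cos.unlock; exact: is_cvg_series_cos_coeff.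
have hs : (series (sin_coeff y) @ \oo --> sin y)%classic.
  by rewrite sin.unlock; exact: is_cvg_series_sin_coeff.
move=> e e0; have e20 : 0 < e / 2 by lra.
have [N1 h1] := seriesC_real hc e20; have [N2 h2] := seriesC_real hs e20.
exists (maxn N1 N2) => n; rewrite geq_max => /andP[/h1 {}h1 /h2 {}h2].
rewrite (eq_bigr (fun i : 'I_n => (cos_coeff y i)%:C%C + iC R * (sin_coeff y i)%:C%C)); last first.
  move=> i _; rewrite exprMn iCX /cos_coeff /sin_coeff /=.
  have N1X k : ((-1) ^+ k)%:C%C = (-1) ^+ k :> C.
    by elim: k => [|k IH]; rewrite ?expr0 // !exprS !mulN1r rmorphN /= IH.
  have half_pred (k : nat) : odd k -> k.-1./2 = k./2.
    by case: k => //= k; rewrite uphalf_half => /negbTE ->.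
  have yE : (y%:C%C ^+ i / i`!%:R) = ((y ^+ i / i`!%:R)%:C)%C :> C.
    by rewrite rmorphM rmorphXn fmorphV rmorph_nat.
  case: (boolP (odd i)) => oi /=.
    rewrite half_pred // mul1r !mul0r add0r -!mulrA yE; congr (_ * _).
    by rewrite [in RHS]rmorphM /= N1X.
  rewrite !mul0r mulr0 addr0 !mul1r -!mulrA yE [in RHS]rmorphM; congr (_ * _).
  by rewrite -exprnP /= N1X.
rewrite big_split /= -mulr_sumr opprD addrACA -mulrBr (le_lt_trans (cnormD _ _)) //.
rewrite cnormM (_ : cnorm (iC R) = 1) ?mul1r; first by lra.
by rewrite /cnorm /= expr0n /= add0r expr1n sqrtr1.
Qed.

(** The series is known on the real and the imaginary axis; the Cauchy product and the binomial
    formula carry it to their sum. *)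
Lemma has_sum_cexp u : has_sum (fun n => u ^+ n / n`!%:R) (cexp u).
Proof.
have [l hl] := has_sum_ex (bounded_cexp_series u).
suff -> : cexp u = l by [].
set x := complex.Re u; set y := complex.Im u.
have hp := has_sum_prod (bounded_cexp_series _) (bounded_cexp_series _)
  (has_sum_cexp_real x) (has_sum_cexp_imag y).
rewrite (complex_decomp u) cexpD; apply: has_sum_uniq hl.
apply: eq_has_sum (has_sum_partition (fun n => has_sum_antidiag _ n) hp) => n /=.
rewrite [u in RHS]complex_decomp addrC exprDn mulr_suml; apply: eq_bigr => i _.
have fn0 k : k`!%:R != 0 :> C by rewrite pnatr_eq0 -lt0n fact_gt0.
have := bin_fact (ltn_ord i : i <= n)%N => /(congr1 (fun k => k%:R : C)).
rewrite !natrM -mulr_natr => <-; field.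
by rewrite !fn0 pnatr_eq0 -lt0n bin_gt0 -ltnS ltn_ord.
Qed.

Lemma cnorm_cexp u : cnorm (cexp u) = expR (complex.Re u).
Proof.
rewrite /cexp cnormM cnormR ger0_norm ?expR_ge0 //.
by rewrite /cnorm /= cos2Dsin2 sqrtr1 mulr1.
Qed.

Lemma cexp0 : cexp (0 : C) = 1.
Proof. by rewrite (_ : 0 = (0 : R)%:C%C) // cexp_real expR0. Qed.

Lemma cexpMn u n : cexp (n%:R * u) = cexp u ^+ n.
Proof.
elim: n => [|n IH]; first by rewrite mul0r cexp0 expr0.
by rewrite -natr1 mulrDl mul1r cexpD IH exprSr.
Qed.

Lemma cexpN u : cexp (- u) = (cexp u)^-1.
Proof.
have : cexp u * cexp (- u) = 1 by rewrite -cexpD subrr cexp0.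
move=> h; have u0 : cexp u != 0.
  by apply/eqP => h0; move: h; rewrite h0 mul0r => /eqP; rewrite eq_sym oner_eq0.
by apply: (mulfI u0); rewrite h divff.
Qed.

Lemma cexp_neq0 u : cexp u != 0.
Proof.
apply/eqP => h; have := cnorm_cexp u; rewrite h cnorm0 => /eqP.
by rewrite eq_sym expR_eq0.
Qed.

End ComplexExponential.

(* sealed, so that rewriting and [ring] do not look inside *)
HB.lock Definition cis (R : realType) (t : R) : R[i] := cexp (iC R * t%:C%C).

Section UnitCircle.
Variable R : realType.
Local Notation C := R[i].
Implicit Types x y t : R.

Lemma cexp_iC t : cexp (iC R * t%:C%C) = cis t.
Proof. by rewrite cis.unlock. Qed.

Lemma cnorm_cis t : cnorm (cis t) = 1.
Proof. by rewrite -!cexp_iC cnorm_cexp /iC /= !(mul0r, mulr0) subr0 expR0. Qed.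

Lemma cisD x y : cis (x + y) = cis x * cis y.
Proof. by rewrite -!cexp_iC rmorphD mulrDr cexpD. Qed.

Lemma cis0 : cis (0 : R) = 1.
Proof. by rewrite -!cexp_iC rmorph0 mulr0 cexp0. Qed.

Lemma cisN x : cis (- x) = (cis x)^-1.
Proof. by rewrite -!cexp_iC rmorphN mulrN cexpN. Qed.

Lemma cisE t : cis t = Complex (cos t) (sin t).
Proof. by rewrite -!cexp_iC cexp_imag; apply/eqP; rewrite eq_complex /iC /= !(mul0r, mul1r, mulr0, subr0, addr0, add0r) !eqxx. Qed.

Lemma conjc_cis t : conjc (cis t) = cis (- t).
Proof. by rewrite !cisE cosN sinN. Qed.

Lemma cisX t n : cis t ^+ n = cis (n%:R * t).
Proof. by rewrite -!cexp_iC -cexpMn rmorphM rmorph_nat mulrCA. Qed.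

Lemma cis_neq0 t : cis t != 0.
Proof. by rewrite -cexp_iC cexp_neq0. Qed.

Lemma cis_pi : cis (pi : R) = -1.
Proof. by rewrite cisE cospi sinpi; apply/eqP; rewrite eq_complex /= !eqxx oppr0 eqxx. Qed.

Lemma cis_2pi : cis (2 * pi : R) = 1.
Proof. by rewrite -cisX cis_pi sqrrN expr1n. Qed.

End UnitCircle.

(** * Absolutely convergent expansions in the coefficients *)

Section MonomialExpansions.
Variables (R : realType) (s : nat).
Local Notation C := R[i].
Implicit Types (a : idx -> C) (m : mono) (f g : (idx -> C) -> C) (B : R).

(** Any finite set containing the support may replace it, so that several monomials can be evaluated
    over a common set. *)
Lemma mono_evalE a m (F : {fset idx}) :
  (forall v, m v != 0%N -> v \in F) -> mono_eval a m = \prod_(v <- F) a v ^+ m v.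
Proof.
move=> mF; apply: fsbig_fwiden; rewrite ?fset_uniq //.
by move=> v [_ /= /negP]; rewrite negbK => /eqP ->; rewrite expr0.
Qed.

Lemma mono_ok_fset m : mono_ok s m -> exists F : {fset idx}, forall v, m v != 0%N -> v \in F.
Proof.
move=> [/finite_fsetP [F hF] _]; exists F => v mv.
have : [set v | m v != 0%N] v by [].
by rewrite hF.
Qed.

Lemma mono_ok_add m m' : mono_ok s m -> mono_ok s m' -> mono_ok s (fun v => m v + m' v)%N.
Proof.
move=> [h1 h2] [h1' h2']; split; last first.
  by move=> v; rewrite addn_eq0 negb_and => /orP[/h2|/h2'].
have h : finite_set ([set v | m v != 0%N] `|` [set v | m' v != 0%N]) by rewrite finite_setU.
by apply: sub_finite_set h => v /=; rewrite addn_eq0 negb_and => /orP[]; [left|right].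
Qed.

Lemma mono_eval_add a m m' : mono_ok s m -> mono_ok s m' ->
  mono_eval a (fun v => m v + m' v)%N = mono_eval a m * mono_eval a m'.
Proof.
move=> /mono_ok_fset [F hF] /mono_ok_fset [F' hF'].
rewrite !(@mono_evalE _ _ (F `|` F')%fset) -?big_split /=.
- by apply: eq_bigr => v _; rewrite exprD.
- by move=> v /hF'; rewrite inE orbC => ->.
- by move=> v /hF; rewrite inE => ->.
- by move=> v; rewrite addn_eq0 negb_and inE => /orP[/hF|/hF'] ->; rewrite ?orbT.
Qed.

Lemma mono_ok0 : mono_ok s (fun=> 0%N).
Proof. by split=> //; rewrite (_ : [set _ | _] = set0) //; apply/seteqP; split. Qed.

Lemma mono_eval0 a : mono_eval a (fun=> 0%N) = 1.
Proof. by rewrite (@mono_evalE _ _ fset0) ?big_seq_fset0. Qed.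

Lemma mono_ok1 v : in_idx s v -> mono_ok s (fun w => (w == v)%N).
Proof.
move=> sv; split; last by move=> w; rewrite eqb0 negbK => /eqP ->.
by apply: sub_finite_set (finite_set1 v) => w /=; rewrite eqb0 negbK => /eqP ->.
Qed.

Lemma mono_eval1 a v : mono_eval a (fun w => (w == v)%N) = a v.
Proof.
rewrite (@mono_evalE _ _ [fset v]%fset) ?big_seq_fset1 ?eqxx ?expr1 // => w.
by rewrite eqb0 negbK inE.
Qed.

Definition polydisc a : Prop := forall v, cnorm (a v) <= 1.

Lemma cnorm_mono_eval a m : polydisc a -> cnorm (mono_eval a m) <= 1.
Proof.
move=> ha; rewrite /mono_eval; elim/big_rec: _ => [|v x _ hx]; first by rewrite cnorm1.
rewrite cnormM cnormX mulr_ile1 ?exprn_ge0 ?cnorm_ge0 //.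
by rewrite exprn_ile1 ?cnorm_ge0.
Qed.

(* [f] is given on the closed polydisc by a monomial expansion of total mass at most [B]:
   the norm of the Banach algebra of absolutely convergent power series in the [a_v] *)
Definition absrep f B : Prop :=
  exists (I : choiceType) (c : I -> C) (w : I -> mono),
  [/\ forall i, mono_ok s (w i), bounded_sum (fun i => cnorm (c i)) B &
      forall a, polydisc a -> has_sum (fun i => c i * mono_eval a (w i)) (f a)].

Lemma bounded_sum_eval (I : choiceType) (c : I -> C) (w : I -> mono) a B :
  polydisc a -> bounded_sum (fun i => cnorm (c i)) B ->
  bounded_sum (fun i => cnorm (c i * mono_eval a (w i))) B.
Proof.
move=> ha; apply: bounded_sum_mono => i.
by rewrite cnormM ler_piMr ?cnorm_ge0 ?cnorm_mono_eval.
Qed.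

Lemma absrep_bound f B a : absrep f B -> polydisc a -> cnorm (f a) <= B.
Proof.
move=> [I [c [w [_ hB h]]]] ha.
exact: has_sum_le (bounded_sum_eval w ha hB) (h a ha).
Qed.

Lemma absrep_ge0 f B : absrep f B -> 0 <= B.
Proof. by move=> [I [c [w [_ hB _]]]]; exact: bounded_sum_ge0 hB. Qed.

Lemma absrep_le f B B' : absrep f B -> B <= B' -> absrep f B'.
Proof.
move=> [I [c [w [hw hB h]]]] BB; exists I, c, w; split => //.
exact: bounded_sum_le hB BB.
Qed.

Lemma eq_absrep f g B : (forall a, polydisc a -> f a = g a) -> absrep f B -> absrep g B.
Proof.
move=> fg [I [c [w [hw hB h]]]]; exists I, c, w; split => // a ha.
by rewrite -fg //; exact: h.
Qed.

Lemma absrep_eqle f g B B' :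
  absrep f B -> (forall a, polydisc a -> f a = g a) -> B <= B' -> absrep g B'.
Proof. by move=> hf fg; apply: absrep_le; exact: eq_absrep hf. Qed.

Lemma bounded_sum_unit (x : R) : 0 <= x -> bounded_sum (fun _ : unit => x) x.
Proof.
move=> x0 F; rewrite (le_trans (@fset_sum_le _ _ _ _ [:: tt] _ _ _)) ?big_seq1 //.
Qed.

Lemma has_sum_unit (c : unit -> C) : has_sum c (c tt).
Proof.
have := @has_sum_finsupp R _ c [fset tt]%fset; by rewrite big_seq_fset1; apply => -[]; rewrite inE.
Qed.

Lemma absrep_cst (x : C) : absrep (fun=> x) (cnorm x).
Proof.
exists unit, (fun=> x), (fun=> fun=> 0%N); split.
- by move=> _; exact: mono_ok0.
- exact/bounded_sum_unit/cnorm_ge0.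
- by move=> a _; rewrite mono_eval0 mulr1; exact: (has_sum_unit (fun=> x)).
Qed.

Lemma absrep0 : absrep (fun=> 0) 0.
Proof. by have := absrep_cst 0; rewrite cnorm0. Qed.

Lemma absrep_coord v : in_idx s v -> absrep (fun a => a v) 1.
Proof.
move=> sv; exists unit, (fun=> 1), (fun=> fun w => (w == v)%N); split.
- by move=> _; exact: mono_ok1.
- by rewrite cnorm1; exact/bounded_sum_unit.
- by move=> a _; rewrite mono_eval1 mul1r; exact: (has_sum_unit (fun=> a v)).
Qed.

(** Pairs index the product and equal monomials stay apart; they are collected only in
    [absrep_expands], which spares the algebra laws any convolution. *)
Lemma absrepM f g B B' : absrep f B -> absrep g B' -> absrep (fun a => f a * g a) (B * B').
Proof.
move=> [I [c [w [hw hB h]]]] [I' [c' [w' [hw' hB' h']]]].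
exists (I * I')%type, (fun u => c u.1 * c' u.2), (fun u v => (w u.1 v + w' u.2 v)%N); split.
- by move=> u; exact: mono_ok_add.
- apply: bounded_sum_mono (bounded_sum_prod _ _ hB hB') => *; rewrite ?cnormM //;
  exact: cnorm_ge0.
- move=> a ha.
  have := has_sum_prod (bounded_sum_eval w ha hB) (bounded_sum_eval w' ha hB') (h a ha) (h' a ha).
  by apply: eq_has_sum => u /=; rewrite mono_eval_add // mulrACA.
Qed.

(** Completeness of the algebra: members with summable norms may be summed. An expansion of each
    member is chosen and their index types are assembled in a dependent sum. *)
Lemma absrep_family (J : choiceType) (f : J -> (idx -> C) -> C) (B : J -> R) B' g :
  (forall j, absrep (f j) (B j)) -> bounded_sum B B' ->
  (forall a, polydisc a -> has_sum (fun j => f j a) (g a)) -> absrep g B'.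
Proof.
move=> hf hB hg.
pose I j : choiceType := sval (cid (hf j)); have hI j := svalP (cid (hf j)).
pose c j : I j -> C := sval (cid (hI j)); have hc j := svalP (cid (hI j)).
pose w j : I j -> mono := sval (cid (hc j)); have hw j := svalP (cid (hc j)).
pose c' (u : {j : J & I j}) := c (tag u) (tagged u).
pose w' (u : {j : J & I j}) := w (tag u) (tagged u).
exists {j : J & I j}, c', w'.
have hB' : bounded_sum (fun u => cnorm (c' u)) B'.
  apply: (@bounded_sum_sigma _ _ _ (fun j i => cnorm (c j i)) B) => //.
    by move=> *; exact: cnorm_ge0.
  by move=> j; have [] := hw j.
split => //; first by move=> u; have [h _ _] := hw (tag u); exact: h.
move=> a ha; have [l hl] := has_sum_ex (bounded_sum_eval w' ha hB').
suff -> : g a = l by [].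
apply: has_sum_uniq (hg a ha) _.
apply: (has_sum_partition (p := tag)) hl => j.
have [_ _ /(_ a ha) h] := hw j.
exact: (@has_sum_sigma_fiber R J I (fun j i => c j i * mono_eval a (w j i)) j).
Qed.

Lemma absrepD f g B B' : absrep f B -> absrep g B' -> absrep (fun a => f a + g a) (B + B').
Proof.
move=> hf hg.
apply: (@absrep_family bool (fun b => if b then f else g) (fun b => if b then B else B')).
- by case.
- move=> F; rewrite (le_trans (@fset_sum_le _ _ _ F [:: true; false] _ _ _)) //.
  + by case; [exact: absrep_ge0 hf|exact: absrep_ge0 hg].
  + by move=> [].
  + by rewrite big_cons big_seq1.
- move=> a _.
  have := @has_sum_finsupp R _ (fun b : bool => (if b then f else g) a) [fset true; false]%fset.
  rewrite big_fsetU1 ?big_seq_fset1 ?inE //=; apply => -[] /=; by rewrite !inE.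
Qed.

Lemma absrepZ (k : C) f B : absrep f B -> absrep (fun a => k * f a) (cnorm k * B).
Proof. exact: absrepM (absrep_cst k). Qed.

Lemma absrepN f B : absrep f B -> absrep (fun a => - f a) B.
Proof.
move=> /(absrepZ (-1)); rewrite cnormN cnorm1 mul1r.
by apply: eq_absrep => a _; rewrite mulN1r.
Qed.

Lemma absrepB f g B B' : absrep f B -> absrep g B' -> absrep (fun a => f a - g a) (B + B').
Proof. by move=> hf /absrepN; exact: absrepD. Qed.

Lemma absrepX f B n : absrep f B -> absrep (fun a => f a ^+ n) (B ^+ n).
Proof.
move=> hf; elim: n => [|n IH]; first by have := absrep_cst 1; rewrite cnorm1.
by rewrite exprS; apply: eq_absrep (absrepM hf IH) => a _; rewrite exprS.
Qed.

Lemma absrep_sum (I : Type) (r : seq I) (P : pred I) (f : I -> (idx -> C) -> C) (B : I -> R) :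
  (forall i, P i -> absrep (f i) (B i)) ->
  absrep (fun a => \sum_(i <- r | P i) f i a) (\sum_(i <- r | P i) B i).
Proof.
move=> h; elim: r => [|i r IH].
  by rewrite big_nil; apply: eq_absrep absrep0 => a _; rewrite big_nil.
rewrite big_cons; case: (boolP (P i)) => Pi.
  by apply: eq_absrep (absrepD (h i Pi) IH) => a _; rewrite big_cons Pi.
by apply: eq_absrep IH => a _; rewrite big_cons (negbTE Pi).
Qed.

End MonomialExpansions.

(** * Exponentials, powers and power series in the algebra of expansions *)

Section ExpansionCalculus.
Variables (R : realType) (s : nat).
Local Notation C := R[i].
Local Notation pt := (idx -> C).
Local Notation absrep := (@absrep R s).
Implicit Types (a : pt) (u z y : pt -> C) (B M d : R).

Lemma expR_sub1_le B : 0 <= B <= 1 / 2 -> expR B - 1 <= 2 * B.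
Proof.
move=> /andP[B0 B1]; have h := expR_ge1Dx (- B); rewrite expRN in h.
have e0 := expR_gt0 B.
have : (1 - B) * expR B <= 1 by rewrite -ler_pdivlMr // div1r.
nra.
Qed.

Lemma expR_sub1B_le B : 0 <= B <= 1 / 2 -> expR B - 1 - B <= 2 * B ^+ 2.
Proof.
move=> /andP[B0 B1]; have h := expR_ge1Dx (- B); rewrite expRN in h.
have e0 := expR_gt0 B.
have : (1 - B) * expR B <= 1 by rewrite -ler_pdivlMr // div1r.
nra.
Qed.

Lemma has_sum_head k (c : nat -> C) :
  has_sum (fun n : nat => if (n < k)%N then c n else 0) (\sum_(n < k) c n).
Proof.
have -> : \sum_(n < k) c n =
    \sum_(n <- [fset i in index_iota 0 k]%fset) (if (n < k)%N then c n else 0).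
  rewrite (perm_big (index_iota 0 k)) /=; last first.
    by apply: uniq_perm; rewrite ?fset_uniq ?iota_uniq // => i; rewrite !inE.
  by rewrite big_mkord; apply: eq_bigr => i _; rewrite ltn_ord.
by apply: has_sum_finsupp => i; rewrite !inE mem_index_iota /= => /negbTE ->.
Qed.

(** The norm is submultiplicative, so the real exponential series at [B] majorizes the tail term by
    term. *)
Lemma absrep_exp_tail k u B : absrep u B ->
  absrep (fun a => cexp (u a) - \sum_(n < k) u a ^+ n / n`!%:R)
         (expR B - \sum_(n < k) B ^+ n / n`!%:R).
Proof.
move=> hu; have B0 := absrep_ge0 hu.
apply: (@absrep_family R s nat
  (fun n a => if (n < k)%N then 0 else u a ^+ n / n`!%:R)
  (fun n => if (n < k)%N then 0 else B ^+ n / n`!%:R)).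
- move=> n; case: ifP => _; first exact: absrep0.
  have := absrepM (absrepX n hu) (absrep_cst s (n`!%:R^-1 : C)).
  by rewrite cnormV cnorm_nat.
- apply: bounded_sum_nat => n.
    by case: ifP => // _; rewrite divr_ge0 // exprn_ge0.
  rewrite lerBrDr (le_trans _ (expR_partial_sum (maxn n k) B0)) //.
  have le_sum (j : nat) (c : nat -> R) : (forall i, 0 <= c i) -> (j <= maxn n k)%N ->
      \sum_(i < j) c i <= \sum_(i < maxn n k) c i.
    move=> c0 jm; rewrite -!(big_mkord xpredT c) (big_cat_nat (leq0n j) jm) //= lerDl.
    by rewrite sumr_ge0.
  set t := fun i => B ^+ i / i`!%:R.
  have t0 i : 0 <= t i by rewrite divr_ge0 // exprn_ge0.
  rewrite [leRHS](_ : _ = \sum_(i < maxn n k) (if (i < k)%N then 0 else t i) +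
     \sum_(i < maxn n k) (if (i < k)%N then t i else 0)); last first.
    by rewrite -big_split; apply: eq_bigr => i _ /=; case: ifP; rewrite ?addr0 ?add0r.
  apply: lerD.
    by apply: (le_sum n (fun i => if (i < k)%N then 0 else t i)); rewrite ?leq_maxl // => i; case: ifP.
  rewrite (le_trans _ (le_sum k (fun i => if (i < k)%N then t i else 0) _ _)) ?leq_maxr //.
    by apply: ler_sum => i _; rewrite ltn_ord.
  by move=> i; case: ifP.
- move=> a ha.
  have h1 := has_sum_cexp (u a).
  have h := has_sum_head k (fun n => u a ^+ n / n`!%:R).
  apply: eq_has_sum (has_sumD h1 (has_sumN h)) => n /=.
  by case: ifP; rewrite ?subrr ?subr0.
Qed.

Lemma absrep_exp1 u B : absrep u B -> B <= 1 / 2 ->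
  absrep (fun a => cexp (u a) - 1) (2 * B).
Proof.
move=> hu B1; have B0 := absrep_ge0 hu.
have := absrep_exp_tail 1 hu; rewrite big_ord1 expr0 fact0 divr1.
move=> /absrep_le /(_ (expR_sub1_le _)) h.
by apply: eq_absrep (h _) => [a _|]; rewrite ?B0 ?B1 // big_ord1 expr0 divr1.
Qed.

Lemma absrep_exp2 u B : absrep u B -> B <= 1 / 2 ->
  absrep (fun a => cexp (u a) - 1 - u a) (2 * B ^+ 2).
Proof.
move=> hu B1; have B0 := absrep_ge0 hu.
have := absrep_exp_tail 2 hu; rewrite !big_ord_recl big_ord0 expr0 expr1 fact0 !divr1 addr0.
rewrite opprD addrA => /absrep_le /(_ (expR_sub1B_le _)) h.
apply: eq_absrep (h _) => [a _|]; rewrite ?B0 ?B1 //.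
by rewrite !big_ord_recl big_ord0 expr0 expr1 !divr1 addr0 opprD addrA.
Qed.

Lemma absrep_exp u B : absrep u B -> B <= 1 / 2 -> absrep (fun a => cexp (u a)) 2.
Proof.
move=> hu B1; have := absrepD (absrep_cst s (1 : C)) (absrep_exp1 hu B1); rewrite cnorm1.
move=> h; apply: absrep_le (_ : 1 + 2 * B <= 2); last by lra.
by apply: eq_absrep h => a _; rewrite addrCA subrr addr0.
Qed.

Lemma absrep_exp_sub u (v : pt -> C) B d : absrep v B -> absrep (fun a => u a - v a) d ->
  B <= 1 / 2 -> d <= 1 / 2 -> absrep (fun a => cexp (u a) - cexp (v a)) (4 * d).
Proof.
move=> hv huv B1 d1.
have := absrepM (absrep_exp hv B1) (absrep_exp1 huv d1).
rewrite (_ : 2 * (2 * d) = 4 * d); last by ring.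
by apply: eq_absrep => a _; rewrite mulrBr mulr1 -cexpD [v a + _]addrC subrK.
Qed.

(** With [D = u - v] the difference equals [(e^v - 1)(e^D - 1) + (e^D - 1 - D)]. It is of order [D]
    with a small factor, which makes the nonlinear part of the radius equation contract. *)
Lemma absrep_exp2_sub u (v : pt -> C) B d : absrep v B -> absrep (fun a => u a - v a) d ->
  B <= 1 / 2 -> d <= 1 / 2 ->
  absrep (fun a => (cexp (u a) - 1 - u a) - (cexp (v a) - 1 - v a)) ((4 * B + 2 * d) * d).
Proof.
move=> hv huv B1 d1.
have := absrepD (absrepM (absrep_exp1 hv B1) (absrep_exp1 huv d1)) (absrep_exp2 huv d1).
rewrite (_ : 2 * B * (2 * d) + 2 * d ^+ 2 = (4 * B + 2 * d) * d); last by ring.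
apply: eq_absrep => a _.
have -> : cexp (u a) = cexp (v a) * cexp (u a - v a) by rewrite -cexpD [v a + _]addrC subrK.
by ring.
Qed.

Section Powers.
Variables (z z' y y' : pt -> C) (M d : R).
Hypotheses (hz : absrep z M) (hz' : absrep z' M) (hy : absrep y M) (hy' : absrep y' M).
Hypotheses (hzy : absrep (fun a => z a - y a) d) (hzy' : absrep (fun a => z' a - y' a) d).

Lemma absrep_pow_sub (x x' : pt -> C) l : absrep x M -> absrep x' M ->
  absrep (fun a => x a - x' a) d ->
  absrep (fun a => x a ^+ l - x' a ^+ l) (l%:R * M ^+ l.-1 * d).
Proof.
move=> hx hx' hxx; elim: l => [|l IH].
  by rewrite !mul0r; apply: eq_absrep (absrep0 _ _) => a _; rewrite !expr0 subrr.
have := absrepD (absrepM hx IH) (absrepM hxx (absrepX l hx')).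
rewrite (_ : M * _ + _ = l.+1%:R * M ^+ l.+1.-1 * d).
  by apply: eq_absrep => a _; rewrite !exprS; ring.
rewrite -natr1 /=; case: (l) => [|k] /=; first by rewrite expr0; ring.
by rewrite exprS; ring.
Qed.

Lemma absrep_monom_sub l m :
  absrep (fun a => z a ^+ l * z' a ^+ m - y a ^+ l * y' a ^+ m)
    ((l + m)%:R * M ^+ (l + m).-1 * d).
Proof.
have := absrepD (absrepM (absrepX l hz) (absrep_pow_sub m hz' hy' hzy'))
  (absrepM (absrep_pow_sub l hz hy hzy) (absrepX m hy')).
rewrite (_ : M ^+ l * _ + _ = (l + m)%:R * M ^+ (l + m).-1 * d).
  by apply: eq_absrep => a _; ring.
case: l m => [|l] [|m] /=; rewrite ?add0n ?addn0 ?expr0; try by ring.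
by rewrite natrD addnS !exprS exprD; ring.
Qed.

End Powers.

(** The second argument is not tied to the first; [atilde] is the case where it is the conjugate. *)
Definition psum (b : idx -> C) (x x' : C) : C :=
  sumI (fun v : idx => b v * (x ^+ v.1 * x' ^+ v.2)).

Section PowerSeries.
Variables (A : idx -> pt -> C) (beta : idx -> R) (M S : R).
Hypothesis hA : forall v, absrep (A v) (beta v).
Hypothesis hS : bounded_sum (fun v : idx => beta v * M ^+ (v.1 + v.2)) S.

Lemma absrep_term z (z' : pt -> C) (v : idx) : absrep z M -> absrep z' M ->
  absrep (fun a => A v a * (z a ^+ v.1 * z' a ^+ v.2)) (beta v * M ^+ (v.1 + v.2)).
Proof. by move=> hz hz'; rewrite exprD; exact: absrepM (hA v) (absrepM (absrepX _ hz) (absrepX _ hz')). Qed.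

Lemma has_sum_psum z (z' : pt -> C) a : absrep z M -> absrep z' M -> polydisc a ->
  has_sum (fun v : idx => A v a * (z a ^+ v.1 * z' a ^+ v.2)) (psum (A^~ a) (z a) (z' a)).
Proof.
move=> hz hz' ha; apply: (@sumIP _ _ _ S).
by apply: bounded_sum_mono hS => v; exact: absrep_bound (absrep_term v hz hz') ha.
Qed.

(** The coefficients [A v] are themselves in the algebra: coordinate functions lead to series in the
    [a_v], constant functions to estimates at a single point. *)
Lemma absrep_psum z (z' : pt -> C) : absrep z M -> absrep z' M ->
  absrep (fun a => psum (A^~ a) (z a) (z' a)) S.
Proof.
move=> hz hz'; apply: (absrep_family _ hS (f := fun v a => A v a * (z a ^+ v.1 * z' a ^+ v.2))).
  by move=> v; exact: absrep_term.
by move=> a ha; exact: has_sum_psum.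
Qed.

Lemma absrep_psum_sub z (z' : pt -> C) y (y' : pt -> C) d S' :
  absrep z M -> absrep z' M -> absrep y M -> absrep y' M ->
  absrep (fun a => z a - y a) d -> absrep (fun a => z' a - y' a) d ->
  bounded_sum (fun v : idx => beta v * ((v.1 + v.2)%:R * M ^+ (v.1 + v.2).-1)) S' ->
  absrep (fun a => psum (A^~ a) (z a) (z' a) - psum (A^~ a) (y a) (y' a)) (S' * d).
Proof.
move=> hz hz' hy hy' hzy hzy' hS'; have d0 := absrep_ge0 hzy.
apply: (@absrep_family R s idx
  (fun v a => A v a * (z a ^+ v.1 * z' a ^+ v.2 - y a ^+ v.1 * y' a ^+ v.2))
  (fun v => beta v * ((v.1 + v.2)%:R * M ^+ (v.1 + v.2).-1 * d))).
- by move=> v; exact: absrepM (hA v) (absrep_monom_sub _ _ _ _ _ _ _ _).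
- rewrite mulrC; apply: bounded_sum_mono (bounded_sumZ d0 hS') => v.
  by rewrite mulrA [leRHS]mulrC.
- move=> a ha.
  apply: eq_has_sum (has_sumD (has_sum_psum hz hz' ha) (has_sumN (has_sum_psum hy hy' ha))) => v.
  by rewrite mulrBr.
Qed.

End PowerSeries.

Lemma bounded_sum_geom : bounded_sum (fun v : idx => (1 / 4 : R) ^+ (v.1 + v.2)) 2.
Proof.
have h : bounded_sum (fun n => (1 / 4 : R) ^+ n) (4 / 3).
  apply: bounded_sum_nat => n; first by rewrite exprn_ge0 //; lra.
  have -> : \sum_(i < n) (1 / 4 : R) ^+ i = 4 / 3 * (1 - (1 / 4) ^+ n).
    elim: n => [|n IH]; first by rewrite big_ord0 expr0; ring.
    by rewrite big_ord_recr /= IH exprS; field.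
  have : 0 <= (1 / 4 : R) ^+ n by rewrite exprn_ge0 //; lra.
  by lra.
have h0 n : 0 <= (1 / 4 : R) ^+ n by rewrite exprn_ge0 //; lra.
apply: (bounded_sum_le (B := 4 / 3 * (4 / 3))); last by lra.
by apply: bounded_sum_mono (bounded_sum_prod h0 h0 h h) => v; rewrite exprD.
Qed.

(** The power of 8 comes from [M^n <= (8 M)^(2s+1) 8^(-n)] for [n >= 2s+1] and [M <= 1/8]; the
    factor 2 bounds the sum of [4^(-i-j)] over all pairs. *)
Definition Kc : R := 2 * 8 ^+ (2 * s).+1.

Lemma Kc_ge1 : 1 <= Kc.
Proof.
have h : 1 <= (8 : R) ^+ (2 * s).+1 by apply: exprn_ege1; lra.
by rewrite /Kc; lra.
Qed.

(** Only degrees above [2s] occur, so [M^(2s+1)] factors out of the series and [M^(2s)] out of its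
    derivative. The weight [n] of the derivative is absorbed by [n <= 2^n], which turns the ratio
    1/8 into 1/4. *)
Lemma bounded_sum_tail (beta : idx -> R) kappa M : 0 <= kappa -> 0 <= M <= 1 / 8 ->
  (forall v, beta v <= if in_idx s v then kappa else 0) ->
  bounded_sum (fun v : idx => beta v * M ^+ (v.1 + v.2)) (kappa * Kc * M ^+ (2 * s).+1) /\
  bounded_sum (fun v : idx => beta v * ((v.1 + v.2)%:R * M ^+ (v.1 + v.2).-1))
    (kappa * Kc * M ^+ (2 * s)).
Proof.
move=> k0 /andP[M0 M1] hb.
have pow4 n : n%:R <= (2 : R) ^+ n.
  by rewrite -natrX ler_nat ltnW // ltn_expl.
have split8 (k n : nat) : (k <= n)%N -> M ^+ n <= M ^+ k * 8 ^+ k * (1 / 8) ^+ n.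
  move=> kn; rewrite -{1 2}(subnKC kn) !exprD -!mulrA ler_wpM2l ?exprn_ge0 //.
  rewrite mulrA -exprMn (_ : 8 * (1 / 8) = 1 :> R); last by field.
  by rewrite expr1n [leRHS]mul1r; apply: lerXn2r; rewrite ?nnegrE //; lra.
have e14 n : (1 / 8 : R) ^+ n <= (1 / 4) ^+ n by apply: lerXn2r; rewrite ?nnegrE; lra.
have e4 n : 0 <= (1 / 4 : R) ^+ n by rewrite exprn_ge0 //; lra.
have e8 n : 0 <= (1 / 8 : R) ^+ n by rewrite exprn_ge0 //; lra.
split.
  rewrite [kappa * _ * _](_ : _ = kappa * M ^+ (2 * s).+1 * 8 ^+ (2 * s).+1 * 2); last by rewrite /Kc; ring.
  apply: bounded_sum_mono (bounded_sumZ _ bounded_sum_geom) => [v|]; last first.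
    by rewrite !mulr_ge0 ?exprn_ge0.
  have := hb v; rewrite /in_idx; case: ifP => sv hv.
    rewrite (le_trans (ler_wpM2r _ hv)) ?exprn_ge0 // -!mulrA ler_wpM2l //.
    rewrite (le_trans (split8 _ _ sv)) // -!mulrA !ler_wpM2l ?exprn_ge0 //.
  apply: (@le_trans _ _ 0); first by rewrite mulr_le0_ge0 ?exprn_ge0.
  by rewrite !mulr_ge0 ?e4 ?exprn_ge0.
rewrite [kappa * _ * _](_ : _ = kappa * M ^+ (2 * s) * 8 ^+ (2 * s).+1 * 2); last by rewrite /Kc; ring.
apply: bounded_sum_mono (bounded_sumZ _ bounded_sum_geom) => [v|]; last first.
  by rewrite !mulr_ge0 ?exprn_ge0.
have := hb v; rewrite /in_idx; case: ifP => sv hv.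
  rewrite (le_trans (ler_wpM2r _ hv)) ?mulr_ge0 ?exprn_ge0 // -!mulrA ler_wpM2l //.
  move: sv; case: (v.1 + v.2)%N => // n; rewrite ltnS /= => sn.
  rewrite (le_trans (ler_wpM2l _ (split8 _ _ sn))) //.
  rewrite [leLHS](_ : _ = M ^+ (2 * s) * (8 ^+ (2 * s) * (n.+1%:R * (1 / 8) ^+ n))); last by ring.
  rewrite ler_wpM2l ?exprn_ge0 // exprS -[8 * _ * _]mulrA [leRHS]mulrCA ler_wpM2l ?exprn_ge0 //.
  rewrite (le_trans (ler_wpM2r (e8 n) (pow4 n.+1))) // exprS -mulrA -exprMn.
  rewrite (_ : 2 * (1 / 8) = 1 / 4 :> R); last by field.
  by rewrite exprS mulrA ler_wpM2r ?exprn_ge0 //; lra.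
apply: (@le_trans _ _ 0); first by rewrite mulr_le0_ge0 ?mulr_ge0 ?exprn_ge0.
by rewrite !mulr_ge0 ?e4 ?exprn_ge0.
Qed.

End ExpansionCalculus.

(** * The equation for periodic orbits *)

Section PeriodicOrbitEquation.
Variables (R : realType) (s q : nat) (r0 w0 th0 : R).
Local Notation C := R[i].
Local Notation pt := (idx -> C).
Local Notation absrep := (@absrep R s).
Hypotheses (s0 : (0 < s)%N) (q0 : (0 < q)%N).

(* [psum a z z'] at [z = r e^(i th)], [z' = r e^(-i th)] with [r = r0 e^t] and [th = c + e],
   where [t] and [e] are complex perturbations *)
Definition hval (a : pt) (t : C) (c : R) (e : C) : C :=
  psum a (r0%:C%C * cis c * cexp (t + iC R * e)) (r0%:C%C * cis (- c) * cexp (t - iC R * e)).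

(** The frequency shift [r^(2s) - r0^(2s)] of the twist map between the radii [r0] and
    [r = r0 e^t]. *)
Definition dfreq (t : C) : C := (r0 ^+ (2 * s))%:C%C * (cexp ((2 * s)%:R * t) - 1).

(** The contribution of [atilde] to step [i]. The first summand is taken at [u_i], whose angle is
    the frequency [w0 + dfreq] minus the angle of [v_i]; the second at [v_(i+1)], whose perturbation
    is [y i.+2] because of the shift by one in a state. *)
Definition gterm (a : pt) (y : nat -> C) (i : nat) : C :=
  hval a (y 0%N) (w0 - (th0 - i%:R * w0)) (dfreq (y 0%N) - y i.+1) +
  hval a (y 0%N) (th0 - i.+1%:R * w0) (y i.+2).

(** The orbit closes up when this mean equals [- dfreq (y 0)]. In [ostep] it corrects the radius,
    after division by the derivative of [dfreq] at 0, and it removes the average drift from the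
    angles. *)
Definition gmean (a : pt) (y : nat -> C) : C := q%:R^-1 * \sum_(i < q) gterm a y i.

(* A state [y] packs the logarithmic radius [y 0] and the perturbations [y j.+1] of the angles
   [th0 - j w0] of a [q]-periodic orbit; the orbit closes up exactly at the fixed points. *)
Definition ostep (a : pt) (y : nat -> C) (j : nat) : C :=
  if j is k.+1 then
    if (k <= q)%N then k%:R * gmean a y - \sum_(i < k) gterm a y i else 0
  else - ((2 * s)%:R^-1 * (cexp ((2 * s)%:R * y 0%N) - 1 - (2 * s)%:R * y 0%N)) -
       ((2 * s)%:R * r0 ^+ (2 * s))^-1%:C%C * gmean a y.

(** Radius of the ball of states: [2 s rho = 1/64] keeps [exp (2 s t)] near its linearization. *)
Definition rho : R := (128 * s%:R)^-1.
(** Here [20 = 12 + 8]: when the state moves by [d], the arguments of the two summands of [gterm]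
    move by [4 r0 (d + 2 d)] and [4 r0 (d + d)]. The factor [4^s] comes from bounding the series at
    radius [2 r0]. *)
Definition K1 : R := 20 * 4 ^+ s * Kc R s.

Hypotheses (r0_gt0 : 0 < r0) (r0_small : 64 * K1 * r0 <= rho) (q_small : q%:R * r0 ^+ (2 * s) <= 8).

Lemma rho_gt0 : 0 < rho.
Proof. by rewrite invr_gt0 mulr_gt0 ?ltr0n. Qed.

Lemma s_rho : s%:R * rho = 1 / 128.
Proof. by rewrite /rho; field; rewrite pnatr_eq0 -lt0n. Qed.

Lemma rho_le : rho <= 1 / 128.
Proof.
have h1 : 1 <= s%:R :> R by rewrite ler1n.
have := rho_gt0; have := s_rho; nra.
Qed.

Lemma K1_ge : 20 <= K1.
Proof.
have h1 : 1 <= 4 ^+ s :> R by apply: exprn_ege1; lra.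
by have := Kc_ge1 R s; rewrite /K1; nra.
Qed.

Lemma r0_le : 2 * r0 <= 1 / 8.
Proof. by have := K1_ge; have := rho_le; have := r0_gt0; have := r0_small; nra. Qed.

Lemma r0_pow_le : (2 * s)%:R * r0 ^+ (2 * s) <= 1 / 8.
Proof.
have h : r0 ^+ (2 * s) <= r0.
  by apply: ler_iXnr; rewrite ?muln_gt0 ?s0 ?ltW //; have := r0_le; lra.
have h1 : 1 <= s%:R :> R by rewrite ler1n.
have h2 : 1120 * r0 <= rho by have := K1_ge; have := r0_gt0; have := r0_small; nra.
rewrite natrM; have := s_rho; have := r0_gt0; nra.
Qed.

Lemma absrep_iC f B : absrep f B -> absrep (fun a => iC R * f a) B.
Proof.
move=> /(absrepZ (iC R)); rewrite (_ : cnorm (iC R) = 1) ?mul1r //.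
by rewrite /cnorm /= expr0n /= add0r expr1n sqrtr1.
Qed.

Section Contraction.
Variables (A : idx -> pt -> C) (kappa : R).
Hypotheses (k0 : 0 <= kappa) (k1 : kappa <= 1).
Hypothesis hA : forall v, absrep (A v) (if in_idx s v then kappa else 0).

Lemma absrep_arg (T E : pt -> C) c B : absrep (fun a => T a + E a) B -> B <= 1 / 2 ->
  absrep (fun a => r0%:C%C * cis c * cexp (T a + E a)) (2 * r0).
Proof.
move=> hB B1; have := absrepM (absrep_cst s (r0%:C%C * cis c)) (absrep_exp hB B1).
by rewrite cnormM cnormR cnorm_cis mulr1 gtr0_norm // [r0 * 2]mulrC.
Qed.

Lemma absrep_arg_sub (T T' : pt -> C) c B d : absrep T' B -> absrep (fun a => T a - T' a) d ->
  B <= 1 / 2 -> d <= 1 / 2 ->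
  absrep (fun a => r0%:C%C * cis c * cexp (T a) - r0%:C%C * cis c * cexp (T' a)) (4 * r0 * d).
Proof.
move=> hT hd B1 d1; have := absrepM (absrep_cst s (r0%:C%C * cis c)) (absrep_exp_sub hT hd B1 d1).
rewrite cnormM cnormR cnorm_cis mulr1 gtr0_norm // (_ : r0 * (4 * d) = 4 * r0 * d); last by ring.
by apply: eq_absrep => a _; rewrite mulrBr.
Qed.

Lemma beta_le v : (if in_idx s v then kappa else 0) <= if in_idx s v then kappa else 0.
Proof. by []. Qed.

Lemma M_itv : 0 <= 2 * r0 <= 1 / 8.
Proof. by rewrite r0_le andbT mulr_ge0 ?ltW. Qed.

Lemma absrep_hval (T E : pt -> C) c B B' : absrep T B -> absrep E B' -> B + B' <= 1 / 2 ->
  absrep (fun a => hval (A^~ a) (T a) c (E a)) (kappa * Kc R s * (2 * r0) ^+ (2 * s).+1).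
Proof.
move=> hT hE hB; have [hS _] := bounded_sum_tail k0 M_itv beta_le.
apply: (absrep_psum hA hS); apply: absrep_arg hB.
  exact: absrepD hT (absrep_iC hE).
exact: absrepB hT (absrep_iC hE).
Qed.

Lemma absrep_hval_sub (T T' E E' : pt -> C) c B B' d d' :
  absrep T B -> absrep E B' -> absrep T' B -> absrep E' B' -> B + B' <= 1 / 2 ->
  absrep (fun a => T a - T' a) d -> absrep (fun a => E a - E' a) d' -> d + d' <= 1 / 2 ->
  absrep (fun a => hval (A^~ a) (T a) c (E a) - hval (A^~ a) (T' a) c (E' a))
    (kappa * Kc R s * (2 * r0) ^+ (2 * s) * (4 * r0 * (d + d'))).
Proof.
move=> hT hE hT' hE' hB hd hd' dd; have [hS hS'] := bounded_sum_tail k0 M_itv beta_le.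
apply: (absrep_psum_sub hA hS _ _ _ _ _ _ hS').
- by apply: absrep_arg hB; exact: absrepD hT (absrep_iC hE).
- by apply: absrep_arg hB; exact: absrepB hT (absrep_iC hE).
- by apply: absrep_arg hB; exact: absrepD hT' (absrep_iC hE').
- by apply: absrep_arg hB; exact: absrepB hT' (absrep_iC hE').
- apply: absrep_arg_sub hB dd; first exact: absrepD hT' (absrep_iC hE').
  by apply: eq_absrep (absrepD hd (absrep_iC hd')) => a _; ring.
- apply: absrep_arg_sub hB dd; first exact: absrepB hT' (absrep_iC hE').
  by apply: eq_absrep (absrepB hd (absrep_iC hd')) => a _; ring.
Qed.

Lemma s_ge1 : 1 <= s%:R :> R.
Proof. by rewrite ler1n. Qed.

Lemma absrep_dfreq T : absrep T rho -> absrep (fun a => dfreq (T a)) rho.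
Proof.
move=> hT; have := absrepZ (2 * s)%:R hT; rewrite cnorm_nat !natrM => h2.
have hB : 2 * s%:R * rho <= 1 / 2 by have := s_rho; lra.
have := absrepZ (r0 ^+ (2 * s))%:C%C (absrep_exp1 h2 hB).
rewrite cnormR ger0_norm ?exprn_ge0 ?ltW // => h3.
apply: (absrep_eqle h3) => [a _|]; first by rewrite /dfreq natrM.
have := r0_pow_le; rewrite !natrM; set x := r0 ^+ _ => hx.
have := rho_gt0; nra.
Qed.

Lemma absrep_dfreq_sub T T' d : absrep T' rho -> absrep (fun a => T a - T' a) d ->
  d <= 2 * rho -> absrep (fun a => dfreq (T a) - dfreq (T' a)) d.
Proof.
move=> hT hd dr; have := absrepZ (2 * s)%:R hT; rewrite cnorm_nat !natrM => h2.
have := absrepZ (2 * s)%:R hd; rewrite cnorm_nat !natrM => h2d.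
have hB : 2 * s%:R * rho <= 1 / 2 by have := s_rho; lra.
have hd1 : 2 * s%:R * d <= 1 / 2 by have := s_rho; have := s_ge1; nra.
have {}h2d := eq_absrep (g := fun a => (2 * s%:R) * T a - (2 * s%:R) * T' a)
   (fun a _ => mulrBr _ _ _) h2d.
have := absrepZ (r0 ^+ (2 * s))%:C%C (absrep_exp_sub h2 h2d hB hd1).
rewrite cnormR ger0_norm ?exprn_ge0 ?ltW // => h3.
apply: (absrep_eqle h3) => [a _|]; first by rewrite /dfreq natrM; ring.
have := r0_pow_le; rewrite !natrM; set x := r0 ^+ _ => hx.
have := absrep_ge0 hd; nra.
Qed.

(** Serves both as the norm of a [gterm] and as its Lipschitz constant. *)
Definition gbound : R := kappa * K1 * r0 ^+ (2 * s).+1.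

Lemma gboundE : gbound = 20 * (kappa * Kc R s * (2 * r0) ^+ (2 * s) * r0).
Proof. by rewrite /gbound /K1 exprMn exprM exprS (_ : 2 ^+ 2 = 4) //; ring. Qed.

Lemma gbound_ge0 : 0 <= gbound.
Proof.
have K0 : 0 <= K1 by have := K1_ge; lra.
have r00 : 0 <= r0 by exact: ltW.
by rewrite /gbound mulr_ge0 ?exprn_ge0 ?mulr_ge0.
Qed.

Lemma absrep_gterm (Y : nat -> pt -> C) i : (forall j, absrep (Y j) rho) ->
  absrep (fun a => gterm (A^~ a) (Y^~ a) i) gbound.
Proof.
move=> hY; have hr := rho_le.
have h1 := absrep_hval (w0 - (th0 - i%:R * w0)) (hY 0%N) (absrepB (absrep_dfreq (hY 0%N)) (hY i.+1)) _.
have h2 := absrep_hval (th0 - i.+1%:R * w0) (hY 0%N) (hY i.+2) _.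
have c1 : rho + (rho + rho) <= 1 / 2 by lra.
have c2 : rho + rho <= 1 / 2 by lra.
apply: absrep_le (absrepD (h1 c1) (h2 c2)) _.
rewrite gboundE exprS; set x := (2 * r0) ^+ _.
have : 0 <= kappa * Kc R s * x * r0.
  have r00 : 0 <= r0 by exact: ltW.
  have c0 : 0 <= Kc R s by have := Kc_ge1 R s; lra.
  by rewrite mulr_ge0 // mulr_ge0 ?exprn_ge0 ?mulr_ge0.
lra.
Qed.

Lemma absrep_gterm_sub (Y Y' : nat -> pt -> C) d i :
  (forall j, absrep (Y j) rho) -> (forall j, absrep (Y' j) rho) ->
  (forall j, absrep (fun a => Y j a - Y' j a) d) -> d <= 2 * rho ->
  absrep (fun a => gterm (A^~ a) (Y^~ a) i - gterm (A^~ a) (Y'^~ a) i) (gbound * d).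
Proof.
move=> hY hY' hd dr; have hr := rho_le; have d0 := absrep_ge0 (hd 0%N).
have hdd : absrep (fun a => dfreq (Y 0%N a) - Y i.+1 a - (dfreq (Y' 0%N a) - Y' i.+1 a)) (d + d).
  apply: eq_absrep (absrepB (absrep_dfreq_sub (hY' 0%N) (hd 0%N) dr) (hd i.+1)) => a _.
  by ring.
have h1 := absrep_hval_sub (w0 - (th0 - i%:R * w0)) (hY 0%N)
  (absrepB (absrep_dfreq (hY 0%N)) (hY i.+1)) (hY' 0%N)
  (absrepB (absrep_dfreq (hY' 0%N)) (hY' i.+1)) _ (hd 0%N) hdd _.
have h2 := absrep_hval_sub (th0 - i.+1%:R * w0) (hY 0%N) (hY i.+2) (hY' 0%N) (hY' i.+2) _
   (hd 0%N) (hd i.+2) _.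
have c1 : rho + (rho + rho) <= 1 / 2 by lra.
have c2 : d + (d + d) <= 1 / 2 by lra.
have c3 : rho + rho <= 1 / 2 by lra.
have c4 : d + d <= 1 / 2 by lra.
apply: (absrep_eqle (absrepD (h1 c1 c2) (h2 c3 c4))) => [a _|].
  have e (x x' z z' : C) : x - x' + (z - z') = x + z - (x' + z') by ring.
  exact: e.
by rewrite gboundE le_eqVlt; apply/orP; left; apply/eqP; ring.
Qed.

Lemma absrep_gmean (Y : nat -> pt -> C) : (forall j, absrep (Y j) rho) ->
  absrep (fun a => gmean (A^~ a) (Y^~ a)) gbound.
Proof.
move=> hY; have := absrepZ q%:R^-1 (absrep_sum (index_enum 'I_q) (P := xpredT)
   (fun (i : 'I_q) _ => absrep_gterm i hY)).
rewrite sumr_const card_ord -[gbound *+ _]mulr_natl mulrA cnormV cnorm_nat mulVf ?mul1r //.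
by rewrite pnatr_eq0 -lt0n.
Qed.

Lemma absrep_gmean_sub (Y Y' : nat -> pt -> C) d :
  (forall j, absrep (Y j) rho) -> (forall j, absrep (Y' j) rho) ->
  (forall j, absrep (fun a => Y j a - Y' j a) d) -> d <= 2 * rho ->
  absrep (fun a => gmean (A^~ a) (Y^~ a) - gmean (A^~ a) (Y'^~ a)) (gbound * d).
Proof.
move=> hY hY' hd dr; have := absrepZ q%:R^-1 (absrep_sum (index_enum 'I_q) (P := xpredT)
   (fun (i : 'I_q) _ => absrep_gterm_sub i hY hY' hd dr)).
rewrite sumr_const card_ord -[_ * _ *+ _]mulr_natl mulrA cnormV cnorm_nat mulVf ?mul1r; last first.
  by rewrite pnatr_eq0 -lt0n.
by apply: eq_absrep => a _; rewrite sumrB mulrBr.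
Qed.

(** The factor [q] is paid for by [q r0^(2s) <= 8]; one power of [r0] remains, and [64 K1 r0 <= rho]
    makes it small. *)
Lemma gbound_q : 2 * q%:R * gbound <= kappa * rho / 4.
Proof.
rewrite /gbound exprS; set x := r0 ^+ (2 * s).
have x0 : 0 <= x by rewrite exprn_ge0 ?ltW.
have h1 : q%:R * x <= 8 by exact: q_small.
have h : K1 * r0 * (q%:R * x) <= K1 * r0 * 8.
  by rewrite ler_wpM2l // mulr_ge0 ?(ltW r0_gt0) //; have := K1_ge; lra.
have h2 := r0_small.
have : kappa * (K1 * r0 * (q%:R * x)) <= kappa * (rho / 8) by rewrite ler_wpM2l //; lra.
lra.
Qed.

Definition cfac : R := ((2 * s)%:R * r0 ^+ (2 * s))^-1.

(** Division by the derivative of the twist cancels [r0^(2s)] and again leaves one factor [r0]. *)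
Lemma cfac_gbound : cfac * gbound = kappa * K1 * r0 / (2 * s%:R).
Proof.
rewrite /cfac /gbound natrM exprS; field.
by rewrite pnatr_eq0 -lt0n s0 /= expf_neq0 // gt_eqF.
Qed.

Lemma cfac_gbound_le : cfac * gbound <= kappa * rho / 56.
Proof.
rewrite cfac_gbound ler_pdivrMr; last by have := s_ge1; lra.
have h : kappa * (64 * K1 * r0) <= kappa * rho by rewrite ler_wpM2l.
have : 0 <= kappa * rho by rewrite mulr_ge0 // ltW // rho_gt0.
have := s_ge1; nra.
Qed.

Lemma cfac_ge0 : 0 <= cfac.
Proof. by rewrite invr_ge0 mulr_ge0 // exprn_ge0 // ltW. Qed.

Lemma absrep_ostep0 j : absrep (fun a => ostep (A^~ a) (fun=> 0) j) (kappa * rho / 4).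
Proof.
have kr : 0 <= kappa * rho by rewrite mulr_ge0 // ltW // rho_gt0.
have hY (k : nat) : absrep ((fun _ _ => 0) k) rho.
  by apply: absrep_le (absrep0 _ _) _; rewrite ltW // rho_gt0.
have g0 := gbound_ge0.
case: j => [|k] /=.
  have := absrepN (absrepZ cfac%:C%C (absrep_gmean hY)).
  rewrite cnormR ger0_norm ?cfac_ge0 // => h.
  apply: absrep_le (_ : cfac * gbound <= _); last by have := cfac_gbound_le; lra.
  by apply: eq_absrep h => a _; rewrite /= mulr0 cexp0 subrr subr0 mulr0 oppr0 add0r.
case: (boolP (k <= q)%N) => kq; last by apply: absrep_le (absrep0 _ _) _; lra.
have := absrepB (absrepZ k%:R (absrep_gmean hY)) (absrep_sum (index_enum 'I_k) (P := xpredT)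
   (fun (i : 'I_k) _ => absrep_gterm i hY)).
rewrite cnorm_nat sumr_const card_ord -[gbound *+ _]mulr_natl => h; apply: absrep_le h _.
have := gbound_q; have : k%:R <= q%:R :> R by rewrite ler_nat.
nra.
Qed.

(** In the radius component the remainder of the exponential contributes a factor of order [s rho]
    and the mean contributes [cfac * gbound]; an angle component contributes at most [2 q gbound].
    All of these are small. *)
Lemma absrep_ostep_sub (Y Y' : nat -> pt -> C) d j :
  (forall j, absrep (Y j) rho) -> (forall j, absrep (Y' j) rho) ->
  (forall j, absrep (fun a => Y j a - Y' j a) d) -> d <= 2 * rho ->
  absrep (fun a => ostep (A^~ a) (Y^~ a) j - ostep (A^~ a) (Y'^~ a) j) (d / 2).
Proof.
move=> hY hY' hd dr; have d0 := absrep_ge0 (hd 0%N).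
have kr : kappa * rho <= rho by rewrite ler_piMl // ltW // rho_gt0.
have r1 := rho_le; have r2 := rho_gt0.
case: j => [|k] /=.
  have := absrepZ (2 * s)%:R (hY' 0%N); rewrite cnorm_nat !natrM => h2.
  have := absrepZ (2 * s)%:R (hd 0%N); rewrite cnorm_nat !natrM => h2d.
  have hB : 2 * s%:R * rho <= 1 / 2 by have := s_rho; lra.
  have hd1 : 2 * s%:R * d <= 1 / 2 by have := s_rho; have := s_ge1; nra.
  have {}h2d := eq_absrep (g := fun a => (2 * s%:R) * Y 0%N a - (2 * s%:R) * Y' 0%N a)
   (fun a _ => mulrBr _ _ _) h2d.
  have h3 := absrepN (absrepZ (2 * s)%:R^-1 (absrep_exp2_sub h2 h2d hB hd1)).
  have h4 := absrepZ cfac%:C%C (absrep_gmean_sub hY hY' hd dr).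
  rewrite cnormV cnorm_nat natrM in h3; rewrite cnormR ger0_norm ?cfac_ge0 // in h4.
  apply: (absrep_eqle (absrepB h3 h4)) => [a _|].
    rewrite /cfac ?natrM; move: (gmean _ _) (gmean _ _) (cexp _) (cexp _) => g g' e e'.
    by ring.
  rewrite [X in X + _](_ : _ = (4 * (2 * (s%:R * rho)) + 2 * (2 * s%:R * d)) * d); last first.
    by rewrite ?natrM; field; rewrite pnatr_eq0 -lt0n.
  rewrite s_rho (_ : cfac * (gbound * d) = cfac * gbound * d); last by ring.
  have h6 : s%:R * d <= 2 * (1 / 128) by rewrite -s_rho mulrCA ler_wpM2l.
  have := cfac_gbound_le; nra.
case: (boolP (k <= q)%N) => kq; last first.
  by apply: absrep_le (_ : 0 <= d / 2); [apply: eq_absrep (absrep0 _ _) => a _; rewrite subrr|lra].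
have := absrepB (absrepZ k%:R (absrep_gmean_sub hY hY' hd dr)) (absrep_sum (index_enum 'I_k)
   (P := xpredT) (fun (i : 'I_k) _ => absrep_gterm_sub i hY hY' hd dr)).
rewrite cnorm_nat sumr_const card_ord -[_ * _ *+ _]mulr_natl => h.
apply: absrep_le (_ : k%:R * (gbound * d) + k%:R * (gbound * d) <= _).
  apply: eq_absrep h => a _; rewrite sumrB.
  have e (x g g' u u' : C) : x * (g - g') - (u - u') = x * g - u - (x * g' - u') by ring.
  exact: e.
have h1 := gbound_q; have h2 : k%:R <= q%:R :> R by rewrite ler_nat.
have h3 : k%:R * gbound <= q%:R * gbound by rewrite ler_wpM2r ?gbound_ge0.
nra.
Qed.

End Contraction.
End PeriodicOrbitEquation.

Section Limits.
Variable R : realType.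
Local Notation C := R[i].

Lemma geom_small (B e : R) : 0 <= B -> 0 < e ->
  exists N, forall n, (N <= n)%N -> B / 2 ^+ n < e.
Proof.
move=> B0 e0; have Be : 0 <= B / e by rewrite divr_ge0 // ltW.
exists (Num.bound (B / e)) => n Nn.
have h1 : B / e < n%:R.
  by rewrite (lt_le_trans (archi_boundP Be)) // ler_nat.
rewrite ltr_pdivrMr ?exprn_gt0 // mulrC -ltr_pdivrMr //; apply: lt_le_trans h1 _.
by rewrite -natrX ler_nat ltnW // ltn_expl.
Qed.

Lemma cvgC_geom (u : nat -> C) l B : 0 <= B -> (forall n, cnorm (u n - l) <= B / 2 ^+ n) -> cvgC u l.
Proof.
move=> B0 h e e0; have [N hN] := geom_small B0 e0.
by exists N => n /hN; apply: le_lt_trans.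
Qed.

Lemma cvgC_le (u : nat -> C) l c B : cvgC u l -> (forall n, cnorm (u n.+1 - c) <= B) ->
  cnorm (l - c) <= B.
Proof.
move=> hu hB; apply: cnorm_small => e e0; have [N hN] := hu _ e0.
have := hN N.+1 (leqnSn N); have := hB N; have := cnorm_dist l (u N.+1) c.
rewrite (cnormBC l (u _)); lra.
Qed.

Lemma bounded_sum_half (B : R) : 0 <= B -> bounded_sum (fun n => B / 2 ^+ n) (2 * B).
Proof.
move=> B0; apply: bounded_sum_nat => n; first by rewrite divr_ge0 // exprn_ge0.
have -> : \sum_(i < n) B / 2 ^+ i = 2 * B - 2 * (B / 2 ^+ n).
  elim: n => [|n IH]; first by rewrite big_ord0 expr0 divr1 subrr.
  by rewrite big_ord_recr /= IH exprS; field; rewrite expf_neq0.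
by rewrite gerBl mulr_ge0 // divr_ge0 // exprn_ge0.
Qed.

End Limits.

(** * The fixed point, its linear part and its uniqueness *)

Section PeriodicOrbitSolution.
Variables (R : realType) (s q : nat) (r0 w0 th0 : R).
Local Notation C := R[i].
Local Notation pt := (idx -> C).
Local Notation absrep := (@absrep R s).
Local Notation ostep := (ostep s q r0 w0 th0).
Local Notation gmean := (gmean s q r0 w0 th0).
Local Notation rho := (rho R s).
Hypotheses (s0 : (0 < s)%N) (q0 : (0 < q)%N).
Hypotheses (r0_gt0 : 0 < r0) (r0_small : 64 * K1 R s * r0 <= rho).
Hypothesis (q_small : q%:R * r0 ^+ (2 * s) <= 8).

Definition oiter (a : pt) (n : nat) : nat -> C := iter n (ostep a) (fun=> 0).

(** The limit of the iterates, written as a telescoping sum from the initial state 0 so that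
    [absrep_family] applies. *)
Definition osol (a : pt) : C := sumI (fun n => oiter a n.+1 0%N - oiter a n 0%N).

Section Param.
Variables (A : idx -> pt -> C) (kappa : R).
Hypotheses (k0 : 0 <= kappa) (k1 : kappa <= 1).
Hypothesis hA : forall v, absrep (A v) (if in_idx s v then kappa else 0).

Lemma kappa_rho : 0 <= kappa * rho <= rho.
Proof.
have h : 0 <= rho by rewrite ltW // rho_gt0.
by rewrite mulr_ge0 //= ler_piMl.
Qed.

(** The bound is proportional to [kappa]: the step from the zero state costs [kappa rho / 4], and
    the contraction halves the rest. *)
Lemma absrep_oiter n j : absrep (fun x => oiter (A^~ x) n j) (kappa * rho / 2).
Proof.
have /andP[kr0 kr] := kappa_rho.
elim: n j => [|n IH] j.
  by apply: absrep_le (absrep0 R s) _; lra.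
have h1 (k : nat) : absrep ((fun k x => oiter (A^~ x) n k) k) rho.
  by apply: absrep_le (IH k) _; lra.
have h2 (k : nat) : absrep ((fun (_ : nat) (_ : pt) => 0 : C) k) rho.
  by apply: absrep_le (absrep0 R s) _; lra.
have h3 (k : nat) : absrep (fun x => oiter (A^~ x) n k - 0) (kappa * rho / 2).
  by apply: eq_absrep (IH k) => a _; rewrite subr0.
have h4 : kappa * rho / 2 <= 2 * rho by lra.
have h5 := absrep_ostep_sub w0 th0 s0 q0 r0_gt0 r0_small q_small k0 k1 hA j h1 h2 h3 h4.
have h6 := absrep_ostep0 w0 th0 s0 q0 r0_gt0 r0_small q_small k0 hA j.
apply: (absrep_eqle (absrepD h5 h6)) => [a _|]; last by lra.
by rewrite subrK.
Qed.

Lemma absrep_oiter_diff n j :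
  absrep (fun x => oiter (A^~ x) n.+1 j - oiter (A^~ x) n j) (kappa * rho / 4 / 2 ^+ n).
Proof.
have /andP[kr0 kr] := kappa_rho.
elim: n j => [|n IH] j.
  rewrite expr0 divr1.
  have h6 := absrep_ostep0 w0 th0 s0 q0 r0_gt0 r0_small q_small k0 hA j.
  by apply: eq_absrep h6 => a _; rewrite subr0.
have h1 (m k : nat) : absrep ((fun k x => oiter (A^~ x) m k) k) rho.
  by apply: absrep_le (absrep_oiter m k) _; lra.
have h4 : kappa * rho / 4 / 2 ^+ n <= 2 * rho.
  rewrite ler_pdivrMr ?exprn_gt0 //.
  have h : 1 <= 2 ^+ n :> R by apply: exprn_ege1; lra.
  by nra.
have h5 := absrep_ostep_sub w0 th0 s0 q0 r0_gt0 r0_small q_small k0 k1 hA j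
  (h1 n.+1) (h1 n) IH h4.
apply: (absrep_eqle h5) => // .
by rewrite exprS le_eqVlt; apply/orP; left; apply/eqP; field; rewrite expf_neq0.
Qed.

Lemma has_sum_osol x : polydisc x ->
  has_sum (fun n => oiter (A^~ x) n.+1 0%N - oiter (A^~ x) n 0%N) (osol (A^~ x)).
Proof.
have /andP[kr0 kr] := kappa_rho.
move=> hx; apply: (@sumIP R _ _ (2 * (kappa * rho / 4))).
apply: bounded_sum_mono (bounded_sum_half _) => [n|]; last by lra.
exact: absrep_bound (absrep_oiter_diff n 0%N) hx.
Qed.

Lemma absrep_osol : absrep (fun x => osol (A^~ x)) (kappa * rho / 2).
Proof.
have /andP[kr0 kr] := kappa_rho.
rewrite (_ : _ / 2 = 2 * (kappa * rho / 4)); last by field.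
apply: (absrep_family (absrep_oiter_diff^~ 0%N) (bounded_sum_half _)); first by lra.
exact: has_sum_osol.
Qed.

Lemma cvg_osol x : polydisc x -> cvgC (fun n => oiter (A^~ x) n 0%N) (osol (A^~ x)).
Proof.
move=> /has_sum_osol /has_sum_nat h e /h [N hN]; exists N => n /hN.
suff -> : \sum_(i < n) (oiter (A^~ x) i.+1 0%N - oiter (A^~ x) i 0%N) = oiter (A^~ x) n 0%N by [].
elim: (n) => [|k IH]; first by rewrite big_ord0.
by rewrite big_ord_recr /= IH addrC subrK.
Qed.

(** From a state of size [O(kappa)] the mean differs from its value at the zero state by
    [O(kappa^2)], and the remainder of the exponential is quadratic as well. The bound is uniform in
    [n], so it passes to the limit. *)
Lemma absrep_oiter_linear n :
  absrep (fun x => oiter (A^~ x) n.+1 0%N +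
    (cfac s r0)%:C%C * gmean (A^~ x) (fun=> 0)) (2 * kappa ^+ 2).
Proof.
have /andP[kr0 kr] := kappa_rho; have r1 := rho_le R s0.
have h1 (k : nat) : absrep ((fun k x => oiter (A^~ x) n k) k) rho.
  by apply: absrep_le (absrep_oiter n k) _; lra.
have h2 (k : nat) : absrep ((fun (_ : nat) (_ : pt) => 0 : C) k) rho.
  by apply: absrep_le (absrep0 R s) _; lra.
have h3 (k : nat) : absrep (fun x => oiter (A^~ x) n k - 0) (kappa * rho / 2).
  by apply: eq_absrep (absrep_oiter n k) => a _; rewrite subr0.
have h4 : kappa * rho / 2 <= 2 * rho by lra.
have h5 := absrep_gmean_sub w0 th0 s0 q0 r0_gt0 r0_small k0 hA h1 h2 h3 h4.
have h6 := absrepZ (2 * s)%:R (absrep_oiter n 0%N); rewrite cnorm_nat in h6.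
have h7 : (2 * s)%:R * (kappa * rho / 2) = kappa / 128.
  by rewrite natrM (_ : _ * _ = kappa * (s%:R * rho)); [rewrite s_rho //; ring|field].
rewrite h7 in h6.
have h8 := absrepN (absrepZ (2 * s)%:R^-1 (absrep_exp2 h6 _)).
have h9 := absrepN (absrepZ (cfac s r0)%:C%C h5).
rewrite cnormV cnorm_nat in h8; rewrite cnormR ger0_norm ?cfac_ge0 // in h9.
have hk : kappa / 128 <= 1 / 2 by rewrite ler_pdivrMr // (le_trans k1) //; lra.
apply: (absrep_eqle (absrepD (h8 hk) h9)) => [a _|].
  have e (u x g g' : C) : - u + - (x * (g - g')) = - u - x * g + x * g' by ring.
  exact: e.
have [s1 s1'] : 0 < ((2 * s)%:R^-1 : R) /\ ((2 * s)%:R^-1 : R) <= 1.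
  by rewrite invr_gt0 invf_le1 ?ltr0n ?ler1n ?muln_gt0 ?s0.
have h10 := cfac_gbound_le s0 r0_gt0 r0_small k0.
set cg := cfac s r0 * _ in h10.
rewrite [cfac s r0 * _]mulrA -/cg; have k2 : 0 <= kappa ^+ 2 by rewrite sqr_ge0.
have h11 : cg * (kappa * rho / 2) <= kappa ^+ 2.
  have h : cg * (kappa * rho / 2) <= kappa * rho / 56 * (kappa * rho / 2).
    by rewrite ler_wpM2r //; lra.
  apply: le_trans h _; rewrite (_ : _ * _ = kappa ^+ 2 * (rho ^+ 2 / 112)); last by field.
  by rewrite ler_piMr //; nra.
have : (2 * s)%:R^-1 * (2 * (kappa / 128) ^+ 2) <= kappa ^+ 2 by nra.
by lra.
Qed.

End Param.

Section Numeric.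
Variables (a : pt) (kappa : R).
Hypotheses (k0 : 0 <= kappa) (k1 : kappa <= 1).
Hypothesis ha : forall v, cnorm (a v) <= if in_idx s v then kappa else 0.

Let origin : pt := fun=> 0.

Lemma polydisc_origin : polydisc origin.
Proof. by move=> v; rewrite cnorm0. Qed.

(** The numbers [a v] enter as constant functions; evaluation at [origin] turns norms into numerical
    inequalities. *)
Lemma absrep_coef v : absrep (fun=> a v) (if in_idx s v then kappa else 0).
Proof. exact: absrep_le (absrep_cst s (a v)) (ha v). Qed.

Lemma absrep_num (x : C) B : cnorm x <= B -> absrep (fun=> x) B.
Proof. exact: absrep_le (absrep_cst s x). Qed.

Lemma cvg_osol_num : cvgC (fun n => oiter a n 0%N) (osol a).
Proof. exact: (cvg_osol k0 k1 absrep_coef polydisc_origin). Qed.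

Lemma osol_linear : cnorm (osol a + (cfac s r0)%:C%C * gmean a (fun=> 0)) <= 2 * kappa ^+ 2.
Proof.
rewrite -[_%:C%C * _]opprK; apply: cvgC_le cvg_osol_num _ => n; rewrite opprK.
exact: absrep_bound (absrep_oiter_linear k0 k1 absrep_coef n) polydisc_origin.
Qed.

(** The iterates from 0 approach every fixed point of the ball at rate 1/2, so their limit is that
    fixed point. *)
Lemma osol_uniq (y : nat -> C) : (forall j, ostep a y j = y j) -> (forall j, cnorm (y j) <= rho) ->
  osol a = y 0%N.
Proof.
move=> yE hy; have r1 := rho_gt0 R s0; have /andP[kr0 kr] := kappa_rho k0 k1.
suff h n j : absrep (fun=> oiter a n j - y j) (2 * rho / 2 ^+ n).
  apply: cvgC_uniq cvg_osol_num _; apply: (@cvgC_geom _ _ _ (2 * rho)); first by lra.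
  by move=> n; exact: absrep_bound (h n 0%N) polydisc_origin.
elim: n j => [|n IH] j.
  by rewrite expr0 divr1; apply: absrep_num; rewrite sub0r cnormN; have := hy j; lra.
have h1 (k : nat) : absrep ((fun k _ => oiter a n k) k) rho.
  by apply: absrep_le (absrep_oiter k0 k1 absrep_coef n k) _; lra.
have h2 (k : nat) : absrep ((fun k _ => y k) k) rho by exact: absrep_num.
have h4 : 2 * rho / 2 ^+ n <= 2 * rho.
  rewrite ler_pdivrMr ?exprn_gt0 //.
  have h : 1 <= 2 ^+ n :> R by apply: exprn_ege1; lra.
  by nra.
have h5 := absrep_ostep_sub w0 th0 s0 q0 r0_gt0 r0_small q_small k0 k1 absrep_coef j h1 h2 IH h4.
apply: (absrep_eqle h5) => [x _|]; first by rewrite yE.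
by rewrite exprS le_eqVlt; apply/orP; left; apply/eqP; field; rewrite expf_neq0.
Qed.

End Numeric.

End PeriodicOrbitSolution.

(** * Formal power series and functional independence *)

Section FormalSeries.
Variables (R : realType) (s : nat).
Local Notation C := R[i].
Local Notation pt := (idx -> C).
Local Notation absrep := (@absrep R s).

Definition mono0 : mono := fun=> 0%N.

Definition mono1 (v : idx) : mono := fun w => (w == v)%N.

Definition axis (v : idx) (t : R) : pt := fun w => if w == v then t%:C%C else 0.

Definition expands (H : fpseries R) (f : pt -> C) (B : R) : Prop :=
  [/\ pseries_ok s H, bounded_sum (fun m : mono => cnorm (H m)) B &
      forall a, polydisc a -> has_sum (fun m : mono => H m * mono_eval a m) (f a)].

(** Terms with equal monomials are collected by summing over the fibres of [w]. A monomial outside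
    the image of [w] gets coefficient 0, which yields [pseries_ok]. *)
Lemma absrep_expands f B : absrep f B -> exists H, expands H f B.
Proof.
move=> [I [c [w [hw hB h]]]].
pose cm (m : mono) i := if w i == m then c i else 0.
have hcm m : has_sum (cm m) (sumI (cm m)).
  apply: (@sumIP _ _ _ B); apply: bounded_sum_mono hB => i.
  by rewrite /cm; case: ifP => // _; rewrite cnorm0 cnorm_ge0.
exists (fun m => sumI (cm m)); split.
- move=> m Hm; have [[i <-]|nw] := pselect (exists i, w i = m); first exact: hw.
  have c0 : cm m = fun=> 0.
    by apply/funext => i; rewrite /cm; case: eqP => // wi; exfalso; apply: nw; exists i.
  have h0 := hcm m; rewrite {1}c0 in h0.
  by move: Hm; rewrite -(has_sum_uniq (@has_sum0 R I) h0) eqxx.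
- exact: (bounded_sum_partition hcm hB).
- move=> a ha; apply: (has_sum_partition (p := w)) (h a ha) => m.
  rewrite mulrC; apply: eq_has_sum (has_sumZ (mono_eval a m) (hcm m)) => i.
  by rewrite /cm; case: eqP => [<-|_]; rewrite ?mulr0 // mulrC.
Qed.

Lemma polydisc_axis v t : 0 <= t <= 1 -> polydisc (axis v t).
Proof.
by move=> /andP[t0 t1] w; rewrite /axis; case: eqP => _; rewrite ?cnorm0 // cnormR ger0_norm.
Qed.

(** Such a monomial either contains another variable and vanishes on the axis, or is a power of the
    coordinate with exponent at least 2. *)
Lemma mono_eval_axis v t m : 0 <= t <= 1 -> mono_ok s m -> m <> (fun=> 0%N) -> m <> mono1 v ->
  cnorm (mono_eval (axis v t) m) <= t ^+ 2.
Proof.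
move=> /andP[t0 t1] hm m0 m1; have [F hF] := mono_ok_fset hm; rewrite (mono_evalE _ hF).
have [[w [wv mw]]|h] := pselect (exists w, w != v /\ m w != 0%N).
  rewrite (big_fsetD1 w) ?hF //= /axis (negbTE wv) expr0n (negbTE mw) mul0r cnorm0.
  by rewrite sqr_ge0.
have hv w : w != v -> m w = 0%N.
  by move=> wv; apply/eqP; apply: contra_notT h => mw; exists w.
have mv2 : (1 < m v)%N.
  rewrite ltnNge; apply/negP => mv; case: (posnP (m v)) => mv0.
    by apply: m0; apply/funext => w; have [->//|/hv] := eqVneq w v.
  apply: m1; apply/funext => w; rewrite /mono1; have [->|/hv ->//] := eqVneq w v.
  by apply/eqP; rewrite eqn_leq mv mv0.
rewrite (big_fsetD1 v) ?hF -?lt0n ?(ltnW mv2) //= big_seq big1 ?mulr1.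
  rewrite /axis eqxx cnormX cnormR ger0_norm // -(subnKC mv2) exprD.
  by rewrite ler_piMr ?exprn_ge0 // exprn_ile1.
by move=> w; rewrite !inE => /andP[/hv -> _]; rewrite expr0.
Qed.

Lemma mono_eval_axis1 v t : mono_eval (axis v t) (mono1 v) = t%:C%C.
Proof. by rewrite mono_eval1 /axis eqxx. Qed.

(** With [H_0], [H_1] the coefficients of [mono0] and [mono1 v], the other monomials contribute at
    most [B t^2] on the axis, so [|H_0 + (H_1 - c) t| <= (B + K) t^2]. Letting [t] tend to 0 kills
    [H_0], and after division by [t] also [H_1 - c]. *)
Lemma linear_coef H f B v (c : C) K : in_idx s v -> expands H f B ->
  (forall t : R, 0 < t <= 1 -> cnorm (f (axis v t) - c * t%:C%C) <= K * t ^+ 2) ->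
  H (mono1 v) = c.
Proof.
move=> sv [Hok hB hs] hK.
have m01 : mono0 <> mono1 v by move=> /(congr1 (fun m : mono => m v)); rewrite /mono0 /mono1 eqxx.
have key t : 0 < t <= 1 -> cnorm (H mono0 + (H (mono1 v) - c) * t%:C%C) <= (B + K) * t ^+ 2.
  move=> t01; have /andP[t0 t1] := t01.
  have t01' : 0 <= t <= 1 by rewrite ltW.
  have h := hs _ (polydisc_axis v t01').
  have hF := @has_sum_finsupp R mono (fun m => if (m == mono0) || (m == mono1 v) then
       H m * mono_eval (axis v t) m else 0) [fset mono0; mono1 v]%fset.
  have {}hF : has_sum (fun m : mono => if (m == mono0) || (m == mono1 v) then
       H m * mono_eval (axis v t) m else 0) (H mono0 + H (mono1 v) * t%:C%C).
    move: hF; rewrite big_fsetU1 ?inE /=; last by apply/eqP.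
    rewrite big_seq_fset1 eqxx /= mono_eval0 mulr1 eqxx orbT mono_eval_axis1; apply.
    by move=> m; rewrite !inE => /negbTE ->.
  have hd := has_sumD h (has_sumN hF).
  have : cnorm (f (axis v t) - (H mono0 + H (mono1 v) * t%:C%C)) <= t ^+ 2 * B.
    apply: has_sum_le hd; apply: bounded_sum_mono (bounded_sumZ (sqr_ge0 t) hB) => m /=.
    case: ifP => [_|/norP [/eqP n0 /eqP n1]].
      by rewrite subrr cnorm0 mulr_ge0 ?sqr_ge0 // cnorm_ge0.
    rewrite subr0 cnormM mulrC; have [->|Hm] := eqVneq (H m) 0; first by rewrite cnorm0 !mulr0.
    by rewrite ler_wpM2r ?cnorm_ge0 // mono_eval_axis //; exact: Hok.
  have := hK t t01; set x := f _.
  have := cnorm_dist (H mono0 + H (mono1 v) * t%:C%C) x (c * t%:C%C).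
  rewrite (cnormBC _ x) -addrA -mulrBl; lra.
have BK : 0 <= B + K.
  have := key 1; rewrite ltr01 lexx expr1n => /(_ isT) h.
  by have := le_trans (cnorm_ge0 _) h; rewrite mulr1.
have H0 : H mono0 = 0.
  apply: cnorm_lt_eq0 => e e0; set D := cnorm (H (mono1 v) - c).
  have D0 : 0 <= D by exact: cnorm_ge0.
  pose t := Num.min 1 (e / (2 * (B + K + D + 1))).
  have p0 : 0 < 2 * (B + K + D + 1) by lra.
  have t0 : 0 < t by rewrite lt_min ltr01 divr_gt0.
  have t1 : t <= 1 by rewrite ge_min lexx.
  have te : t * (2 * (B + K + D + 1)) <= e by rewrite -ler_pdivlMr // ge_min lexx orbT.
  have := key t; rewrite t0 t1 => /(_ isT) h.
  have := cnormB (H mono0 + (H (mono1 v) - c) * t%:C%C) ((H (mono1 v) - c) * t%:C%C).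
  rewrite addrK cnormM -/D cnormR (gtr0_norm t0) => h2.
  have : (B + K) * t ^+ 2 <= (B + K) * t by rewrite ler_wpM2l // expr2 ler_piMr // ltW.
  nra.
apply/eqP; rewrite -subr_eq0; apply/eqP; apply: cnorm_lt_eq0 => e e0.
set D := cnorm (H (mono1 v) - c).
pose t := Num.min 1 (e / (2 * (B + K + 1))).
have p0 : 0 < 2 * (B + K + 1) by lra.
have t0 : 0 < t by rewrite lt_min ltr01 divr_gt0.
have t1 : t <= 1 by rewrite ge_min lexx.
have te : t * (2 * (B + K + 1)) <= e by rewrite -ler_pdivlMr // ge_min lexx orbT.
have := key t; rewrite t0 t1 H0 add0r => /(_ isT); rewrite cnormM cnormR (gtr0_norm t0) -/D.
rewrite expr2 mulrA ler_pM2r // => h; nra.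
Qed.

(** The zero exponent is a sum of exponents only if all of them are zero. *)
Lemma ps_prodn0 n (F : 'I_n -> fpseries R) : ps_prodn F (fun=> 0%N) = \prod_(p < n) F p (fun=> 0%N).
Proof.
rewrite /ps_prodn (_ : [set t | _] = [set fun _ _ => 0%N]) ?fsbig_set1 //.
apply/seteqP; split => [t /= h|t -> w /=]; last by rewrite big1.
apply/funext => p; apply/funext => w; have /eqP := h w.
by rewrite sum_nat_eq0 => /forallP /(_ p) /eqP.
Qed.

Lemma fun_independent_diag n (H : 'I_n -> fpseries R) (x : 'I_n -> idx) :
  injective x -> (forall p, in_idx s (x p)) ->
  (forall p r, (H p (mono1 (x r)) != 0) = (p == r)) -> fun_independent s H.
Proof.
move=> xi xs hH; exists x; split => //; split => //; exists (fun=> 0%N).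
(* only the identity permutation contributes to the constant term *)
rewrite /ps_jacdet; under eq_bigr => sg _.
  rewrite ps_prodn0; under eq_bigr => p _.
    rewrite /ps_deriv mul1r (_ : (fun w => _) = mono1 (x (sg p))) //; over.
  over.
rewrite (bigD1 (1%g : 'S_n)) //= [X in _ + X]big1 ?addr0.
  rewrite odd_perm1 expr0 mul1r prodf_seq_neq0; apply/allP => p _ /=.
  by rewrite perm1 hH eqxx.
move=> sg sg1; have [p hp] : exists p, sg p != p.
  apply/existsP; apply: contraR sg1; rewrite negb_exists => /forallP h.
  by apply/eqP/permP => p; rewrite perm1; have := h p; rewrite negbK => /eqP.
rewrite (bigD1 p) //= (_ : H p _ = 0) ?mul0r ?mulr0 //.
by apply/eqP; apply: contraNT hp; rewrite hH eq_sym.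
Qed.

End FormalSeries.

(** * Resonant circles *)

Section Angles.
Variable R : realType.
Local Notation C := R[i].
Implicit Types (t u : R) (k : int).

Lemma cis_2pin (n : nat) : cis (2 * pi * n%:R : R) = 1.
Proof. by rewrite mulrC -cisX cis_2pi expr1n. Qed.

Lemma cis_2piz k : cis (2 * pi * k%:~R : R) = 1.
Proof.
case: k => n; first exact: cis_2pin.
by rewrite NegzE mulrNz mulrN cisN cis_2pin invr1.
Qed.

Lemma pi2_gt0 : 0 < 2 * pi :> R.
Proof. by rewrite mulr_gt0 // pi_gt0. Qed.

Lemma angle_reduce t : exists k, 0 <= t - 2 * pi * k%:~R < 2 * pi.
Proof.
have p0 := pi2_gt0; exists (Num.floor (t / (2 * pi))).
have := floor_le (t / (2 * pi)); have := floorD1_gt (t / (2 * pi)).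
rewrite intrD; set k := (Num.floor _)%:~R => h1 h2.
move: h1 h2; rewrite ltr_pdivrMr // ler_pdivlMr // => h1 h2.
by apply/andP; split; lra.
Qed.

Lemma cis_eq1 t : cis t = 1 -> exists k, t = 2 * pi * k%:~R.
Proof.
move=> ht; have [k /andP[u0 u1]] := angle_reduce t.
exists k; apply/eqP; rewrite -subr_eq0; move: u0 u1.
have : cis (t - 2 * pi * k%:~R) = 1 by rewrite cisD cisN cis_2piz ht invr1 mulr1.
set u := t - _; rewrite cisE => /eqP; rewrite eq_complex /= => /andP[/eqP cu /eqP su] u0 u1.
rewrite eq_le u0 andbT leNgt; apply/negP => up.
have [h|h|h] := ltgtP u pi.
- by have := @sin_gt0_pi R u; rewrite up h su ltxx => /(_ isT).
- have h1 : 0 < u - pi < pi by apply/andP; split; lra.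
  have := sin_gt0_pi h1; rewrite -[X in 0 < X]opprK -sinDpi subrK su oppr0 ltxx.
  by [].
- by move: cu; rewrite h cospi; lra.
Qed.

Lemma cis_inj_mod t u : cis t = cis u -> exists k, t = u + 2 * pi * k%:~R.
Proof.
move=> h; have : cis (t - u) = 1 by rewrite cisD cisN h divff // cis_neq0.
by move=> /cis_eq1 [k hk]; exists k; rewrite -hk addrC subrK.
Qed.

End Angles.

Section ResonantCircles.
Variables (R : realType) (s : nat) (alpha : R).
Local Notation C := R[i].
Local Notation pt := (idx -> C).
Hypotheses (s0 : (0 < s)%N) (halpha : forall q : rat, alpha / (2 * (pi : R)) != ratr q).

(* [freq q = 2 pi pnum q / q] is the first frequency above [alpha] of denominator [q], and
   [radius q] is the radius of the circle on which the twist map has that frequency *)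
Definition pnum (q : nat) : int := Num.floor (q%:R * alpha / (2 * pi)) + 1.
Definition freq (q : nat) : R := 2 * pi * (pnum q)%:~R / q%:R.
Definition radius (q : nat) : R := (freq q - alpha) `^ ((2 * s)%:R^-1).

(** Floor plus one makes the gap positive and at most [2 pi / q]; 8 is a convenient bound for
    [2 pi]. *)
Lemma freq_gap q : (0 < q)%N -> 0 < freq q - alpha <= 8 / q%:R.
Proof.
move=> q0; have p0 := pi2_gt0 R; have p1 : 2 * pi <= 8 :> R by have := @pihalf_lt2 R; lra.
have q0' : 0 < q%:R :> R by rewrite ltr0n.
have := floor_le (q%:R * alpha / (2 * pi)); have := floorD1_gt (q%:R * alpha / (2 * pi)).
rewrite /freq /pnum intrD; set k := (Num.floor _)%:~R => h1 h2.
move: h1 h2; rewrite ltr_pdivrMr // ler_pdivlMr // => h1 h2.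
apply/andP; split; first by rewrite subr_gt0 ltr_pdivlMr //; lra.
have -> : alpha = alpha * q%:R / q%:R by rewrite mulfK // gt_eqF.
by rewrite -mulrBl ler_pM2r ?invr_gt0 //; lra.
Qed.

Lemma radius_gt0 q : (0 < q)%N -> 0 < radius q.
Proof. by move=> /freq_gap /andP[h _]; exact: powR_gt0. Qed.

Lemma radius_pow q : (0 < q)%N -> radius q ^+ (2 * s) = freq q - alpha.
Proof.
move=> /freq_gap /andP[h _]; rewrite -powR_mulrn ?powR_ge0 // -powRrM.
by rewrite mulVf ?powRr1 ?ltW // pnatr_eq0 muln_eq0 /= -lt0n.
Qed.

Lemma radius_q q : (0 < q)%N -> q%:R * radius q ^+ (2 * s) <= 8.
Proof.
move=> q0; rewrite radius_pow //; have /andP[_ h] := freq_gap q0.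
by rewrite mulrC -ler_pdivlMr // ltr0n.
Qed.

Lemma radius_small (e : R) : 0 < e -> exists Q, forall q, (Q <= q)%N -> radius q <= e.
Proof.
move=> e0; have e20 : 0 < e ^+ (2 * s) by rewrite exprn_gt0.
exists (Num.bound (8 / e ^+ (2 * s))).+1 => q hq; have q0 : (0 < q)%N by exact: leq_trans hq.
rewrite -(@ler_pXn2r _ (2 * s)) ?nnegrE ?powR_ge0 ?(ltW e0) ?muln_gt0 //.
rewrite radius_pow //; have /andP[_ h] := freq_gap q0; apply: le_trans h _.
rewrite ler_pdivrMr ?ltr0n // mulrC -ler_pdivrMr //.
have h8 : 0 <= 8 / e ^+ (2 * s) by rewrite divr_ge0 // ltW.
by rewrite (le_trans (ltW (archi_boundP h8))) // ler_nat ltnW.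
Qed.

Lemma freqM q : (0 < q)%N -> q%:R * freq q = 2 * pi * (pnum q)%:~R.
Proof. by move=> q0; rewrite /freq mulrC divfK // pnatr_eq0 -lt0n. Qed.

(** If [q] divides [pnum q], then [freq q] is a multiple of [2 pi] above [alpha], at distance at
    least [freq 1 - alpha]. This fixed distance exceeds [8 / q] for large [q]. *)
Lemma pnum_ndvd : exists Q, forall q, (Q <= q)%N -> ~~ (q%:Z %| pnum q)%Z.
Proof.
have p0 := pi2_gt0 R; have := freq_gap (ltnSn 0); rewrite /freq divr1 divr1.
set g := _ - alpha => /andP[g0 _].
exists (Num.bound (8 / g)).+1 => q hq; have q0 : (0 < q)%N by exact: leq_trans hq.
have q0' : 0 < q%:R :> R by rewrite ltr0n.
apply/negP => /dvdzP [k pk].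
have fk : freq q = 2 * pi * k%:~R.
  rewrite /freq pk intrM; rewrite -[(q%:Z)%:~R]/(q%:R : R) mulrA mulfK //.
  by rewrite pnatr_eq0 -lt0n.
have /andP[h1 h2] := freq_gap q0; rewrite fk in h1 h2.
have hk : (pnum 1)%:~R <= k%:~R :> R.
  rewrite ler_int /pnum -ltzD1 ltrD2r mul1r -(ltr_int R).
  rewrite (le_lt_trans (floor_le _)) // ltr_pdivrMr // mulrC; lra.
have gk : g <= 2 * pi * k%:~R - alpha by rewrite /g lerB // ler_pM2l.
have h8 : 0 <= 8 / g by rewrite divr_ge0 // ltW.
have h3 : 8 / g < q%:R by rewrite (lt_le_trans (archi_boundP h8)) // ler_nat ltnW.
have : g * q%:R <= 8 by rewrite -ler_pdivlMr // (le_trans gk).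
by rewrite leNgt mulrC -ltr_pdivrMr // h3.
Qed.

(** The polydisc also ranges over entries with [i + j <= 2s]; erasing them leaves only variables of
    Sigma in the expansion. On Sigma itself nothing changes. *)
Definition trunc (a : pt) : pt := fun v => if in_idx s v then a v else 0.

(* logarithmic radii of the [q]-periodic orbits started at the angles [0] and [pi] *)
Definition resonance (q : nat) (a : pt) : C :=
  osol s q (radius q) (freq q) 0 (trunc a) - osol s q (radius q) (freq q) pi (trunc a).

(** [2 s < q] makes [a_(q,0)] a variable, oddness of [q] separates the starting angles 0 and pi, and
    non-divisibility makes [pnum q / q] a reduced fraction. The inequality is the smallness required
    by the contraction. *)
Definition admissible (q : nat) : Prop :=
  [/\ prime q, (2 * s < q)%N, (2 < q)%N, 64 * K1 R s * radius q <= rho R s & ~~ (q%:Z %| pnum q)%Z].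

Lemma admissible_large : exists Q, forall q, (Q <= q)%N -> prime q -> admissible q.
Proof.
have [Q1 h1] := pnum_ndvd.
have K0 : 0 < 64 * K1 R s by have := K1_ge R s; lra.
have [Q2 h2] := radius_small (divr_gt0 (rho_gt0 R s0) K0).
exists (maxn (maxn Q1 Q2) (2 * s + 3)) => q; rewrite !geq_max => /andP[/andP[q1 q2] q3] pq.
split => //; try lia; last exact: h1.
by rewrite mulrC -ler_pdivlMr //; exact: h2.
Qed.

Lemma admissible_seq : exists u : nat -> nat,
  [/\ injective u, forall k, (k <= u k)%N & forall k, admissible (u k)].
Proof.
have [Q hQ] := admissible_large.
pose u := fix u k := if k is k'.+1 then s2val (prime_above (u k')) else s2val (prime_above Q).
have u_lt k : (u k < u k.+1)%N by exact: (s2valP (prime_above (u k))).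
have uQ k : (Q <= u k)%N.
  elim: k => [|k IH]; first by rewrite ltnW // (s2valP (prime_above Q)).
  by rewrite (leq_trans IH) // ltnW.
have up k : prime (u k) by case: k => [|k]; rewrite /= (s2valP' (prime_above _)).
have mono_u : {homo u : i j / (i < j)%N} by apply: homo_ltn => //; exact: ltn_trans.
exists u; split; last by move=> k; exact: hQ.
  exact: incn_inj (leq_mono mono_u).
by elim=> // k IH; exact: leq_ltn_trans IH (u_lt k).
Qed.

End ResonantCircles.

(** * The linear part of the resonance functions *)

Section ResonanceExpansion.
Variables (R : realType) (s : nat) (alpha : R).
Local Notation C := R[i].
Local Notation pt := (idx -> C).
Hypotheses (s0 : (0 < s)%N) (halpha : forall q : rat, alpha / (2 * (pi : R)) != ratr q).
Local Notation admissible := (admissible s alpha).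
Local Notation radius := (radius s alpha).
Local Notation freq := (freq alpha).
Local Notation resonance := (resonance s alpha).

Lemma absrep_trunc (v : idx) : absrep s (fun a : pt => trunc s a v) (if in_idx s v then 1 : R else 0).
Proof.
rewrite /trunc; case: (boolP (in_idx s v)) => sv; first exact: absrep_coord.
exact: absrep0.
Qed.

Lemma absrep_resonance q : admissible q -> absrep s (resonance q) (rho R s).
Proof.
move=> [pq _ _ hr _]; have q0 : (0 < q)%N by exact: prime_gt0.
have r0 := radius_gt0 s alpha q0; have hq := radius_q alpha s0 q0.
have h t := absrep_osol (freq q) t s0 q0 r0 hr hq ler01 (lexx 1) absrep_trunc.
apply: (absrep_eqle (absrepB (h 0) (h pi))) => //.
by rewrite mul1r le_eqVlt; apply/orP; left; apply/eqP; field.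
Qed.

Lemma trunc_axis (v : idx) (t : R) : in_idx s v -> trunc s (axis v t) = axis v t.
Proof.
move=> sv; apply/funext => w; rewrite /trunc /axis.
by case: eqP => [->|_]; rewrite ?sv //; case: ifP.
Qed.

Lemma psum_axis (k : nat) (t : R) (x y : C) : psum (axis (k, 0)%N t) x y = t%:C%C * x ^+ k.
Proof.
apply: sumIE.
have := @has_sum_finsupp R idx (fun v : idx => axis (k, 0)%N t v * (x ^+ v.1 * y ^+ v.2)) [fset (k, 0)]%N%fset.
rewrite big_seq_fset1 /= expr0 mulr1 /axis eqxx; apply => w.
by rewrite inE => /negbTE ->; rewrite mul0r.
Qed.

Lemma gterm_axis k (t w th r : R) i :
  gterm s r w th (axis (k, 0)%N t) (fun=> 0) i =
  t%:C%C * r%:C%C ^+ k * (cis (k%:R * (i.+1%:R * w - th)) + cis (- (k%:R * (i.+1%:R * w - th)))).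
Proof.
rewrite /gterm /hval !psum_axis /dfreq !(mulr0, cexp0, subrr, addr0, oppr0, subr0, mulr1).
rewrite ![(_%:C%C * cis _) ^+ _]exprMn !cisX [RHS]mulrDr ![t%:C%C * (_ * _)]mulrA; congr (_ * cis _ + _ * cis _).
  by rewrite -natr1; ring.
by rewrite -natr1; ring.
Qed.

Lemma sum_geom_root (q : nat) (z w : C) : w != 1 -> w ^+ q = 1 -> \sum_(i < q) z * w ^+ i = 0.
Proof.
move=> w1 wq; rewrite -mulr_sumr; have := subrX1 w q.
by rewrite wq subrr => /esym/eqP; rewrite mulf_eq0 subr_eq0 (negbTE w1) => /eqP ->; rewrite mulr0.
Qed.

(** At the zero state the angles advance by [freq q], so [a_(k,0)] contributes powers of the [q]-th
    root of unity [cis (k freq q)]. For a prime [k] other than [q] this root is not 1 and the mean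
    vanishes; for [k = q] all terms agree and leave [2 cos (q th)]. *)
Lemma gmean_axis q k (t th : R) : admissible q -> admissible k ->
  gmean s q (radius q) (freq q) th (axis (k, 0)%N t) (fun=> 0) =
  if q == k then t%:C%C * (radius q)%:C%C ^+ q * (cis (- (q%:R * th)) + cis (q%:R * th)) else 0.
Proof.
move=> [pq _ _ _ pnd] [pk _ _ _ _]; have q0 : (0 < q)%N by exact: prime_gt0.
have qn0 : q%:R != 0 :> C by rewrite pnatr_eq0 -lt0n.
rewrite /gmean; under eq_bigr => i _ do rewrite gterm_axis.
have fq := freqM alpha q0.
case: eqP => [<-{k pk}|qk].
  rewrite (eq_bigr (fun=> t%:C%C * (radius q)%:C%C ^+ q * (cis (- (q%:R * th)) + cis (q%:R * th)))).
    by rewrite sumr_const card_ord -[_ * _ *+ q]mulr_natl mulKf.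
  move=> i _.
  have e : q%:R * (i.+1%:R * freq q - th) = 2 * pi * (i.+1%:Z * pnum alpha q)%:~R + - (q%:R * th).
    rewrite intrM -[(i.+1%:Z)%:~R]/(i.+1%:R : R) mulrBr [q%:R * (_ * _)]mulrCA fq; ring.
  by rewrite e cisN cisD cis_2piz mul1r cisN invrK.
set z := cis (k%:R * freq q).
have zq : z ^+ q = 1.
  rewrite cisX (_ : _ * _ = 2 * pi * (k%:Z * pnum alpha q)%:~R) ?cis_2piz //.
  by rewrite intrM -[(k%:Z)%:~R]/(k%:R : R) mulrCA fq; ring.
(* Otherwise [q] divides [k * pnum q], hence [pnum q], since [k] and [q] are distinct primes. *)
have z1 : z != 1.
  apply/eqP => /cis_eq1 [j hj]; move: pnd; rewrite -(Gauss_dvdzr (m := q%:Z) (n := k%:Z)); last first.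
    by rewrite coprimezE !absz_nat prime_coprime // dvdn_prime2 //; apply/eqP.
  move=> /negP; apply; apply/dvdzP; exists j; apply/eqP; rewrite -(eqr_int R) !intrM.
  rewrite -[(k%:Z)%:~R]/(k%:R : R) -[(q%:Z)%:~R]/(q%:R : R).
  have p0 : 2 * pi != 0 :> R by rewrite gt_eqF // pi2_gt0.
  by apply/eqP; apply: (mulfI p0); rewrite mulrCA -fq mulrCA hj; ring.
have zV1 : z^-1 != 1 by rewrite invr_eq1.
have zVq : z^-1 ^+ q = 1 by rewrite exprVn zq invr1.
rewrite -mulr_sumr big_split /=.
rewrite (eq_bigr (fun i : 'I_q => (z * cis (- (k%:R * th))) * z ^+ i)); last first.
  by move=> i _; rewrite cisX -!cisD; congr cis; rewrite -natr1; ring.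
rewrite [X in _ + X](eq_bigr (fun i : 'I_q => (z^-1 * cis (k%:R * th)) * z^-1 ^+ i)); last first.
  by move=> i _; rewrite -cisN cisX -!cisD; congr cis; rewrite -natr1; ring.
by rewrite !sum_geom_root // addr0 !mulr0.
Qed.

(** For odd [q] the means at the starting angles 0 and pi are [2] and [-2] times [t r^q], whence the
    factor [- 4 cfac]. The two quadratic errors add up to [4 t^2]. *)
Lemma resonance_linear q k (t : R) : admissible q -> admissible k -> 0 < t <= 1 ->
  cnorm (resonance q (axis (k, 0)%N t) -
    (if q == k then - 4 * (cfac s (radius q))%:C%C * (radius q)%:C%C ^+ q else 0) * t%:C%C)
  <= 4 * t ^+ 2.
Proof.
move=> aq ak /andP[t0 t1]; have [pq _ q2 hr _] := aq; have q0 : (0 < q)%N by exact: prime_gt0.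
have [_ sk _ _ _] := ak.
have skv : in_idx s (k, 0)%N by rewrite /in_idx /= addn0.
have r0 := radius_gt0 s alpha q0; have hq := radius_q alpha s0 q0.
have ha v : cnorm (axis (k, 0)%N t v) <= if in_idx s v then t else 0.
  rewrite /axis; case: eqP => [->|_]; first by rewrite skv cnormR ger0_norm // ltW.
  by rewrite cnorm0; case: ifP => // _; rewrite ltW.
(* Taking [kappa = t] makes the error quadratic in [t]. *)
have h th := osol_linear (freq q) th s0 q0 r0 hr hq (ltW t0) t1 ha.
rewrite /resonance trunc_axis //.
have := cnormB (osol s q (radius q) (freq q) 0 (axis (k, 0)%N t) +
    (cfac s (radius q))%:C%C * gmean s q (radius q) (freq q) 0 (axis (k, 0)%N t) (fun=> 0))
  (osol s q (radius q) (freq q) pi (axis (k, 0)%N t) +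
    (cfac s (radius q))%:C%C * gmean s q (radius q) (freq q) pi (axis (k, 0)%N t) (fun=> 0)).
have := h 0; have := h pi; rewrite !gmean_axis //.
move: (osol _ _ _ _ 0 _) (osol _ _ _ _ pi _) => x y.
have oddq : odd q by case: (even_prime pq) => // qq; move: q2; rewrite qq.
have cq : cis (q%:R * pi) = -1 :> C.
  by rewrite -cisX cis_pi -signr_odd oddq expr1.
have cq' : cis (- (q%:R * pi)) = -1 :> C by rewrite cisN cq invrN invr1.
case: ifP => _.
  rewrite mulr0 oppr0 cis0 cq cq' => h1 h2.
  set u := (_ + _) - (_ + _); set v := (X in _ -> cnorm X <= _).
  have -> : v = u by rewrite /u /v; ring.
  by move=> h3; lra.
rewrite !mulr0 mul0r !addr0 subr0; lra.
Qed.

Lemma resonance_series q : admissible q -> exists H, expands s H (resonance q) (rho R s) /\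
  forall k, admissible k -> (H (mono1 (k, 0)%N) != 0) = (q == k).
Proof.
move=> aq; have [H hH] := absrep_expands (absrep_resonance aq).
exists H; split => // k ak; have [_ sk _ _ _] := ak.
have skv : in_idx s (k, 0)%N by rewrite /in_idx /= addn0.
rewrite (linear_coef skv hH (fun t => resonance_linear aq ak)).
case: (q =P k) => _; last by rewrite eqxx.
have [pq _ _ _ _] := aq; have q0 : (0 < q)%N by exact: prime_gt0.
have r0 := radius_gt0 s alpha q0.
have rn (x : R) : x != 0 -> x%:C%C != 0 :> C.
  by apply: contraNneq => /(congr1 (@complex.Re R)) /= ->.
rewrite !mulf_neq0 ?oppr_eq0 ?pnatr_eq0 ?expf_neq0 ?rn ?gt_eqF //.
by rewrite invr_gt0 mulr_gt0 ?exprn_gt0 ?ltr0n ?muln_gt0 ?s0.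
Qed.

End ResonanceExpansion.

(** * Dynamics of the map on circles *)

Section CisBounds.
Variable R : realType.
Local Notation C := R[i].
Implicit Types (x y t : R) (z : C).

(** The estimates of the algebra, applied to constants, double as numerical bounds. *)
Lemma cnorm_cis_sub1_small x : `|x| <= 1 / 2 -> cnorm (cis x - 1) <= 2 * `|x|.
Proof.
move=> hx; have h := absrep_cst 0 (iC R * x%:C%C).
have iC1 : cnorm (iC R) = 1 by rewrite /cnorm /= expr0n /= add0r expr1n sqrtr1.
rewrite cnormM iC1 mul1r cnormR in h.
by rewrite -cexp_iC; exact: absrep_bound (absrep_exp1 h hx) (polydisc_origin R).
Qed.

Lemma cnorm_cis_sub1 x : cnorm (cis x - 1) <= 4 * `|x|.
Proof.
have [h|h] := leP `|x| (1 / 2).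
  by have := cnorm_cis_sub1_small h; have := normr_ge0 x; lra.
by have := cnormB (cis x) 1; rewrite cnorm_cis cnorm1; lra.
Qed.

Lemma cnorm_cis_sub x y : cnorm (cis x - cis y) <= 4 * `|x - y|.
Proof.
rewrite (_ : cis x - cis y = cis y * (cis (x - y) - 1)).
  by rewrite cnormM cnorm_cis mul1r cnorm_cis_sub1.
by rewrite mulrBr mulr1 -cisD [y + _]addrC subrK.
Qed.

Lemma cis_sub1_ge x : `|x| <= 1 / 2 -> `|x| <= cnorm (cis x - 1) + 2 * `|x| ^+ 2.
Proof.
move=> hx; have h := absrep_cst 0 (iC R * x%:C%C).
have iC1 : cnorm (iC R) = 1 by rewrite /cnorm /= expr0n /= add0r expr1n sqrtr1.
rewrite cnormM iC1 mul1r cnormR in h.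
have := absrep_bound (absrep_exp2 h hx) (polydisc_origin R).
have := cnorm_sub_le (iC R * x%:C%C) (cis x - 1).
by rewrite cnormM iC1 mul1r cnormR (cnormBC (iC R * _)) cexp_iC; lra.
Qed.

Lemma polar_form z : exists t, z = (cnorm z)%:C%C * cis t.
Proof.
have [->|z0] := eqVneq z 0; first by exists 0; rewrite cnorm0 mul0r.
have n0 := cnorm_gt0 z0; set n := cnorm z in n0 *.
set c := complex.Re z / n; set d := complex.Im z / n.
have cd : c ^+ 2 + d ^+ 2 = 1.
  by rewrite /c /d !expr_div_n -mulrDl -cnorm_sqr divff // expf_neq0 // gt_eqF.
have c1 : -1 <= c <= 1.
  have : c ^+ 2 <= 1 by have := sqr_ge0 d; lra.
  by move=> c2; apply/andP; split; nra.
have zE (e : R) : cos e = c -> sin e = d -> z = (n%:C%C * cis e).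
  move=> ec ed; rewrite cisE ec ed; apply/eqP; rewrite eq_complex /= !mul0r subr0 addr0.
  by apply/andP; split; apply/eqP; rewrite mulrC divfK // gt_eqF.
have ac := acos_def c1; have sc := sin_acos c1.
have sd : sin (acos c) = `|d| by rewrite sc -cd addrAC subrr add0r sqrtr_sqr.
have [d0|d0] := leP 0 d.
  by exists (acos c); apply: zE; [exact: ac.2|rewrite sd ger0_norm].
exists (- acos c); apply: zE; first by rewrite cosN; exact: ac.2.
by rewrite sinN sd ltr0_norm // opprK.
Qed.
End CisBounds.

Section LipschitzIVT.
Import numFieldNormedType.Exports.

Lemma lipschitz_IVT (R : realType) (f : R -> R) (k a b v : R) : 0 < k ->
  (forall t u, `|f t - f u| <= k * `|t - u|) -> a <= b -> f a <= v <= f b ->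
  exists c, f c = v.
Proof.
move=> k0 fl ab fab.
have fc : continuous f.
  move=> t; apply/cvgrPdist_lt => e e0.
  near=> u; apply: le_lt_trans (fl t u) _.
  rewrite mulrC -ltr_pdivlMr //; near: u.
  by have := @nbhsx_ballx R R t _ (divr_gt0 e0 k0).
have fm : Num.min (f a) (f b) <= v <= Num.max (f a) (f b).
  by move: fab => /andP[h1 h2]; rewrite ge_min le_max h1 h2 orbT.
have [c _ hc] := IVT ab (continuous_subspaceT fc) fm.
by exists c.
Unshelve. all: by end_near.
Qed.

End LipschitzIVT.

(* sealed, so that [ring] and [lra] treat its values as atoms *)
HB.lock Definition twist_of (R : realType) (a : idx -> R[i]) (z : R[i]) : R :=
  complex.Re (psum a z (conjc z)).

Section TwistFactor.
Variables (R : realType) (s : nat) (a : idx -> R[i]).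
Local Notation C := R[i].
Hypotheses (s0 : (0 < s)%N) (ha : inSigma s a).
Local Notation twist := (twist_of a).
Implicit Types (z w : C) (M x : R).

Lemma sigma_coef v : cnorm (a v) <= if in_idx s v then 1 else 0.
Proof.
case: v => i j; case: (boolP (in_idx s (i, j))) => sv; last by rewrite ha.2 // cnorm0.
by have [_ /ltW] := ha.1 i j sv.
Qed.

Lemma sigma_absrep v : absrep s (fun=> a v) (if in_idx s v then 1 else 0 : R).
Proof. exact: absrep_le (absrep_cst s (a v)) (sigma_coef v). Qed.

Lemma sigma_trunc : trunc s a = a.
Proof. by apply/funext => -[i j]; rewrite /trunc; case: ifP => // /negbT /ha.2 ->. Qed.

Lemma sigma_polydisc : polydisc a.
Proof. by move=> v; apply: le_trans (sigma_coef v) _; case: ifP. Qed.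

Lemma sigma_conj i j : conjc (a (i, j)) = a (j, i).
Proof.
case: (boolP (in_idx s (i, j))) => sv; first by have [-> _] := ha.1 i j sv.
by rewrite !ha.2 ?conjc0 // /in_idx /= addnC.
Qed.

Section Radius.
Variable M : R.
Hypothesis hM : 0 <= M <= 1 / 8.

Let absrep_small (z : C) : cnorm z <= M -> absrep s (fun=> z) M.
Proof. exact: absrep_le (absrep_cst s z). Qed.

Lemma psum_sigma_has_sum z w : cnorm z <= M -> cnorm w <= M ->
  has_sum (fun v : idx => a v * (z ^+ v.1 * w ^+ v.2)) (psum a z w).
Proof.
move=> /absrep_small hz /absrep_small hw.
have [hS _] := bounded_sum_tail ler01 hM (fun v => lexx (if in_idx s v then 1 else 0)).
exact: (has_sum_psum sigma_absrep hS hz hw (polydisc_origin R)).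
Qed.

Lemma psum_sigma_bound z w : cnorm z <= M -> cnorm w <= M ->
  cnorm (psum a z w) <= Kc R s * M ^+ (2 * s).+1.
Proof.
move=> /absrep_small hz /absrep_small hw.
have [hS _] := bounded_sum_tail ler01 hM (fun v => lexx (if in_idx s v then 1 else 0)).
have := absrep_bound (absrep_psum sigma_absrep hS hz hw) (polydisc_origin R).
by rewrite mul1r.
Qed.

Lemma psum_sigma_lip z w z' w' d : cnorm z <= M -> cnorm w <= M -> cnorm z' <= M -> cnorm w' <= M ->
  cnorm (z - z') <= d -> cnorm (w - w') <= d ->
  cnorm (psum a z w - psum a z' w') <= Kc R s * M ^+ (2 * s) * d.
Proof.
move=> /absrep_small hz /absrep_small hw /absrep_small hz' /absrep_small hw' hd hd'.
have [hS hS'] := bounded_sum_tail ler01 hM (fun v => lexx (if in_idx s v then 1 else 0)).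
have := absrep_bound (absrep_psum_sub sigma_absrep hS hz hw hz' hw'
  (absrep_le (absrep_cst s (z - z')) hd) (absrep_le (absrep_cst s (w - w')) hd') hS') (polydisc_origin R).
by rewrite mul1r.
Qed.

End Radius.

Lemma eighth_itv : 0 <= (1 / 8 : R) <= 1 / 8.
Proof. by apply/andP; split; lra. Qed.

Lemma has_sum_conj (I : choiceType) (c : I -> C) l :
  has_sum c l -> has_sum (fun i => conjc (c i)) (conjc l).
Proof.
move=> h e /h [F0 hF]; exists F0 => F /hF.
by rewrite -cnorm_conj rmorphB rmorph_sum.
Qed.

(** Conjugation exchanges the terms of index [(i,j)] and [(j,i)], so the sum is its own
    conjugate. *)
Lemma psum_sigma_real z : cnorm z <= 1 / 8 -> psum a z (conjc z) = (twist z)%:C%C.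
Proof.
move=> hz; have hM := eighth_itv.
have h := psum_sigma_has_sum hM hz (_ : cnorm (conjc z) <= 1 / 8).
rewrite cnorm_conj in h; have {}h := h hz.
have e : conjc (psum a z (conjc z)) = psum a z (conjc z).
  apply: (has_sum_uniq _ h); pose sw (v : idx) : idx := (v.2, v.1).
  apply: (@has_sum_pinj _ idx idx sw (fun v => Some (sw v))) (has_sum_conj h).
  - by case.
  - by case.
  - by move=> [i j] /=; rewrite rmorphM rmorphM !rmorphXn /= conjcK sigma_conj [_ ^+ j * _]mulrC.
move: e; rewrite twist_of.unlock; case: (psum _ _ _) => x y [] /eqP.
rewrite eq_sym -addr_eq0 -mulr2n mulrn_eq0 /= => /eqP ->.
by [].
Qed.

(** Identifies the value picked by [epsilon] in [atilde], a series by total degree, with the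
    unconditional double sum. *)
Lemma atilde_twist z : cnorm z <= 1 / 8 -> atilde s a z = (twist z)%:C%C.
Proof.
move=> hz; have hM := eighth_itv.
rewrite -psum_sigma_real //; have hz' : cnorm (conjc z) <= 1 / 8 by rewrite cnorm_conj.
have h := psum_sigma_has_sum hM hz hz'.
have h2 := has_sum_nat (has_sum_partition (fun n => has_sum_antidiag _ n) h).
have {}h2 : seriesC (fun n => if (2 * s < n)%N then
   \sum_(i < n.+1) a (val i, (n - val i)%N) * z ^+ i * (conjc z) ^+ (n - i) else 0)
   (psum a z (conjc z)).
  move: h2; congr (seriesC _ _); apply/funext => n; case: ifP => sn.
    by apply: eq_bigr => i _ /=; rewrite mulrA.
  rewrite big1 // => i _ /=; rewrite ha.2 ?mul0r // /in_idx /= subnKC ?sn //.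
  by rewrite -ltnS.
exact: seriesC_uniq (epsilon_spec (inhabits 0) (seriesC _) (ex_intro _ _ h2)) h2.
Qed.

Lemma twist_bound z M : cnorm z <= M -> M <= 1 / 8 -> `|twist z| <= Kc R s * M ^+ (2 * s).+1.
Proof.
move=> hz hM; have M0 : 0 <= M by exact: le_trans (cnorm_ge0 z) hz.
have hM' : 0 <= M <= 1 / 8 by rewrite M0.
rewrite -cnormR -psum_sigma_real; last by exact: le_trans hz hM.
by apply: psum_sigma_bound => //; rewrite cnorm_conj.
Qed.

Lemma twist_lip z w M : cnorm z <= M -> cnorm w <= M -> M <= 1 / 8 ->
  `|twist z - twist w| <= Kc R s * M ^+ (2 * s) * cnorm (z - w).
Proof.
move=> hz hw hM; have M0 : 0 <= M by exact: le_trans (cnorm_ge0 z) hz.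
have hM' : 0 <= M <= 1 / 8 by rewrite M0.
rewrite -cnormR (_ : (twist z - twist w)%:C%C = (twist z)%:C%C - (twist w)%:C%C); last exact: rmorphB.
rewrite -!psum_sigma_real; try (apply: le_trans hM; assumption).
by apply: psum_sigma_lip; rewrite ?cnorm_conj // -rmorphB cnorm_conj.
Qed.

Lemma phi_twist z : cnorm z <= 1 / 8 -> phi_a s a z = z * cis (twist z).
Proof. by move=> hz; rewrite /phi_a atilde_twist // cexp_iC. Qed.

Lemma cnorm_phi z : cnorm z <= 1 / 8 -> cnorm (phi_a s a z) = cnorm z.
Proof. by move=> hz; rewrite phi_twist // cnormM cnorm_cis mulr1. Qed.

(** Below this radius [twist] has Lipschitz constant at most 1/8. *)
Definition rsmall : R := (8 * Kc R s)^-1.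

Lemma Kc_rsmall : Kc R s * rsmall = 1 / 8.
Proof. by have := Kc_ge1 R s => h; rewrite /rsmall; field; rewrite gt_eqF //; lra. Qed.

Lemma rsmall_gt0 : 0 < rsmall.
Proof. by rewrite invr_gt0 mulr_gt0 //; have := Kc_ge1 R s; lra. Qed.

Lemma rsmall_le : rsmall <= 1 / 8.
Proof. by have := Kc_rsmall; have := Kc_ge1 R s; have := rsmall_gt0; nra. Qed.

Lemma Kc_pow M : 0 <= M <= rsmall -> Kc R s * M ^+ (2 * s) <= 1 / 8.
Proof.
move=> /andP[M0 M1]; have r1 := rsmall_le.
have h : M ^+ (2 * s) <= M.
  by apply: ler_iXnr; rewrite ?muln_gt0 ?s0 //; lra.
rewrite -Kc_rsmall ler_wpM2l ?(le_trans h) //.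
by have := Kc_ge1 R s; lra.
Qed.

(** Equal images give [z - w = w (cis (twist w - twist z) - 1)], of modulus at most
    [|z - w| / 16]. *)
Lemma phi_inj z w : cnorm z <= rsmall -> cnorm w <= rsmall -> phi_a s a z = phi_a s a w -> z = w.
Proof.
move=> hz hw; have r1 := rsmall_le; have r0 := rsmall_gt0.
have z8 : cnorm z <= 1 / 8 by lra.
have w8 : cnorm w <= 1 / 8 by lra.
rewrite !phi_twist // => e; have K1 : Kc R s * rsmall ^+ (2 * s) <= 1 / 8 by apply: Kc_pow; rewrite lexx ltW.
have h1 : cnorm (z - w) <= cnorm w * (4 * `|twist w - twist z|).
  have -> : z - w = w * (cis (twist w - twist z) - 1).
    apply: (mulIf (cis_neq0 (twist z))).
    by rewrite -mulrA [(cis _ - 1) * _]mulrBl mul1r -cisD subrK mulrBr -e mulrBl.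
  by rewrite cnormM ler_wpM2l ?cnorm_ge0 // cnorm_cis_sub1.
have h2 := twist_lip hw hz r1; rewrite cnormBC in h2.
have d0 := cnorm_ge0 (z - w); have w0 := cnorm_ge0 w.
set d := cnorm (z - w) in h1 h2 d0; set t := `|_| in h1 h2.
have t0 : 0 <= t by exact: normr_ge0.
have h3 : t <= 1 / 8 * d by apply: le_trans h2 _; rewrite ler_wpM2r.
have h4 : d <= 0.
  have : cnorm w * (4 * t) <= 1 / 8 * (4 * t) by rewrite ler_wpM2r ?mulr_ge0 //; lra.
  by lra.
by apply/eqP; rewrite -subr_eq0; apply/eqP; apply: cnorm_eq0; apply/eqP; rewrite eq_le h4.
Qed.

(** Circles are preserved, so only an angle is sought. As [|twist| <= 1] there, the continuous
    function [f] takes the value [b] between [b - 1] and [b + 1]. *)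
Lemma phi_surj z : cnorm z <= rsmall -> exists w, cnorm w = cnorm z /\ phi_a s a w = z.
Proof.
move=> hz; have r1 := rsmall_le; have r0 := rsmall_gt0.
have [b zE] := polar_form z; set r := cnorm z in hz zE *.
have rr : 0 <= r by exact: cnorm_ge0.
pose f (t : R) := t + twist (r%:C%C * cis t).
have nr t : cnorm (r%:C%C * cis t) = r by rewrite cnormM cnormR cnorm_cis mulr1 ger0_norm.
have K1 : Kc R s * r ^+ (2 * s) <= 1 / 8 by apply: Kc_pow; rewrite rr.
have K0 : 0 <= Kc R s * r ^+ (2 * s).
  by rewrite mulr_ge0 ?exprn_ge0 //; have := Kc_ge1 R s; lra.
have fl t u : `|f t - f u| <= 2 * `|t - u|.
  have h1 : `|twist (r%:C%C * cis t) - twist (r%:C%C * cis u)| <= 1 / 8 * (r * (4 * `|t - u|)).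
    apply: le_trans (twist_lip (M := r) _ _ _) _; rewrite ?nr //; first by lra.
    rewrite -mulrBr cnormM cnormR ger0_norm //.
    apply: ler_pM => //; first by rewrite mulr_ge0 ?cnorm_ge0.
    by rewrite ler_wpM2l // cnorm_cis_sub.
  have -> : f t - f u = (t - u) + (twist (r%:C%C * cis t) - twist (r%:C%C * cis u)).
    by rewrite /f opprD addrACA.
  apply: le_trans (ler_normD _ _) _; have := normr_ge0 (t - u).
  move: h1; move: (`|twist _ - _|) (`|t - u|) => x y h1 y0; nra.
have tb t : `|twist (r%:C%C * cis t)| <= 1.
  apply: le_trans (twist_bound (M := r) _ _) _; rewrite ?nr //; first by lra.
  by rewrite exprS; nra.
have b1 : b - 1 <= b + 1 by lra.
have fb : f (b - 1) <= b <= f (b + 1).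
  have := tb (b - 1); have := tb (b + 1); rewrite !ler_norml /f => /andP[h1 h2] /andP[h3 h4].
  by apply/andP; split; lra.
have [c hc] := lipschitz_IVT (ltr0n _ 2) fl b1 fb.
exists (r%:C%C * cis c); rewrite nr; split => //.
by rewrite phi_twist ?nr; [rewrite zE -mulrA -cisD -hc|lra].
Qed.

Lemma phi_local_inverse : exists psi, local_inverse (phi_a s a) psi.
Proof.
have r1 := rsmall_le; have r0 := rsmall_gt0.
(* The default 0 keeps the continuity clause of [local_inverse] true for every [e], however
   large. *)
pose psi z := if cnorm z <= rsmall then epsilon (inhabits 0) (fun w => cnorm w = cnorm z /\ phi_a s a w = z) else 0.
have psiP z : cnorm z <= rsmall -> cnorm (psi z) = cnorm z /\ phi_a s a (psi z) = z.
  by move=> hz; rewrite /psi hz; exact: (epsilon_spec (inhabits 0) (fun w => cnorm w = cnorm z /\ phi_a s a w = z) (phi_surj hz)).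
exists psi; split; [|split].
- by apply: cnorm_eq0; rewrite (psiP 0 _).1 cnorm0 // ltW.
- move=> e e0; exists e; split => // z ze.
  case: (boolP (cnorm z <= rsmall)) => hz; first by rewrite (psiP z hz).1.
  by rewrite /psi (negbTE hz) cnorm0.
- exists rsmall; split => // z /ltW hz; split; first exact: (psiP z hz).2.
  have hp : cnorm (phi_a s a z) <= rsmall by rewrite cnorm_phi //; lra.
  have [h1 h2] := psiP _ hp.
  by apply: phi_inj => //; rewrite h1.
Qed.

Lemma Tmap_cis alpha z : Tmap s alpha z = z * cis (alpha + cnorm z ^+ (2 * s)).
Proof.
by rewrite /Tmap mul_conjc -rmorphXn -exprM -rmorphD cexp_iC.
Qed.

Definition inverse_radius psi (r : R) : Prop := 0 < r <= rsmall /\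
  forall z, cnorm z < r ->
    [/\ cnorm (psi z) = cnorm z, phi_a s a (psi z) = z & psi (phi_a s a z) = z].

(** Near 0 any local inverse preserves the modulus because [phi_a] does. *)
Lemma inverse_radius_ex psi : local_inverse (phi_a s a) psi -> exists r, inverse_radius psi r.
Proof.
have r1 := rsmall_le; have r0 := rsmall_gt0.
move=> [psi0 [psic [r [rp hr]]]]; have [d [d0 hd]] := psic _ r0.
exists (Num.min rsmall (Num.min r d)); split; first by rewrite !lt_min r0 rp d0 ge_min lexx.
move=> z; rewrite !lt_min => /andP[_ /andP[z2 z3]]; have [h1 h2] := hr z z2.
by split => //; rewrite -[in RHS]h1 cnorm_phi //; have := hd z z3; lra.
Qed.

Lemma varphi_cis alpha psi r z : inverse_radius psi r -> cnorm z < r ->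
  let v := psi (conjc z) in let u := conjc v * cis (alpha + cnorm z ^+ (2 * s)) in
  [/\ cnorm v = cnorm z, z = conjc v * cis (- twist v) &
      varphi_a s alpha a psi z = z * cis (alpha + cnorm z ^+ (2 * s) + (twist u + twist v))].
Proof.
have r1 := rsmall_le; move=> [/andP[r0 rr] hr] hz v u.
have cz : cnorm (conjc z) < r by rewrite cnorm_conj.
have [vz pv _] := hr _ cz; rewrite cnorm_conj -/v in vz; rewrite -/v in pv.
have v8 : cnorm v <= 1 / 8 by rewrite vz; lra.
have uz : cnorm u = cnorm z by rewrite /u cnormM cnorm_cis mulr1 cnorm_conj.
have zE : z = conjc v * cis (- twist v).
  rewrite -[LHS]conjcK -pv phi_twist // [LHS]rmorphM; congr (_ * _); exact: conjc_cis.
split => //; rewrite /varphi_a /tau -/v Tmap_cis cnorm_conj vz -/u.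
rewrite phi_twist ?uz; last by lra.
set tu := twist u; set om := alpha + _.
have -> : u * cis tu = conjc v * cis (om + tu) by rewrite cisD mulrA.
rewrite [X in _ = X * _]zE -mulrA -cisD; congr (_ * cis _); ring.
Qed.

End TwistFactor.

(** * Analytic germs and conjugacies *)

Section AnalyticGerms.
Variable R : realType.
Local Notation C := R[i].
Implicit Types (z w : C) (r m : R).

Lemma bounded_sum_fibers (I J : choiceType) (p : I -> J) (f : I -> R) (B : J -> R) M :
  (forall j (F : {fset I}), \sum_(i <- F | p i == j) f i <= B j) ->
  bounded_sum B M -> bounded_sum f M.
Proof.
move=> h hB F; pose G := [fset p i | i in F]%fset.
rewrite (le_trans _ (hB G)) // [leLHS](_ : _ = \sum_(i <- F | p i \in G) f i).
  rewrite -(sum_fibers p); apply: ler_sum => j _.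
  by rewrite -big_mkcond; exact: h.
rewrite big_seq [RHS]big_seq_cond; apply: eq_bigl => i.
case: (boolP (i \in F)) => //= iF.
by rewrite (_ : _ \in _) //; apply/imfsetP; exists i.
Qed.

Lemma bounded_sum_antidiag (f : idx -> R) M : (forall v, 0 <= f v) ->
  (forall N : nat, \sum_(n < N) \sum_(k < n.+1) f (val k, (n - val k)%N) <= M) -> bounded_sum f M.
Proof.
move=> f0 h; apply: (@bounded_sum_fibers _ _ (fun v : idx => v.1 + v.2)%N f
   (fun n => \sum_(k < n.+1) f (val k, (n - val k)%N))); last first.
  by apply: bounded_sum_nat => // n; rewrite sumr_ge0.
move=> n F; pose r := [seq (k, n - k)%N | k <- index_iota 0 n.+1].
have -> : \sum_(k < n.+1) f (val k, (n - val k)%N) = \sum_(v <- r) f v.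
  by rewrite big_map big_mkord.
have ur : uniq r by rewrite map_inj_uniq; [exact: iota_uniq|move=> i j []].
have := @fset_sum_le R idx f [fset v in F | (v.1 + v.2 == n)%N]%fset r f0.
rewrite big_fset /=; apply => //.
move=> [i j] hF; have ijn : (i + j)%N = n by move: hF; rewrite !inE /= => /andP[_ /eqP].
apply/mapP; exists i.
  by rewrite mem_index_iota; lia.
by congr pair; lia.
Qed.

Lemma ranalytic_psum Phi : ranalytic0 Phi -> exists (B : idx -> C) (rho M : R),
  [/\ 0 < rho, bounded_sum (fun v : idx => cnorm (B v) * rho ^+ (v.1 + v.2)) M &
      forall z, cnorm z <= rho -> Phi z = psum B z (conjc z)].
Proof.
move=> [r [r0 [b [[M hM] hb]]]]; pose B (v : idx) := b v.1 v.2.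
have hB : bounded_sum (fun v : idx => cnorm (B v) * r ^+ (v.1 + v.2)) M.
  apply: bounded_sum_antidiag => [v|N]; first by rewrite mulr_ge0 ?cnorm_ge0 ?exprn_ge0 // ltW.
  rewrite (le_trans _ (hM N)) // ler_sum // => n _; apply: ler_sum => k _ /=.
  by rewrite subnKC // -ltnS.
(* Halving the radius replaces the open disc by a closed one. *)
have r20 : 0 < r / 2 by lra.
have hB2 : bounded_sum (fun v : idx => cnorm (B v) * (r / 2) ^+ (v.1 + v.2)) M.
  apply: bounded_sum_mono hB => v; rewrite ler_wpM2l ?cnorm_ge0 //.
  by apply: lerXn2r; rewrite ?nnegrE; lra.
exists B, (r / 2), M; split => // z hz.
have hs : has_sum (fun v : idx => B v * (z ^+ v.1 * conjc z ^+ v.2)) (psum B z (conjc z)).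
  apply: (@sumIP _ _ _ M); apply: bounded_sum_mono hB2 => v.
  rewrite !cnormM !cnormX cnorm_conj -exprD ler_wpM2l ?cnorm_ge0 //.
  by apply: lerXn2r; rewrite ?nnegrE ?cnorm_ge0 //; lra.
have h2 := has_sum_nat (has_sum_partition (fun n => has_sum_antidiag _ n) hs).
have zr : cnorm z < r by lra.
apply: seriesC_uniq (hb z zr) _; move: h2; congr (seriesC _ _); apply/funext => n.
by apply: eq_bigr => i _ /=; rewrite mulrA.
Qed.

Lemma nat_le_4pow n : n%:R <= (4 : R) ^+ n.
Proof. by rewrite -natrX ler_nat ltnW // ltn_expl. Qed.

(* the remainder is small in the C^1 sense: its Lipschitz constant on the ball of radius [m]
   is [O(m)] *)
Lemma analytic_taylor Phi : ranalytic0 Phi -> Phi 0 = 0 ->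
  exists (b c : C) (E : C -> C) (rho K : R), [/\ 0 < rho, 0 <= K,
    forall z, cnorm z <= rho -> Phi z = b * z + c * conjc z + E z,
    E 0 = 0 &
    forall m z w, m <= rho -> cnorm z <= m -> cnorm w <= m -> cnorm (E z - E w) <= K * m * cnorm (z - w)].
Proof.
move=> /ranalytic_psum [B [rho [M [r0 hB hPhi]]]] Phi0.
have M0 := bounded_sum_ge0 hB.
pose B2 (v : idx) := if (1 < v.1 + v.2)%N then B v else 0.
pose E z := psum B2 z (conjc z).
have hB2 m : 0 <= m <= rho -> bounded_sum (fun v : idx => cnorm (B2 v) * m ^+ (v.1 + v.2)) M.
  move=> /andP[m0 m1]; apply: bounded_sum_mono hB => v; rewrite /B2; case: ifP => _.
    by rewrite ler_wpM2l ?cnorm_ge0 //; apply: lerXn2r; rewrite ?nnegrE // ltW.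
  by rewrite cnorm0 mul0r mulr_ge0 ?cnorm_ge0 ?exprn_ge0 // ltW.
(* In degree [n + 2] one has [(n+2) m^(n+1) <= 4^(n+2) m (rho/4)^n = 16 m rho^n]: a radius four
   times smaller absorbs the degree, and the two missing powers of [rho] give [16 / rho^2]. *)
have hB2' m : 0 <= m <= rho / 4 ->
    bounded_sum (fun v : idx => cnorm (B2 v) * ((v.1 + v.2)%:R * m ^+ (v.1 + v.2).-1)) (16 / rho ^+ 2 * m * M).
  move=> /andP[m0 m1]; have k0 : 0 <= 16 / rho ^+ 2 * m.
    by rewrite mulr_ge0 // divr_ge0 // exprn_ge0 // ltW.
  apply: bounded_sum_mono (bounded_sumZ k0 hB) => v; rewrite /B2; case: ifP => vn; last first.
    by rewrite cnorm0 mul0r mulr_ge0 // mulr_ge0 ?cnorm_ge0 ?exprn_ge0 // ltW.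
  rewrite [leRHS]mulrCA ler_wpM2l ?cnorm_ge0 //; move: vn; case: (v.1 + v.2)%N => [|[|n]] // _.
  rewrite /= [m ^+ n.+1]exprS [leLHS]mulrCA -[leRHS]mulrA [leRHS]mulrCA ler_wpM2l //.
  have h1 : m ^+ n <= (rho / 4) ^+ n by apply: lerXn2r; rewrite ?nnegrE //; lra.
  have h2 := nat_le_4pow n.+2.
  apply: le_trans (ler_pM _ _ h2 h1) _; rewrite ?exprn_ge0 //.
  rewrite expr_div_n !exprS le_eqVlt; apply/orP; left; apply/eqP.
  by field; rewrite expf_neq0 // gt_eqF.
have absE m z : cnorm z <= m -> absrep 0 (fun=> z) m by exact: absrep_le (absrep_cst 0 z).
have hE m z : 0 <= m <= rho -> cnorm z <= m ->
    has_sum (fun v : idx => B2 v * (z ^+ v.1 * conjc z ^+ v.2)) (E z).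
  move=> hm hz; have hz' : cnorm (conjc z) <= m by rewrite cnorm_conj.
  exact: (has_sum_psum (fun v => absrep_cst 0 (B2 v)) (hB2 m hm) (absE m z hz) (absE m _ hz')
     (polydisc_origin R)).
have rr : 0 <= rho <= rho by rewrite lexx andbT ltW.
have E0 : E 0 = 0.
  apply: sumIE; apply: eq_has_sum (@has_sum0 R idx) => v.
  rewrite /B2 conjc0 !expr0n; case: ifP => h; last by rewrite mul0r.
  by move: h; case: v => [[|i] [|j]] //= _; rewrite ?(mul0r, mulr0).
have hfull z : cnorm z <= rho -> Phi z = B (0, 0)%N + B (1, 0)%N * z + B (0, 1)%N * conjc z + E z.
  move=> hz; rewrite hPhi //; apply: sumIE; rewrite addrC.
  pose B1 (v : idx) := if (1 < v.1 + v.2)%N then 0 else B v.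
  have h1 : has_sum (fun v : idx => B1 v * (z ^+ v.1 * conjc z ^+ v.2))
      (B (0, 0)%N + B (1, 0)%N * z + B (0, 1)%N * conjc z).
    have := @has_sum_finsupp R idx (fun v : idx => B1 v * (z ^+ v.1 * conjc z ^+ v.2))
      [fset (0, 0)%N; (1, 0)%N; (0, 1)%N]%fset.
    rewrite -fsetUA !big_fsetU1 ?inE //= big_seq_fset1 /B1 /= !expr0 !expr1 !mul1r !mulr1 addrA; apply.
    move=> [[|[|i]] [|[|j]]]; rewrite ?inE //= ?mul0r //.
  apply: eq_has_sum (has_sumD (hE rho z rr hz) h1) => v.
  by rewrite /B1 /B2; case: ifP => _; rewrite ?mul0r ?addr0 ?add0r.
have B00 : B (0, 0)%N = 0.
  have := hfull 0; rewrite cnorm0 ltW // Phi0 => /(_ isT).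
  by rewrite E0 conjc0 !mulr0 !addr0.
exists (B (1, 0)%N), (B (0, 1)%N), E, (rho / 4), (16 / rho ^+ 2 * M); split => //.
- by rewrite divr_gt0.
- by rewrite mulr_ge0 // divr_ge0 // exprn_ge0 // ltW.
- by move=> z hz; rewrite hfull ?B00 ?add0r //; lra.
- move=> m z w hm hz hw; have m0 : 0 <= m by exact: le_trans (cnorm_ge0 z) hz.
  have m4 : 0 <= m <= rho / 4 by rewrite m0.
  have m1 : 0 <= m <= rho by rewrite m0 /=; lra.
  have hz' : cnorm (conjc z) <= m by rewrite cnorm_conj.
  have hw' : cnorm (conjc w) <= m by rewrite cnorm_conj.
  have hd' : cnorm (conjc z - conjc w) <= cnorm (z - w) by rewrite -rmorphB cnorm_conj.
  have := absrep_bound (absrep_psum_sub (fun v => absrep_cst 0 (B2 v)) (hB2 m m1)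
    (absE m _ hz) (absE m _ hz') (absE m _ hw) (absE m _ hw') (absE _ _ (lexx (cnorm (z - w))))
    (absE _ _ hd') (hB2' m m4)) (polydisc_origin R).
  by rewrite /E (_ : 16 / rho ^+ 2 * M * m = 16 / rho ^+ 2 * m * M) //; ring.
Qed.

End AnalyticGerms.

(** * Normal form of an analytic conjugacy *)

Section ConjugacyNormalForm.
Variables (R : realType) (s : nat) (alpha : R) (a : idx -> R[i]).
Local Notation C := R[i].
Hypotheses (s0 : (0 < s)%N) (ha : inSigma s a).
Hypothesis halpha : forall q : rat, alpha / (2 * (pi : R)) != ratr q.
Local Notation twist := (twist_of a).
Local Notation rsmall := (rsmall R s).

Lemma small_le0 (x B rho : R) : 0 < rho -> 0 <= B ->
  (forall t, 0 < t <= rho -> x <= B * t) -> x <= 0.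
Proof.
move=> r0 B0 h; rewrite leNgt; apply/negP => x0.
have p0 : 0 < 2 * (B + 1) by lra.
pose t := Num.min rho (x / (2 * (B + 1))).
have t0 : 0 < t by rewrite lt_min r0 divr_gt0.
have t1 : t <= rho by rewrite ge_min lexx.
have te : t * (2 * (B + 1)) <= x by rewrite -ler_pdivlMr // ge_min lexx orbT.
have := h t; rewrite t0 t1 => /(_ isT); nra.
Qed.

Lemma lipschitz_at0 (Phi : C -> C) : ranalytic0 Phi -> Phi 0 = 0 -> exists L rho : R,
  [/\ 0 < rho, 1 <= L & forall z, cnorm z <= rho -> cnorm (Phi z) <= L * cnorm z].
Proof.
move=> h h0; have [b [c [E [rho [K [r0 K0 hP E0 hE]]]]]] := analytic_taylor h h0.
have nb := cnorm_ge0 b; have nc := cnorm_ge0 c.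
have Kr : 0 <= K * rho by rewrite mulr_ge0 // ltW.
exists (cnorm b + cnorm c + K * rho + 1), rho; split => //; first by lra.
move=> z hz; rewrite hP //; have := hE rho z 0 (lexx _) hz.
rewrite cnorm0 ltW // E0 !subr0 => /(_ isT) h1.
have := cnormD (b * z + c * conjc z) (E z); have := cnormD (b * z) (c * conjc z).
rewrite !cnormM cnorm_conj; have := cnorm_ge0 z; lra.
Qed.

Section Inverse.
Variables (psi : C -> C) (r1 : R).
Hypothesis hpsi : inverse_radius s a psi r1.
Local Notation F := (varphi_a s alpha a psi).

(* the angle by which [F] departs from the rigid rotation of the circle through [z] *)
Definition angle_shift (z : C) : R :=
  twist (conjc (psi (conjc z)) * cis (alpha + cnorm z ^+ (2 * s))) + twist (psi (conjc z)).

Lemma r1_bounds : 0 < r1 <= 1 / 8.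
Proof. by have [/andP[-> h] _] := hpsi; rewrite (le_trans h) // rsmall_le. Qed.

Lemma F_cis z : cnorm z < r1 -> F z = z * cis (alpha + cnorm z ^+ (2 * s) + angle_shift z).
Proof. by move=> hz; have [_ _ ->] := varphi_cis ha alpha hpsi hz. Qed.

Lemma cnorm_F z : cnorm z < r1 -> cnorm (F z) = cnorm z.
Proof. by move=> hz; rewrite F_cis // cnormM cnorm_cis mulr1. Qed.

Lemma angle_shift_bound z : cnorm z < r1 -> `|angle_shift z| <= 2 * Kc R s * cnorm z ^+ (2 * s).+1.
Proof.
move=> hz; have [vz _ _] := varphi_cis ha alpha hpsi hz.
have /andP[r0 r8] := r1_bounds; have z8 : cnorm z <= 1 / 8 by lra.
have h1 := twist_bound ha (z := psi (conjc z)) (M := cnorm z) _ z8.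
have h2 := twist_bound ha (z := conjc (psi (conjc z)) * cis (alpha + cnorm z ^+ (2 * s))) (M := cnorm z) _ z8.
rewrite cnormM cnorm_cis cnorm_conj mulr1 vz in h2; rewrite vz in h1.
apply: le_trans (ler_normD _ _) _; have := h1 (lexx _); have := h2 (lexx _); lra.
Qed.

Lemma angle_shift_bound_lin z : cnorm z < r1 -> cnorm z ^+ (2 * s) + `|angle_shift z| <= 5 / 4 * cnorm z.
Proof.
move=> hz; have h := angle_shift_bound hz; have [/andP[r0 rs] _] := hpsi.
have /andP[_ r8] := r1_bounds; have z0 := cnorm_ge0 z.
have h1 : cnorm z ^+ (2 * s) <= cnorm z by apply: ler_iXnr; rewrite ?muln_gt0 ?s0 //; lra.
have h2 : Kc R s * cnorm z ^+ (2 * s) <= 1 / 8 by apply: Kc_pow => //; rewrite z0; lra.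
rewrite exprS in h; nra.
Qed.

(* [Phi] conjugates [F] to the twist map, with [Psi] its inverse and [b] the derivative of [Psi] *)
Definition normal_form (Phi Psi E : C -> C) (b : C) (K L rho : R) : Prop :=
  [/\ [/\ 0 < rho, 0 <= K & 1 <= L], b != 0, E 0 = 0,
      (forall m z w, m <= rho -> cnorm z <= m -> cnorm w <= m ->
         cnorm (E z - E w) <= K * m * cnorm (z - w)) &
      [/\ forall w, cnorm w <= rho -> Psi w = b * w + E w,
          forall w, cnorm w <= rho -> cnorm (Psi w) <= L * cnorm w /\ cnorm (Psi w) < r1,
          forall w, cnorm w <= rho -> Psi (Tmap s alpha w) = F (Psi w) &
          forall z, cnorm z <= L * rho -> cnorm (Phi z) <= L * cnorm z /\ Psi (Phi z) = z]].

Lemma alpha_irrational (k : int) : alpha * 2 <> 2 * pi * k%:~R.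
Proof.
move=> h; have := halpha (k%:~R / 2); rewrite rmorphM fmorphV rmorph_int rmorph_nat.
move=> /eqP; apply; have p0 : pi != 0 :> R by rewrite gt_eqF // pi_gt0.
have -> : alpha = pi * k%:~R by lra.
by rewrite [2 * pi]mulrC -mulf_div divff // mul1r.
Qed.

(** The linear part of [Psi] commutes with the rotation by [alpha], and [2 alpha] is not a multiple
    of [2 pi], so its antilinear coefficient [c] vanishes. Then [b] cannot vanish, as [Phi] is
    Lipschitz at 0. *)
Lemma normal_form_ex : analytically_conjugate F (Tmap s alpha) ->
  exists Phi Psi E b K L rho, normal_form Phi Psi E b K L rho.
Proof.
move=> [Phi [Psi [Phi0 [Psi0 [aPhi [aPsi [r2 [r20 hc]]]]]]]].
have [b [c [E [rho1 [K [rho10 K0 hPsi E0 hE]]]]]] := analytic_taylor aPsi Psi0.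
have [L1 [rho2 [rho20 L11 hL1]]] := lipschitz_at0 aPsi Psi0.
have [L2 [rho3 [rho30 L21 hL2]]] := lipschitz_at0 aPhi Phi0.
have /andP[r10 r18] := r1_bounds.
pose L := L1 + L2; have L1' : 1 <= L by rewrite /L; lra.
pose m3 := Num.min rho3 (Num.min r1 r2).
have m30 : 0 < m3 by rewrite !lt_min rho30 r10.
have [m3a m3b m3c] : [/\ m3 <= rho3, m3 <= r1 & m3 <= r2] by rewrite !ge_min !lexx !orbT.
(* The last term keeps [Psi w], and all points of modulus at most [L rho], inside the domains where
   [Phi], [F] and the conjugacy are controlled. *)
pose rho := Num.min (Num.min rho1 1) (Num.min rho2 (m3 / (2 * L))).
have L20 : 0 < 2 * L by lra.
have rho0 : 0 < rho by rewrite !lt_min rho10 rho20 divr_gt0 ?ltr01.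
have [ra rb rc rd] : [/\ rho <= rho1, rho <= 1, rho <= rho2 & rho <= m3 / (2 * L)].
  by rewrite !ge_min !lexx !orbT.
have Lrho : 2 * (L * rho) <= m3 by move: rd; rewrite ler_pdivlMr //; lra.
have hLip w : cnorm w <= rho -> cnorm (Psi w) <= L * cnorm w /\ cnorm (Psi w) < r1.
  move=> hw; have w0 := cnorm_ge0 w; have h1 : cnorm (Psi w) <= L * cnorm w.
    by apply: le_trans (hL1 w _) _; [lra|rewrite ler_wpM2r // /L; lra].
  by split => //; nra.
have Psi_r2 w : cnorm w <= rho -> cnorm (Psi w) < r2.
  by move=> hw; have [h1 _] := hLip w hw; have w0 := cnorm_ge0 w; nra.
have hstep w : cnorm w <= rho -> Psi (Tmap s alpha w) = F (Psi w).
  move=> hw; have [h1 h2] := hLip w hw; have h3 := Psi_r2 w hw.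
  have wr2 : cnorm w < r2 by nra.
  have [_ [_ <-]] := hc w wr2.
  have h4 : cnorm (F (Psi w)) < r2 by rewrite cnorm_F.
  by have [-> _] := hc _ h4.
have hPhi z : cnorm z <= L * rho -> cnorm (Phi z) <= L * cnorm z /\ Psi (Phi z) = z.
  move=> hz; have z0 := cnorm_ge0 z; split.
    by apply: le_trans (hL2 z _) _; [nra|rewrite ler_wpM2r // /L; lra].
  have z2 : cnorm z < r2 by nra.
  by have [] := hc _ z2.
have small_E w : cnorm w <= rho -> cnorm (E w) <= K * cnorm w ^+ 2.
  move=> hw; have := hE (cnorm w) w 0 _ (lexx _); rewrite E0 cnorm0 !subr0 cnorm_ge0.
  by rewrite -mulrA => h; apply: h => //; lra.
(* At real [w = t] the conjugacy equation reduces to [c t (cis (-alpha) - cis alpha) = O(t^2)]. *)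
have c0 : c = 0.
  pose D := cnorm (cis (- alpha) - cis alpha).
  have D0 : 0 < D.
    apply: cnorm_gt0; rewrite subr_eq0; apply/eqP => /cis_inj_mod [k hk].
    by apply: (@alpha_irrational (- k)); rewrite mulrNz; lra.
  have nb := cnorm_ge0 b; have nc := cnorm_ge0 c.
  suff : cnorm c * D <= 0 by rewrite pmulr_lle0 // => h; apply: cnorm_eq0; apply/eqP; rewrite eq_le h.
  apply: (@small_le0 _ (4 * cnorm c + cnorm b * (5 * L + 4) + 5 * L * cnorm c + 2 * K) rho) => //.
    by rewrite !addr_ge0 ?mulr_ge0 //; lra.
  move=> t /andP[t0 t1]; pose w : C := t%:C%C.
  have nw : cnorm w = t by rewrite cnormR gtr0_norm.
  have hw : cnorm w <= rho by rewrite nw.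
  have [h1 h2] := hLip w hw; rewrite nw in h1.
  set z := Psi w in h1 h2; set x := alpha + t ^+ (2 * s); set y := alpha + cnorm z ^+ (2 * s) + angle_shift z.
  have hT : Tmap s alpha w = w * cis x by rewrite Tmap_cis nw.
  have nT : cnorm (w * cis x) = t by rewrite cnormM cnorm_cis mulr1.
  have e1 : b * (w * cis x) + c * (w * cis (- x)) + E (w * cis x) = (b * w + c * w + E w) * cis y.
    have wbar : conjc w = w by rewrite /w conjc_real.
    have := hstep w hw; rewrite F_cis // -/z -/y hT hPsi; last by rewrite nT; lra.
    have cT : conjc (w * cis x) = w * cis (- x) by rewrite [LHS]rmorphM; congr (_ * _); [exact: wbar|exact: conjc_cis].
    by rewrite cT => ->; rewrite /z hPsi ?wbar //; lra.
  have e2 : c * w * (cis (- alpha) - cis alpha) = c * w * (cis (- alpha) - cis (- x)) +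
     b * w * (cis y - cis x) + c * w * (cis y - cis alpha) + (E w * cis y - E (w * cis x)).
    have {}e1 : c * w * cis (- x) = (b * w + c * w + E w) * cis y - b * w * cis x - E (w * cis x).
      by rewrite -e1; ring.
    by rewrite mulrBr [c * w * (_ - cis (- x))]mulrBr e1; ring.
  have z0 := cnorm_ge0 z.
  have hx : t ^+ (2 * s) <= t by apply: ler_iXnr; rewrite ?muln_gt0 ?s0 //; lra.
  have hx0 : 0 <= t ^+ (2 * s) by rewrite exprn_ge0 // ltW.
  have f1 : cnorm (cis (- alpha) - cis (- x)) <= 4 * t.
    apply: le_trans (cnorm_cis_sub _ _) _; rewrite /x (_ : _ - _ = t ^+ (2 * s)); last by ring.
    by rewrite ger0_norm //; lra.
  have hy := angle_shift_bound_lin h2; have hz0 : 0 <= cnorm z ^+ (2 * s) by rewrite exprn_ge0.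
  have f2 : cnorm (cis y - cis alpha) <= 5 * L * t.
    apply: le_trans (cnorm_cis_sub _ _) _; rewrite /y (_ : _ - _ = cnorm z ^+ (2 * s) + angle_shift z); last by ring.
    by have := ler_normD (cnorm z ^+ (2 * s)) (angle_shift z); rewrite (ger0_norm hz0) => h6; move: (`|_ + angle_shift z|) (`|angle_shift z|) h6 hy => p q' h6 hy; lra.
  have f3 : cnorm (cis y - cis x) <= (5 * L + 4) * t.
    have f4 : cnorm (cis alpha - cis x) <= 4 * t.
      apply: le_trans (cnorm_cis_sub _ _) _; rewrite /x (_ : _ - _ = - t ^+ (2 * s)); last by ring.
      by rewrite normrN ger0_norm //; lra.
    by have := cnorm_dist (cis y) (cis alpha) (cis x); lra.
  have f5 : cnorm (E w * cis y - E (w * cis x)) <= 2 * K * t ^+ 2.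
    apply: le_trans (cnormB _ _) _; rewrite cnormM cnorm_cis mulr1.
    by have := small_E w hw; have := small_E (w * cis x); rewrite nT nw t1 => /(_ isT); lra.
  have : cnorm c * t * D <= cnorm c * t * (4 * t) + cnorm b * t * ((5 * L + 4) * t) +
     cnorm c * t * (5 * L * t) + 2 * K * t ^+ 2.
    rewrite -{1}nw /D -!cnormM e2.
    apply: le_trans (cnormD _ _) _; apply: lerD => //.
    apply: le_trans (cnormD _ _) _; apply: lerD.
      apply: le_trans (cnormD _ _) _; apply: lerD.
        by rewrite cnormM cnormM nw ler_wpM2l // mulr_ge0 // ltW.
      by rewrite cnormM cnormM nw ler_wpM2l // mulr_ge0 // ltW.
    by rewrite cnormM cnormM nw ler_wpM2l // mulr_ge0 // ltW.
  rewrite (_ : _ + _ = ((4 * cnorm c + cnorm b * (5 * L + 4) + 5 * L * cnorm c + 2 * K) * t) * t); last by ring.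
  by rewrite mulrAC ler_pM2r.
have hPsi' w : cnorm w <= rho -> Psi w = b * w + E w.
  by move=> hw; rewrite hPsi ?c0 ?mul0r ?addr0 //; lra.
(* If [b = 0] then [Psi w = O(|w|^2)], hence [|w| = |Phi (Psi w)| <= L K |w|^2]. *)
have b0 : b != 0.
  apply/eqP => b0; have : (1 : R) <= 0; last by lra.
  apply: (@small_le0 _ (L * K) rho) => //; first by rewrite mulr_ge0 //; lra.
  move=> t /andP[t0 t1]; pose w : C := t%:C%C.
  have nw : cnorm w = t by rewrite cnormR gtr0_norm.
  have hw : cnorm w <= rho by rewrite nw.
  have [h1 h2] := hLip w hw; have wr2 : cnorm w < r2 by nra.
  have hz : cnorm (Psi w) <= L * rho by rewrite (le_trans h1) // ler_wpM2l //; lra.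
  have [h3 _] := hPhi _ hz; have [_ [h4 _]] := hc w wr2; rewrite h4 nw in h3.
  have h5 := small_E w hw; rewrite hPsi' // b0 mul0r add0r in h3; rewrite nw in h5.
  have h6 : t <= L * (K * t ^+ 2) by rewrite (le_trans h3) // ler_wpM2l //; lra.
  by rewrite -(ler_pM2r t0) mul1r; lra.
exists Phi, Psi, E, b, K, L, rho; split => //.
by move=> m z w hm; apply: hE; lra.
Qed.

End Inverse.
End ConjugacyNormalForm.

(** * Images of circles under the conjugacy and their frequencies *)

Section InvariantCircles.
Variables (R : realType) (s : nat) (alpha : R) (a : idx -> R[i]).
Local Notation C := R[i].
Hypotheses (s0 : (0 < s)%N) (ha : inSigma s a).
Variables (psi : C -> C) (r1 : R).
Hypothesis hpsi : inverse_radius s a psi r1.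
Local Notation F := (varphi_a s alpha a psi).
Local Notation eps := (angle_shift s alpha a psi).
Variables (Phi Psi E : C -> C) (b : C) (K L rho : R).
Hypothesis hN : normal_form s alpha a psi r1 Phi Psi E b K L rho.
Implicit Types (w z : C).

Definition omega w : R := alpha + cnorm w ^+ (2 * s).

(** The angle accumulated along the orbit of [Psi w], a sum of real increments that is never reduced
    modulo [2 pi]. *)
Definition lift w (N : nat) : R :=
  \sum_(j < N) (alpha + cnorm (Psi w) ^+ (2 * s) + eps (Psi (w * cis (j%:R * omega w)))).

Lemma Psi_iter w N : cnorm w <= rho ->
  Psi (w * cis (N%:R * omega w)) = Psi w * cis (lift w N).
Proof.
have [_ _ _ _ [_ hL hT _]] := hN; move=> hw.
elim: N => [|N IH]; first by rewrite mul0r cis0 mulr1 /lift big_ord0 cis0 mulr1.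
have nw : cnorm (w * cis (N%:R * omega w)) = cnorm w by rewrite cnormM cnorm_cis mulr1.
have hw' : cnorm (w * cis (N%:R * omega w)) <= rho by rewrite nw.
have e : w * cis (N.+1%:R * omega w) = Tmap s alpha (w * cis (N%:R * omega w)).
  by rewrite Tmap_cis nw -/(omega w) -mulrA -cisD -natr1 mulrDl mul1r.
rewrite e hT // (F_cis alpha ha hpsi); last by have [] := hL _ hw'.
have nz : cnorm (Psi (w * cis (N%:R * omega w))) = cnorm (Psi w).
  by rewrite IH cnormM cnorm_cis mulr1.
by rewrite nz /lift big_ord_recr /= [in RHS]cisD [RHS]mulrA -/(lift w N) -IH.
Qed.

Lemma cnorm_Psi_iter w N : cnorm w <= rho ->
  cnorm (Psi (w * cis (N%:R * omega w))) = cnorm (Psi w).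
Proof. by move=> hw; rewrite Psi_iter // cnormM cnorm_cis mulr1. Qed.

(** For large [N] the quantity [N (alpha + r'^(2s))] sweeps more than a full turn as [r'] runs
    through the interval, so it meets [beta] modulo [2 pi]. *)
Lemma resonant_radius (r d beta : R) : 0 < r -> 0 < d -> exists (r' : R) (N : nat) (k : int),
  r < r' < r + d /\ N%:R * (alpha + r' ^+ (2 * s)) = beta + 2 * pi * k%:~R.
Proof.
move=> r0 d0; have p0 := pi2_gt0 R; have s20 : (0 < 2 * s)%N by rewrite muln_gt0 s0.
pose g := (r + d) ^+ (2 * s) - r ^+ (2 * s).
have g0 : 0 < g by rewrite subr_gt0 ltr_pXn2r // ?nnegrE //; lra.
have pg : 0 <= 2 * pi / g by rewrite divr_ge0 // ltW.
pose N := (Num.bound (2 * pi / g)).+1.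
have N0 : 0 < N%:R :> R by rewrite ltr0n.
have Ng : 2 * pi < N%:R * g.
  rewrite -ltr_pdivrMr // (lt_le_trans (archi_boundP pg)) // ler_nat.
  exact: leqnSn.
pose x := (N%:R * (alpha + r ^+ (2 * s)) - beta) / (2 * pi).
pose k := Num.floor x + 1.
pose y := (beta + 2 * pi * k%:~R) / N%:R - alpha.
have := floor_le x; have := floorD1_gt x; rewrite -/k => h1 h2.
have hk : k%:~R = (Num.floor x)%:~R + 1 :> R by rewrite intrD.
have {h2}h2 : k%:~R <= x + 1 by rewrite hk; lra.
have xE : 2 * pi * x = N%:R * (alpha + r ^+ (2 * s)) - beta by rewrite /x mulrC divfK // gt_eqF.
have h3 : 2 * pi * x < 2 * pi * k%:~R by rewrite ltr_pM2l.
have h4 : 2 * pi * k%:~R <= 2 * pi * (x + 1) by rewrite ler_pM2l.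
have yE : N%:R * (alpha + y) = beta + 2 * pi * k%:~R.
  by rewrite /y addrC subrK mulrC divfK // gt_eqF.
have y1 : r ^+ (2 * s) < y.
  by rewrite -(ltrD2l alpha) -(ltr_pM2l N0) yE; lra.
have y2 : y < (r + d) ^+ (2 * s).
  by rewrite -(ltrD2l alpha) -(ltr_pM2l N0) yE; move: Ng; rewrite /g; lra.
have y0 : 0 < y by apply: le_lt_trans y1; rewrite exprn_ge0 // ltW.
pose r' := y `^ ((2 * s)%:R^-1).
have r'y : r' ^+ (2 * s) = y.
  rewrite -powR_mulrn ?powR_ge0 // -powRrM mulVf ?powRr1 ?ltW //.
  by rewrite pnatr_eq0 -lt0n.
exists r', N, k; rewrite r'y yE; split => //.
have r'0 : 0 <= r' by exact: powR_ge0.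
apply/andP; split.
  by rewrite -(ltr_pXn2r s20) ?nnegrE ?r'y // ltW.
by rewrite -(ltr_pXn2r s20) ?nnegrE ?r'y //; lra.
Qed.

Lemma Psi_lip z w : cnorm z <= rho -> cnorm w <= rho ->
  cnorm (Psi z - Psi w) <= (cnorm b + K * rho) * cnorm (z - w).
Proof.
have [_ _ _ hE [hP _ _ _]] := hN; move=> hz hw; rewrite !hP //.
have := hE rho z w (lexx _) hz hw => h.
rewrite (_ : _ - _ = b * (z - w) + (E z - E w)); last by ring.
by apply: le_trans (cnormD _ _) _; rewrite cnormM mulrDl lerD2l.
Qed.

(* [|Psi|] is invariant under the twist map, whose iterates realize the rotation by [beta]
   exactly on circles arbitrarily close to the given one *)
Lemma cnorm_Psi_rot w beta : cnorm w < rho -> cnorm (Psi (w * cis beta)) = cnorm (Psi w).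
Proof.
move=> hw; have [->|w0] := eqVneq w 0; first by rewrite mul0r.
have [[rho0 K0 L1] _ _ _ _] := hN; have r0 := cnorm_gt0 w0; set r := cnorm w in hw r0.
apply/eqP; rewrite -subr_eq0 -normr_eq0 eq_le normr_ge0 andbT.
set M := cnorm b + K * rho; have M0 : 0 <= M by rewrite addr_ge0 ?cnorm_ge0 ?mulr_ge0 // ltW.
apply: (@small_le0 R _ (2 * M) (rho - r)); [by lra|by lra|move=> d /andP[d0 d1]].
have [r' [N [k [/andP[h1 h2] h3]]]] := resonant_radius beta r0 d0.
pose x := w * (r' / r)%:C%C; have r'0 : 0 < r' / r by rewrite divr_gt0 //; lra.
have nx : cnorm x = r' by rewrite cnormM cnormR gtr0_norm // -/r mulrC divfK // gt_eqF.
have hx : cnorm x <= rho by rewrite nx; lra.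
have xb : x * cis beta = x * cis (N%:R * omega x).
  by rewrite /omega nx h3 cisD cis_2piz mulr1.
have h4 := cnorm_Psi_iter N hx; rewrite -xb in h4.
have dx : cnorm (w - x) <= d.
  have -> : w - x = w * (1 - r' / r)%:C%C by rewrite rmorphB rmorph1 mulrBr mulr1.
  rewrite cnormM cnormR -/r ltr0_norm; last by rewrite subr_lt0 ltr_pdivlMr // mul1r.
  by rewrite opprB mulrBr mulr1 mulrCA divff ?gt_eqF // mulr1; lra.
have wr : cnorm w <= rho by exact: ltW.
have wbr : cnorm (w * cis beta) <= rho by rewrite cnormM cnorm_cis mulr1.
have xbr : cnorm (x * cis beta) <= rho by rewrite cnormM cnorm_cis mulr1.
have h5 := Psi_lip wr hx; have h6 := Psi_lip wbr xbr.
rewrite -mulrBl cnormM cnorm_cis mulr1 in h6.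
have h7 := cnorm_sub_le (Psi w) (Psi x); have h7' := cnorm_sub_le (Psi x) (Psi w).
have h8 := cnorm_sub_le (Psi (w * cis beta)) (Psi (x * cis beta)).
have h8' := cnorm_sub_le (Psi (x * cis beta)) (Psi (w * cis beta)).
rewrite (cnormBC (Psi x)) in h7'; rewrite (cnormBC (Psi (x * _))) in h8'.
have h9 : M * cnorm (w - x) <= M * d by rewrite ler_wpM2l.
rewrite -/M in h5 h6; rewrite ler_norml; apply/andP; split; lra.
Qed.

Section SmallRadius.
Variable rho2 : R.
Hypothesis hrho2 : [/\ 0 < rho2, rho2 < rho, 64 * (K * rho2) <= cnorm b & 8 * ((2 * L + 1) * rho2) <= 1].

Lemma small_E w : cnorm w <= rho2 -> cnorm (E w) <= K * cnorm w ^+ 2.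
Proof.
have [_ _ E0 hE _] := hN; have [h1 h2 _ _] := hrho2; move=> hw.
have := hE (cnorm w) w 0 _ (lexx _); rewrite E0 cnorm0 !subr0 cnorm_ge0.
by rewrite -mulrA => h; apply: h => //; lra.
Qed.

Lemma Psi_lower w : cnorm w <= rho2 -> cnorm b * cnorm w / 2 <= cnorm (Psi w).
Proof.
have [[_ K0 _] _ _ _ [hP _ _ _]] := hN; have [h1 h2 h3 _] := hrho2; move=> hw.
rewrite hP; last by lra.
have h4 := small_E hw; have w0 := cnorm_ge0 w.
have h5 : K * cnorm w ^+ 2 <= cnorm b / 64 * cnorm w.
  rewrite expr2 mulrA ler_wpM2r //; have : K * cnorm w <= K * rho2 by rewrite ler_wpM2l.
  lra.
have := cnorm_sub_le (b * w) (- E w); rewrite opprK cnormN cnormM.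
have : 0 <= cnorm b * cnorm w by rewrite mulr_ge0 ?cnorm_ge0.
lra.
Qed.

Lemma cnorm_Psi_real w : cnorm w <= rho2 -> cnorm (Psi w) = cnorm (Psi (cnorm w)%:C%C).
Proof.
move=> hw; have [t ht] := polar_form w; rewrite [in LHS]ht cnorm_Psi_rot //.
by rewrite cnormR ger0_norm ?cnorm_ge0 //; have [_ h _ _] := hrho2; lra.
Qed.

(** The linear term cancels from [x Psi y - y Psi x], so the small Lipschitz constant of [E] makes
    this vector short. If the moduli agreed, its length would be at least [(y - x) |Psi x|]. *)
Lemma modulus_lt (x y : R) : 0 <= x -> x < y -> y <= rho2 ->
  cnorm (Psi x%:C%C) <> cnorm (Psi y%:C%C).
Proof.
have [[_ K0 _] b0 E0 hE [hP _ _ _]] := hN; have [h1 h2 h3 _] := hrho2.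
move=> x0 xy yr exy; have bp := cnorm_gt0 b0.
have nx : cnorm (x%:C%C : C) = x by rewrite cnormR ger0_norm.
have ny : cnorm (y%:C%C : C) = y by rewrite cnormR ger0_norm //; lra.
have [xz|xn0] := eqVneq x 0.
  have := @Psi_lower y%:C%C; rewrite ny -exy xz => /(_ yr).
  rewrite hP ?cnormR ?normr0 // ?E0 ?mulr0 ?addr0 ?cnorm0; last by lra.
  have : 0 < cnorm b * y by rewrite mulr_gt0 //; lra.
  lra.
have xp : 0 < x by rewrite lt_neqAle eq_sym xn0.
have hx : cnorm (x%:C%C : C) <= rho2 by rewrite nx; lra.
have hy : cnorm (y%:C%C : C) <= rho2 by rewrite ny.
have yx0 : 0 <= y - x by lra.
pose V := x%:C%C * Psi y%:C%C - y%:C%C * Psi x%:C%C.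
have hV : cnorm V <= x * (K * y * (y - x)) + (y - x) * (K * x ^+ 2).
  have -> : V = x%:C%C * (E y%:C%C - E x%:C%C) - (y - x)%:C%C * E x%:C%C.
    by rewrite /V !hP ?nx ?ny; [rewrite rmorphB; ring|lra|lra].
  apply: le_trans (cnormB _ _) _; rewrite !cnormM !cnormR (ger0_norm x0) (ger0_norm yx0).
  apply: lerD; rewrite ler_wpM2l //.
    have := hE y y%:C%C x%:C%C; rewrite nx ny -rmorphB cnormR (gtr0_norm (_ : 0 < y - x)); last by lra.
    by apply; lra.
  by have := small_E hx; rewrite nx.
have hV' : (y - x) * cnorm (Psi x%:C%C) <= cnorm V.
  have := cnorm_sub_le (y%:C%C * Psi x%:C%C) (x%:C%C * Psi y%:C%C).
  rewrite (cnormBC (y%:C%C * _)) -/V !cnormM nx ny -exy; lra.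
have h4 := Psi_lower hx; rewrite nx in h4.
have h5 : (y - x) * (cnorm b * x / 2) <= (y - x) * (2 * (K * rho2) * x).
  have h6 : (y - x) * (cnorm b * x / 2) <= (y - x) * cnorm (Psi x%:C%C) by rewrite ler_wpM2l //; lra.
  have h7 : x * (K * y * (y - x)) <= (y - x) * (K * rho2 * x).
    rewrite (_ : x * _ = (y - x) * (x * (K * y))); last by ring.
    rewrite ler_wpM2l ?subr_ge0 ?(ltW xy) // mulrC ler_wpM2r // ler_wpM2l //.
  have h8 : (y - x) * (K * x ^+ 2) <= (y - x) * (K * rho2 * x).
    by rewrite ler_wpM2l ?subr_ge0 ?(ltW xy) // expr2 mulrA ler_wpM2r // ler_wpM2l //; lra.
  lra.
have : cnorm b * x / 2 <= 2 * (K * rho2) * x by rewrite -(ler_pM2l (_ : 0 < y - x)) //; lra.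
have : 0 < cnorm b * x by rewrite mulr_gt0.
have : 64 * (K * rho2) * x <= cnorm b * x by rewrite ler_wpM2r.
lra.
Qed.

Lemma modulus_inj w z : cnorm w <= rho2 -> cnorm z <= rho2 ->
  cnorm (Psi w) = cnorm (Psi z) -> cnorm w = cnorm z.
Proof.
move=> hw hz; rewrite cnorm_Psi_real // (cnorm_Psi_real hz) => e.
have [h|h|//] := ltgtP (cnorm w) (cnorm z).
  by case: (modulus_lt (cnorm_ge0 w) h hz).
by case: (modulus_lt (cnorm_ge0 z) h hw).
Qed.

(* [Psi w / w] is close to [b], so [Psi] distorts the angle along the orbit of [w] only slightly *)
Lemma cis_lift_near1 w N : cnorm w <= rho2 -> w != 0 ->
  cnorm (cis (lift w N - N%:R * omega w) - 1) <= 1 / 16.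
Proof.
have [[_ K0 _] b0 _ _ [hP _ _ _]] := hN; have [h1 h2 h3 _] := hrho2.
move=> hw w0; have wp := cnorm_gt0 w0; have bp := cnorm_gt0 b0.
have hw' : cnorm w <= rho by lra.
set x := N%:R * omega w; set y := lift w N - x; set wN := w * cis x.
have nw : cnorm wN = cnorm w by rewrite cnormM cnorm_cis mulr1.
have e : Psi w * (cis y - 1) * cis x = E wN - E w * cis x.
  have e1 : b * wN + E wN = Psi w * (cis x * cis y).
    by rewrite -cisD /y [x + _]addrC subrK -Psi_iter // -/x hP // nw.
  have e2 : E wN = Psi w * (cis x * cis y) - b * wN by rewrite -e1; ring.
  have e3 : E w = Psi w - b * w by rewrite hP //; ring.
  by rewrite e2 /wN e3; ring.
have h4 := small_E hw; have h5 : cnorm (E wN) <= K * cnorm w ^+ 2 by rewrite -nw small_E ?nw.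
have h6 : cnorm (Psi w) * cnorm (cis y - 1) <= 2 * (K * cnorm w ^+ 2).
  have := congr1 (@cnorm R) e; rewrite [cnorm (_ * cis x)]cnormM [cnorm (Psi w * _)]cnormM cnorm_cis mulr1 => ->.
  by apply: le_trans (cnormB _ _) _; rewrite cnormM cnorm_cis mulr1; lra.
have h7 := Psi_lower hw; have c0 := cnorm_ge0 (cis y - 1).
have h8 : cnorm b * cnorm w / 2 * cnorm (cis y - 1) <= cnorm (Psi w) * cnorm (cis y - 1).
  by rewrite ler_wpM2r.
have h9 : 2 * (K * cnorm w ^+ 2) <= cnorm b / 32 * cnorm w.
  rewrite expr2 !mulrA ler_wpM2r //; first by rewrite ltW.
  have : K * cnorm w <= K * rho2 by rewrite ler_wpM2l.
  lra.
have bw : 0 < cnorm b * cnorm w by rewrite mulr_gt0.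
rewrite -(ler_pM2l bw); lra.
Qed.

(* the angle gap is within 1/16 of 1 on the unit circle at every step and moves by less than 1/8
   per step, so it never gets around the circle *)
Lemma lift_bound w N : cnorm w <= rho2 -> w != 0 -> `|lift w N - N%:R * omega w| <= 1 / 8.
Proof.
have [[_ K0 L1] _ _ _ [_ hL _ _]] := hN; have [h1 h2 h3 h4] := hrho2.
move=> hw w0; have wp := cnorm_ge0 w.
have hw' : cnorm w <= rho by lra.
elim: N => [|N IH]; first by rewrite /lift big_ord0 mul0r subrr normr0; lra.
have h5 := cis_lift_near1 N.+1 hw w0.
set y := lift w N.+1 - _ in h5 *; set wN := w * cis (N%:R * omega w).
have yE : y = (lift w N - N%:R * omega w) + (cnorm (Psi w) ^+ (2 * s) + eps (Psi wN) - cnorm w ^+ (2 * s)).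
  by rewrite /y /lift big_ord_recr /= -/(lift w N) -/wN /omega -natr1; ring.
have nz : cnorm (Psi wN) = cnorm (Psi w) by exact: cnorm_Psi_iter.
have [h6 h7] := hL _ hw'.
have h8 : cnorm (Psi wN) < r1 by rewrite nz.
have := angle_shift_bound_lin alpha s0 ha hpsi h8; rewrite nz => h9.
have h10 : cnorm w ^+ (2 * s) <= cnorm w.
  by apply: ler_iXnr; rewrite ?muln_gt0 ?s0 //; nra.
have h11 : 0 <= cnorm w ^+ (2 * s) by rewrite exprn_ge0.
have h12 : 0 <= cnorm (Psi w) ^+ (2 * s) by rewrite exprn_ge0 ?cnorm_ge0.
have h13 : cnorm (Psi w) * (5 / 4) + cnorm w <= 1 / 8 by nra.
have h14 : `|y| <= 1 / 4.
  move: IH; rewrite yE; move: (lift w N - _) (eps _) h9 => u e h9 hu.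
  by move: hu h9; rewrite !ler_norml; case: (lerP 0 e) => he; [rewrite ger0_norm //|rewrite ltr0_norm //] => /andP[a1 a2] a3; apply/andP; split; lra.
(* [|y| <= 1/16 + 2 |y|^2] together with [|y| <= 1/4] gives back [|y| <= 1/8]. *)
have y2 : `|y| <= 1 / 2 by lra.
have := cis_sub1_ge y2; rewrite expr2; have := normr_ge0 y; nra.
Qed.

(** After [N] steps the lift and [N omega w] differ by at most 1/8. Division by a large [N] bounds
    the difference of the frequencies by the mean of the angle shifts. *)
Lemma drift_bound w : cnorm w <= rho2 -> w != 0 ->
  `|cnorm (Psi w) ^+ (2 * s) - cnorm w ^+ (2 * s)| <= 2 * Kc R s * cnorm (Psi w) ^+ (2 * s).+1.
Proof.
have [_ _ _ _ [_ hL _ _]] := hN; have [h1 h2 _ _] := hrho2.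
move=> hw w0; have hw' : cnorm w <= rho by lra.
have [_ pr] := hL _ hw'.
set D := _ - _; set c := 2 * _ * _.
have key (N : nat) : N%:R * `|D| <= 1 / 8 + N%:R * c.
  have h := lift_bound N hw w0.
  have e : N%:R * D = (lift w N - N%:R * omega w) - \sum_(j < N) eps (Psi (w * cis (j%:R * omega w))).
    rewrite /lift big_split /= sumr_const card_ord -[_ *+ N]mulr_natl /omega /D.
    by move: (\sum_(j < N) _) => S; ring.
  rewrite -[X in X * `|D|](ger0_norm (ler0n R N)) -normrM e.
  apply: le_trans (ler_normB _ _) _; apply: lerD => //.
  apply: le_trans (ler_norm_sum _ _ _) _.
  apply: (@le_trans _ _ (\sum_(j < N) c)); last by rewrite sumr_const card_ord -[c *+ N]mulr_natl.
  apply: ler_sum => j _; have nz := cnorm_Psi_iter j hw'.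
  have := @angle_shift_bound R s alpha a ha psi r1 hpsi (Psi (w * cis (j%:R * omega w))).
  by rewrite nz => /(_ pr).
rewrite leNgt; apply/negP => cD.
have g0 : 0 < `|D| - c by lra.
have h8 : 0 <= 1 / 8 / (`|D| - c) by rewrite divr_ge0 // ltW.
have := archi_boundP h8; rewrite ltr_pdivrMr //; have := key (Num.bound (1 / 8 / (`|D| - c))).
rewrite mulrBr; lra.
Qed.

End SmallRadius.
End InvariantCircles.

(** * Closed orbits and the theorem *)

Lemma conjc_polar (R : realType) (x t : R) : conjc (x%:C%C * cis t) = x%:C%C * cis (- t).
Proof. by rewrite [LHS]rmorphM; congr (_ * _); [exact: conjc_real|exact: conjc_cis]. Qed.

Section ClosedOrbits.
Variables (R : realType) (s : nat) (alpha : R) (a : idx -> R[i]).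
Local Notation C := R[i].
Hypotheses (s0 : (0 < s)%N) (ha : inSigma s a).
Local Notation twist := (twist_of a).
Variables (psi : C -> C) (r1 : R).
Hypothesis hpsi : inverse_radius s a psi r1.
Local Notation eps := (angle_shift s alpha a psi).
Variables (Phi Psi E : C -> C) (b : C) (K L rho0 rho2 : R).
Hypothesis hN : normal_form s alpha a psi r1 Phi Psi E b K L rho0.
Hypothesis hrho2 : [/\ 0 < rho2, rho2 < rho0, 64 * (K * rho2) <= cnorm b & 8 * ((2 * L + 1) * rho2) <= 1].

Variable q : nat.
Hypothesis hq : admissible s alpha q.
Local Notation R0 := (radius s alpha q).
Local Notation w0 := (freq alpha q).
Hypothesis R0_small : L ^+ 2 * R0 <= rho2.
Hypothesis R0_small' : 64 * (Kc R s * (L * R0)) <= rho R s.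

(** Radius of the image under [Psi] of the circle on which [T] has frequency [w0]. *)
Let r : R := cnorm (Psi R0%:C%C).

Lemma q_gt0 : (0 < q)%N.
Proof. by have [pq _ _ _ _] := hq; exact: prime_gt0. Qed.

Lemma R0_gt0 : 0 < R0.
Proof. exact: radius_gt0 q_gt0. Qed.

Lemma cnorm_R0 : cnorm (R0%:C%C : C) = R0.
Proof. by rewrite cnormR gtr0_norm // R0_gt0. Qed.

Lemma R0_bounds : R0 <= rho2 /\ R0 <= rho0.
Proof.
have [[_ _ L1] _ _ _ _] := hN; have [h1 h2 _ _] := hrho2; have r0 := R0_gt0.
have h : R0 <= L ^+ 2 * R0 by apply: ler_peMl; [exact: ltW|exact: exprn_ege1].
by have := R0_small; lra.
Qed.

Lemma r_bounds : [/\ 0 < r, r < r1, r <= L * R0 & r <= 1 / 8].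
Proof.
have [_ b0 _ _ [_ hL _ _]] := hN; have [h1 h2] := R0_bounds.
have [h3 h4] : r <= L * R0 /\ r < r1 by rewrite /r -{2}cnorm_R0; apply: hL; rewrite cnorm_R0.
have h5 := Psi_lower hN hrho2 (w := R0%:C%C).
have h6 : 0 < cnorm b * R0 by rewrite mulr_gt0 ?cnorm_gt0 ?R0_gt0.
split => //; last by have /andP[_] := r1_bounds hpsi; lra.
by move: h5; rewrite cnorm_R0 -/r => /(_ h1); lra.
Qed.

Lemma Kc_r : 64 * (Kc R s * r) <= rho R s.
Proof.
have [_ _ h _] := r_bounds; apply: le_trans R0_small'.
by rewrite ler_pM2l // ler_wpM2l //; have := Kc_ge1 R s; lra.
Qed.

Lemma circle_drift : `|r ^+ (2 * s) - R0 ^+ (2 * s)| <= 2 * Kc R s * r ^+ (2 * s).+1.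
Proof.
have [h1 h2] := R0_bounds; rewrite -[X in _ - X ^+ _]cnorm_R0.
apply: (drift_bound s0 ha hpsi hN hrho2); first by rewrite cnorm_R0.
by apply/eqP => e; have := cnorm_R0; rewrite e cnorm0; have := R0_gt0; lra.
Qed.

Lemma Kc2r_small : 0 < 2 * Kc R s * r <= 1 / 4.
Proof.
have h := Kc_r; have h1 := rho_le R s0; have [h2 _ _ _] := r_bounds.
by apply/andP; split; [rewrite !mulr_gt0 //; have := Kc_ge1 R s; lra|lra].
Qed.

Lemma q_r_pow : q%:R * r ^+ (2 * s) <= 16.
Proof.
have h := circle_drift; have /andP[x0 x1] := Kc2r_small; have [r0 _ _ _] := r_bounds.
have hR := radius_q alpha s0 q_gt0.
move: h; rewrite exprS mulrA ler_norml => /andP[_ h].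
have p0 : 0 <= r ^+ (2 * s) by rewrite exprn_ge0 // ltW.
have h3 : 2 * Kc R s * r * r ^+ (2 * s) <= 1 / 4 * r ^+ (2 * s) by rewrite ler_wpM2r.
have h4 : r ^+ (2 * s) <= 2 * R0 ^+ (2 * s) by lra.
have : q%:R * r ^+ (2 * s) <= q%:R * (2 * R0 ^+ (2 * s)) by rewrite ler_wpM2l.
lra.
Qed.

(** Places the radius in the ball where the fixed point is unique. The drift bound gives the ratio
    of [r^(2s)] to [R0^(2s)] up to a relative error [2 Kc r], and [1 + x <= exp x] at both signs of
    the exponent turns this into a bound on the logarithm. *)
Lemma log_radius_bound : `|ln (r / R0)| <= rho R s.
Proof.
have h := circle_drift; have /andP[x0 x1] := Kc2r_small; have [r0 _ _ _] := r_bounds.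
have hk := Kc_r; have R00 := R0_gt0; have rR : 0 < r / R0 by rewrite divr_gt0.
set t := ln _; have et : expR t = r / R0 by rewrite lnK // posrE.
have X0 : 0 < r ^+ (2 * s) by rewrite exprn_gt0.
have Y0 : 0 < R0 ^+ (2 * s) by rewrite exprn_gt0.
have eX : expR ((2 * s)%:R * t) * R0 ^+ (2 * s) = r ^+ (2 * s).
  by rewrite expRM_natl et expr_div_n divfK // gt_eqF.
have eY : expR (- ((2 * s)%:R * t)) * r ^+ (2 * s) = R0 ^+ (2 * s).
  by rewrite -eX mulrA expRN mulVf ?mul1r // gt_eqF // expR_gt0.
have f1 := expR_ge1Dx ((2 * s)%:R * t); have f2 := expR_ge1Dx (- ((2 * s)%:R * t)).
have s1 : 1 <= (2 * s)%:R :> R by rewrite ler1n muln_gt0 s0.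
move: h; rewrite exprS mulrA; set x := 2 * Kc R s * r in x0 x1 *.
have xr : 2 * x <= rho R s by move: x0; rewrite /x; lra.
rewrite ler_norml => /andP[h1 h2].
set T := (2 * s)%:R * t in eX eY f1 f2.
have g1 : - T <= x.
  have : (1 + - T) * r ^+ (2 * s) <= (1 + x) * r ^+ (2 * s).
    apply: (@le_trans _ _ (R0 ^+ (2 * s))); last by lra.
    by rewrite -eY ler_pM2r.
  by rewrite ler_pM2r //; lra.
have g2 : T <= 2 * x.
  have h3 : (1 + T) * R0 ^+ (2 * s) <= r ^+ (2 * s) by rewrite -eX ler_pM2r.
  have h4 : (1 - x) * r ^+ (2 * s) <= R0 ^+ (2 * s) by lra.
  have h5 : (1 - x) * (1 + T) * R0 ^+ (2 * s) <= R0 ^+ (2 * s).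
    by rewrite -mulrA; apply: le_trans h4; rewrite ler_wpM2l //; lra.
  have h6 : (1 - x) * (1 + T) <= 1 by rewrite -(ler_pM2r Y0) mul1r.
  nra.
have tT : `|t| <= `|T| by rewrite /T normrM ger0_norm // ler_peMl.
by apply: (le_trans tT); rewrite ler_norml; apply/andP; split; lra.
Qed.

Section Angle.
Variable th0 : R.

(* [z0] is the point of the invariant circle of radius [r] for which [v_0] has angle [th0];
   [th j] is a continuous lift of the angle of [v_j] along its orbit [z_j] *)
Let v0 : C := r%:C%C * cis th0.
Let z0 : C := conjc (phi_a s a v0).
Let w : C := Phi z0.
Let om : R := alpha + r ^+ (2 * s).
Let zj (j : nat) : C := Psi (w * cis (j%:R * w0)).
Let vj (j : nat) : C := psi (conjc (zj j)).
Let uj (j : nat) : C := conjc (vj j) * cis om.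
Let th (j : nat) : R := th0 + twist v0 - lift s alpha a psi Psi w j - twist (vj j).

Lemma cnorm_v0 : cnorm v0 = r.
Proof. by have [r0 _ _ _] := r_bounds; rewrite cnormM cnormR cnorm_cis mulr1 gtr0_norm. Qed.

Lemma v0_le : cnorm v0 <= 1 / 8.
Proof. by rewrite cnorm_v0; have [] := r_bounds. Qed.

Lemma z0E : z0 = conjc v0 * cis (- twist v0).
Proof.
rewrite /z0 phi_twist //; last exact: v0_le.
by rewrite [LHS]rmorphM; congr (_ * _); exact: conjc_cis.
Qed.

Lemma cnorm_z0 : cnorm z0 = r.
Proof. by rewrite z0E cnormM cnorm_cis cnorm_conj mulr1 cnorm_v0. Qed.

(** [|Psi w| = r = |Psi R0|], so injectivity of the modulus gives [|w| = R0]; it applies because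
    [|w| <= L r <= L^2 R0 <= rho2]. *)
Lemma w_facts : [/\ cnorm w = R0, Psi w = z0, cnorm w <= rho0, w != 0 & omega s alpha w = w0].
Proof.
have [[_ _ L1] _ _ _ [_ _ _ hP]] := hN; have [r0 rr1 rL r8] := r_bounds; have [h1 h2] := R0_bounds.
have hz : cnorm z0 <= L * rho0 by rewrite cnorm_z0 (le_trans rL) // ler_wpM2l //; lra.
have [h3 h4] := hP _ hz; rewrite cnorm_z0 -/w in h3.
have h5 : cnorm w <= rho2.
  apply: le_trans h3 _; apply: le_trans R0_small; rewrite expr2 -mulrA ler_wpM2l //; lra.
have wR : cnorm w = R0.
  rewrite -cnorm_R0; apply: (modulus_inj s0 ha hpsi hN hrho2) => //; first by rewrite cnorm_R0.
  by rewrite h4 cnorm_z0.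
split => //; first by rewrite wR.
  by apply/eqP => e; have := wR; rewrite e cnorm0; have := R0_gt0; lra.
by rewrite /omega wR (radius_pow alpha s0 q_gt0); ring.
Qed.

Lemma zjE j : zj j = z0 * cis (lift s alpha a psi Psi w j).
Proof.
have [_ <- wr _ ow] := w_facts.
by rewrite -(Psi_iter ha hpsi hN j wr) ow.
Qed.

Lemma cnorm_zj j : cnorm (zj j) = r.
Proof. by rewrite zjE cnormM cnorm_cis mulr1 cnorm_z0. Qed.

Lemma vjE j : vj j = r%:C%C * cis (th j).
Proof.
have [_ rr1 _ _] := r_bounds.
have zr : cnorm (zj j) < r1 by rewrite cnorm_zj.
have [_ e _] := varphi_cis ha alpha hpsi zr; rewrite -/(vj j) in e.
have e2 : conjc (vj j) = r%:C%C * cis (- th j).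
  apply: (mulIf (cis_neq0 (- twist (vj j)))); rewrite -e zjE z0E /v0.
  rewrite conjc_polar -!mulrA -!cisD.
  by congr (_ * cis _); rewrite /th; ring.
by rewrite -[LHS]conjcK e2 conjc_polar opprK.
Qed.

Lemma ujE j : uj j = r%:C%C * cis (om - th j).
Proof.
by rewrite /uj vjE conjc_polar -mulrA -cisD [om - _]addrC.
Qed.

Lemma v_0 : vj 0 = v0.
Proof.
have [_ rr1 _ _] := r_bounds; have [_ hp] := hpsi.
have vr : cnorm v0 < r1 by rewrite cnorm_v0.
have [_ _ <-] := hp _ vr.
rewrite /vj zjE /lift big_ord0 cis0 mulr1 /z0 conjcK.
by have [_ _ ->] := hp _ vr.
Qed.

(** [q w0] is a multiple of [2 pi], so the orbit of [z0] closes after [q] steps and the lift is some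
    [2 pi k]. Its distance to [2 pi pnum q] is at most 1/8, which fixes the number of turns. *)
Lemma lift_closed : lift s alpha a psi Psi w q = q%:R * w0.
Proof.
have [wR wz wr wn ow] := w_facts; have [h1 _] := R0_bounds.
have h : cnorm w <= rho2 by rewrite wR.
have := lift_bound s0 ha hpsi hN hrho2 q h wn; rewrite ow.
have e : z0 * cis (lift s alpha a psi Psi w q) = z0.
  rewrite -zjE /zj (freqM alpha q_gt0) cis_2piz mulr1 wz.
  by [].
have zn : z0 != 0.
  by apply/eqP => e0; have := cnorm_z0; rewrite e0 cnorm0; have [r0 _ _ _] := r_bounds; lra.
have /cis_eq1 [k ->] : cis (lift s alpha a psi Psi w q) = 1 by apply: (mulfI zn); rewrite e mulr1.
rewrite (freqM alpha q_gt0) -mulrBr -intrB => hk.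
suff : (k - pnum alpha q == 0)%R by rewrite subr_eq0 => /eqP ->.
apply: contraTT hk => kn; rewrite -ltNge normrM gtr0_norm ?pi2_gt0 // -intr_norm.
have h2 : 1 <= (`|k - pnum alpha q|%:~R : R) by rewrite (ler_int R 1) -gtz0_ge1 normr_gt0.
by have := @pi_ge2 R; nra.
Qed.

Lemma th_0 : th 0 = th0.
Proof. by rewrite /th v_0 /lift big_ord0; ring. Qed.

Lemma th_q : th q = th0 - q%:R * w0.
Proof.
have vq : vj q = v0.
  by rewrite -v_0 /vj !zjE lift_closed (freqM alpha q_gt0) cis_2piz /lift big_ord0 cis0.
by rewrite /th vq lift_closed; ring.
Qed.

Definition gj (j : nat) : R := twist (uj j) + twist (vj j.+1).

(** A step of the lift contains [twist] at [v_j]; passing from the angles of the [z_j] to those of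
    the [v_j] trades it for [twist] at [v_(j+1)]. *)
Lemma gjE j : gj j = th j - th j.+1 - om.
Proof.
have hz := cnorm_zj j; have [_ wz _ _ ow] := w_facts.
rewrite /th /lift big_ord_recr /= -/(lift s alpha a psi Psi w j) ow -/(zj j) wz cnorm_z0 -/om.
by rewrite /angle_shift hz -/om -/(vj j) -/(uj j) /gj; ring.
Qed.

Lemma sum_gj k : \sum_(i < k) gj i = th0 - th k - k%:R * om.
Proof.
elim: k => [|k IH]; first by rewrite big_ord0 th_0; ring.
by rewrite big_ord_recr /= IH gjE -natr1; ring.
Qed.

Definition ystate (j : nat) : C :=
  if j is k.+1 then (if (k <= q)%N then (th k - th0 + k%:R * w0)%:C%C else 0) else (ln (r / R0))%:C%C.

Lemma expR_log : expR (ln (r / R0)) = r / R0.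
Proof.
have [r0 _ _ _] := r_bounds.
by rewrite lnK // posrE divr_gt0 // R0_gt0.
Qed.

Lemma hval_real c e : hval R0 a (ln (r / R0))%:C%C c e%:C%C = (twist (r%:C%C * cis (c + e)))%:C%C.
Proof.
have [r0 _ _ r8] := r_bounds; have R00 := R0_gt0.
have rR : R0%:C%C * (expR (ln (r / R0)))%:C%C = r%:C%C :> C.
  by rewrite -rmorphM /= expR_log mulrC divfK // gt_eqF.
have e1 : R0%:C%C * cis c * cexp ((ln (r / R0))%:C%C + iC R * e%:C%C) = r%:C%C * cis (c + e).
  by rewrite cexpD cexp_real cexp_iC cisD -rR; ring.
have e2 : R0%:C%C * cis (- c) * cexp ((ln (r / R0))%:C%C - iC R * e%:C%C) = conjc (r%:C%C * cis (c + e)).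
  rewrite conjc_polar opprD cisD -mulrN -rmorphN.
  by rewrite cexpD cexp_real cexp_iC -rR; ring.
rewrite /hval e1 e2 (psum_sigma_real ha) //.
by rewrite cnormM cnorm_cis mulr1 cnormR gtr0_norm.
Qed.

Lemma dfreq_real : dfreq s R0 (ln (r / R0))%:C%C = (om - w0)%:C%C.
Proof.
have R00 := R0_gt0.
have one : (1 : C) = (1 : R)%:C%C by [].
rewrite /dfreq cexpMn cexp_real expR_log -rmorphXn one -rmorphB -rmorphM /=; congr (_%:C)%C.
rewrite expr_div_n mulrBr mulr1 mulrC divfK; last by rewrite expf_neq0 // gt_eqF.
by rewrite (radius_pow alpha s0 q_gt0) /om; ring.
Qed.

Lemma gterm_ystate i : (i < q)%N -> gterm s R0 w0 th0 a ystate i = (gj i)%:C%C.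
Proof.
move=> iq; rewrite /gterm /ystate (ltnW iq) iq dfreq_real.
rewrite -rmorphB !hval_real -rmorphD /=; congr (_%:C)%C.
rewrite /gj ujE vjE; congr (twist (_ * cis _) + twist (_ * cis _)).
  by ring.
by ring.
Qed.

(** The sum telescopes to [th0 - th q - q om], and [th q = th0 - q w0] expresses the closing after
    [pnum q] turns. *)
Lemma gmean_ystate : gmean s q R0 w0 th0 a ystate = (w0 - om)%:C%C.
Proof.
rewrite /gmean (eq_bigr (fun i : 'I_q => (gj i)%:C%C)) => [|i _]; last exact: gterm_ystate.
rewrite -rmorph_sum sum_gj th_q -[q%:R^-1](_ : (q%:R^-1)%:C%C = _); last first.
  by rewrite fmorphV rmorph_nat.
rewrite -rmorphM /=; congr (_%:C)%C.
have q0 : q%:R != 0 :> R by rewrite pnatr_eq0 -lt0n q_gt0.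
by field.
Qed.

Lemma ostep_ystate j : ostep s q R0 w0 th0 a ystate j = ystate j.
Proof.
have R00 := R0_gt0; case: j => [|k].
  rewrite /ostep gmean_ystate /ystate cexpMn cexp_real expR_log.
  set t := ln _.
  have -> : (2 * s)%:R = ((2 * s)%:R : R)%:C%C :> C by rewrite rmorph_nat.
  have one : (1 : C) = (1 : R)%:C%C by [].
  rewrite -rmorphXn one -rmorphM -!rmorphB -fmorphV -rmorphM -rmorphM -rmorphN -rmorphB /=.
  congr (_%:C)%C; have <- : R0 ^+ (2 * s) + alpha = w0 by rewrite (radius_pow alpha s0 q_gt0); ring.
  have s20 : (2 * s)%:R != 0 :> R by rewrite pnatr_eq0 muln_eq0 /= -lt0n.
  have Rn : R0 ^+ (2 * s) != 0 by rewrite expf_neq0 // gt_eqF.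
  rewrite /om expr_div_n; move: (r ^+ _) (R0 ^+ _) (2 * s)%:R s20 Rn => x y n n0 y0.
  by field; rewrite n0 y0.
rewrite /ostep gmean_ystate /ystate; case: ifP => // kq.
rewrite (eq_bigr (fun i : 'I_k => (gj i)%:C%C)); last first.
  by move=> i _; apply: gterm_ystate; apply: leq_trans kq.
rewrite -rmorph_sum sum_gj -[k%:R](_ : (k%:R)%:C%C = _); last by rewrite rmorph_nat.
by rewrite -rmorphM -rmorphB /=; congr (_%:C)%C; ring.
Qed.

Lemma gj_bound j : `|gj j| <= 2 * Kc R s * r ^+ (2 * s).+1.
Proof.
have [r0 _ _ r8] := r_bounds.
have nv : cnorm (vj j.+1) <= r by rewrite vjE cnormM cnorm_cis mulr1 cnormR gtr0_norm.
have nu : cnorm (uj j) <= r by rewrite ujE cnormM cnorm_cis mulr1 cnormR gtr0_norm.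
apply: le_trans (ler_normD _ _) _.
have := twist_bound ha nv r8; have := twist_bound ha nu r8; lra.
Qed.

(** A deviation after [k <= q] steps is made of [2 k] quantities of size at most [2 Kc r^(2s+1)]. As
    [q r^(2s) <= 16], their total is at most [64 Kc r <= rho]. *)
Lemma ystate_bound j : cnorm (ystate j) <= rho R s.
Proof.
case: j => [|k]; first by rewrite /ystate cnormR; exact: log_radius_bound.
rewrite /ystate; case: ifP => kq; last by rewrite cnorm0 ltW // rho_gt0.
rewrite cnormR; set X := 2 * Kc R s * r ^+ (2 * s).+1.
have [r0 _ _ _] := r_bounds; have K1 := Kc_ge1 R s.
have r00 : 0 <= r by exact: ltW.
have K0' : 0 <= 2 * Kc R s by lra.
have X0 : 0 <= X by rewrite mulr_ge0 ?exprn_ge0.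
have e : th k - th0 + k%:R * w0 = k%:R * (w0 - om) - \sum_(i < k) gj i by rewrite sum_gj; ring.
have f1 : `|w0 - om| <= X.
  have := circle_drift; rewrite (radius_pow alpha s0 q_gt0) distrC.
  by rewrite (_ : w0 - om = w0 - alpha - r ^+ (2 * s)) // /om; ring.
have kX : k%:R * X <= q%:R * X by rewrite ler_wpM2r // ler_nat.
have f2 : `|\sum_(i < k) gj i| <= k%:R * X.
  apply: le_trans (ler_norm_sum _ _ _) _.
  apply: (@le_trans _ _ (\sum_(i < k) X)); last by rewrite sumr_const card_ord -[X *+ k]mulr_natl.
  by apply: ler_sum => i _; exact: gj_bound.
have f3 : `|k%:R * (w0 - om)| <= k%:R * X by rewrite normrM ger0_norm // ler_wpM2l.
rewrite e; apply: le_trans (ler_normB _ _) _.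
have f4 : q%:R * X <= 32 * (Kc R s * r).
  rewrite /X exprS (_ : q%:R * _ = (q%:R * r ^+ (2 * s)) * (2 * (Kc R s * r))); last by ring.
  rewrite (_ : 32 * _ = 16 * (2 * (Kc R s * r))); last by ring.
  by rewrite ler_wpM2r ?q_r_pow // mulrA mulr_ge0.
have := Kc_r; lra.
Qed.

(** The right-hand side is free of [th0], which makes the two starting angles agree. *)
Lemma osol_circle : osol s q R0 w0 th0 a = (ln (r / R0))%:C%C.
Proof.
have [_ _ _ hr _] := hq.
exact: (osol_uniq s0 q_gt0 R0_gt0 hr (radius_q alpha s0 q_gt0) ler01 (lexx 1) (sigma_coef ha)
  ostep_ystate ystate_bound).
Qed.

End Angle.

Lemma resonance_zero : resonance s alpha q a = 0.
Proof. by rewrite /resonance (sigma_trunc ha) !osol_circle subrr. Qed.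

End ClosedOrbits.

Section EventualVanishing.
Variables (R : realType) (s : nat) (alpha : R) (a : idx -> R[i]).
Hypotheses (s0 : (0 < s)%N) (ha : inSigma s a).
Hypothesis halpha : forall q : rat, alpha / (2 * (pi : R)) != ratr q.

(** The constants of the normal form depend on the conjugacy but not on [q], and the resonant radii
    tend to 0, so all large [q] meet the smallness conditions. *)
Lemma resonance_eventually_zero psi : local_inverse (phi_a s a) psi ->
  analytically_conjugate (varphi_a s alpha a psi) (Tmap s alpha) ->
  exists Q, forall q, (Q <= q)%N -> admissible s alpha q -> resonance s alpha q a = 0.
Proof.
move=> /(inverse_radius_ex ha) [r1 hpsi] hconj.
have [Phi [Psi [E [b [K [L [rho0 hN]]]]]]] := normal_form_ex s0 ha halpha hpsi hconj.
have [[r00 K0 L1] b0 _ _ _] := hN; have bp := cnorm_gt0 b0.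
have K64 : 0 < 64 * (K + 1) by lra.
have L8 : 0 < 8 * (2 * L + 1) by lra.
pose rho2 := Num.min (rho0 / 2) (Num.min (cnorm b / (64 * (K + 1))) (1 / (8 * (2 * L + 1)))).
have p0 : 0 < rho2 by rewrite !lt_min !divr_gt0.
have [p1 p2 p3] : [/\ rho2 <= rho0 / 2, rho2 <= cnorm b / (64 * (K + 1)) & rho2 <= 1 / (8 * (2 * L + 1))].
  by rewrite !ge_min !lexx !orbT.
have hrho2 : [/\ 0 < rho2, rho2 < rho0, 64 * (K * rho2) <= cnorm b & 8 * ((2 * L + 1) * rho2) <= 1].
  split => //; first by lra.
    by move: p2; rewrite ler_pdivlMr //; lra.
  by move: p3; rewrite ler_pdivlMr //; lra.
have L20 : 0 < L ^+ 2 by rewrite exprn_gt0 //; lra.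
have KL : 0 < 64 * (Kc R s * L) by have := Kc_ge1 R s; nra.
pose d := Num.min (rho2 / L ^+ 2) (rho R s / (64 * (Kc R s * L))).
have d0 : 0 < d by rewrite lt_min !divr_gt0 ?rho_gt0.
have [Q hQ] := radius_small alpha s0 d0; exists Q => q /hQ hq aq.
have h1 : L ^+ 2 * radius s alpha q <= rho2.
  by rewrite mulrC -ler_pdivlMr // (le_trans hq) // ge_min lexx.
have h2 : 64 * (Kc R s * (L * radius s alpha q)) <= rho R s.
  rewrite (_ : _ * _ = radius s alpha q * (64 * (Kc R s * L))); last by ring.
  by rewrite -ler_pdivlMr // (le_trans hq) // ge_min lexx orbT.
exact: (resonance_zero s0 ha hpsi hN hrho2 aq h1 h2).
Qed.

End EventualVanishing.

Theorem theorem1p1 (R : realType) (s : nat) (alpha : R) :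
  (0 < s)%N ->
  (forall q : rat, alpha / (2 * (pi : R)) != ratr q) ->
  exists H : nat -> fpseries R,
    (forall k, pseries_ok s (H k)) /\
    seq_fun_independent s H /\
    (forall k (a : idx -> R[i]), inSigma s a -> ps_converges (H k) a) /\
    (forall a : idx -> R[i], inSigma s a ->
       infinite_set [set k | ps_nonzero_at (H k) a] ->
       (exists psi, local_inverse (phi_a s a) psi) /\
       (forall psi, local_inverse (phi_a s a) psi ->
          ~ analytically_conjugate (varphi_a s alpha a psi) (Tmap s alpha))).
Proof.
move=> s0 halpha; have [u [u_inj u_ge u_adm]] := admissible_seq alpha s0.
have [H hH] := @boolp.choice _ _ _ (fun k => resonance_series s0 (u_adm k)).
exists H; split; [|split; [|split]].
- by move=> k; have [[]] := hH k.
- move=> n k k_inj; apply: (@fun_independent_diag R s n _ (fun p => (u (k p), 0)%N)).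
  + by move=> p r [] /u_inj /k_inj.
  + by move=> p; have [_ h _ _ _] := u_adm (k p); rewrite /in_idx /= addn0.
  + move=> p r; have [_ ->] := hH (k p); last exact: u_adm.
    by rewrite (inj_eq u_inj) (inj_eq k_inj).
- move=> k a /sigma_polydisc ha; have [[_ hB _] _] := hH k.
  by exists (rho R s); exact: (@bounded_sum_eval R mono (H k) id a _ ha hB).
- move=> a ha hinf; split; first exact: phi_local_inverse.
  move=> psi hpsi hconj; have [Q hQ] := resonance_eventually_zero s0 ha halpha hpsi hconj.
  (* As [k <= u k], every [k] with [H k] nonzero at [a] lies below [Q]. *)
  apply: hinf; apply: sub_finite_set (finite_II Q) => k [v [hv vn0]] /=.
  rewrite ltnNge; apply/negP => Qk; move/eqP: vn0; apply.
  have [[_ _ hs] _] := hH k.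
  have := has_sum_uniq (hs a (sigma_polydisc ha)) hv.
  by rewrite hQ ?(leq_trans Qk).
Qed.
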